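(* Let $G$ be a planar graph without chordal $4$-cycles and without chordal $6$-cycles, and let $k$ be an integer with $k\geq\max\{7,\Delta(G)\}$. Then $G$ is equitably $k$-colorable.
   Context: Graphs are finite and simple; $\Delta(G)$ denotes the maximum degree of $G$. A cycle $C$ of length $k$ in $G$ is called a chordal $k$-cycle if there exists an edge $xy\in E(G)\setminus E(C)$ with $x,y\in V(C)$. A proper $k$-coloring of $G$ is a map $\pi:V(G)\to\{1,\dots,k\}$ with $\pi(x)\neq\pi(y)$ for every edge $xy\in E(G)$. $G$ is equitably $k$-colorable if it has a proper $k$-coloring such that the sizes of the $k$ color classes differ pairwise by at most $1$; equivalently, $V(G)$ can be partitioned into $k$ (possibly empty) independent subsets $V_1,\dots,V_k$ with $\bigl||V_i|-|V_j|\bigr|\leq 1$ for all $1\leq i,j\leq k$. *)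

(* Defs.v *)
From HB Require Import structures.
From mathcomp Require Import all_boot all_order all_algebra.
From mathcomp Require Import mathcomp_extra boolp classical_sets set_interval.
From mathcomp Require Import reals topology normedtype.

Set Implicit Arguments.
Unset Strict Implicit.
Unset Printing Implicit Defensive.

Import Order.TTheory GRing.Theory Num.Theory.
Import numFieldNormedType.Exports.

Definition simple_graph (T : finType) (e : rel T) : Prop :=
  symmetric e /\ irreflexive e.

Definition degree (T : finType) (e : rel T) (x : T) : nat :=
  #|[set y | e x y]|.

Definition max_degree (T : finType) (e : rel T) : nat :=
  \max_(x : T) degree e x.

(* A cycle of length k is given by the sequence of its vertices in cyclic     *)
(* order; its edges join each vertex to its cyclic successor.                 *)
Definition graph_cycle (T : finType) (e : rel T) (k : nat) (c : seq T) : bool :=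
  [&& 3 <= k, size c == k & ucycleb e c].

Definition cycle_edge (T : finType) (c : seq T) (x y : T) : bool :=
  [&& x \in c, y \in c & (y == next c x) || (x == next c y)].

Definition chordal_cycle (T : finType) (e : rel T) (k : nat) (c : seq T) : Prop :=
  graph_cycle e k c /\
  exists x y : T, [/\ x \in c, y \in c, e x y & ~~ cycle_edge c x y].

Definition equitably_colorable (T : finType) (e : rel T) (k : nat) : Prop :=
  exists f : T -> 'I_k,
    (forall x y : T, e x y -> f x != f y) /\
    (forall i j : 'I_k,
       #|[set x | f x == i]| <= #|[set x | f x == j]|.+1).

Local Open Scope classical_set_scope.
Local Open Scope ring_scope.

(* A drawing in the plane R * R (with the product topology): [p x] is the     *)
(* point representing the vertex x, and [a x y] parametrizes by [0, 1] the    *)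
(* simple arc representing the edge xy, traversed from x to y.  An edge has   *)
(* two orientations; they parametrize the same arc, in opposite directions.   *)
(* The values of [a x y] when xy is not an edge are irrelevant.               *)
Record plane_drawing (R : realType) (T : finType) (e : rel T)
    (p : T -> R * R) (a : T -> T -> R -> R * R) : Prop := PlaneDrawing {
  drawing_vertex_inj : injective p;
  drawing_arc_continuous : forall x y : T, e x y ->
    {within `[0, 1], continuous (a x y)};
  drawing_arc_inj : forall x y : T, e x y ->
    {in `[0, 1] &, injective (a x y)};
  drawing_arc_source : forall x y : T, e x y -> a x y 0 = p x;
  drawing_arc_target : forall x y : T, e x y -> a x y 1 = p y;
  drawing_arc_rev : forall x y : T, e x y ->
    {in `[0, 1], forall t : R, a y x t = a x y (1 - t)};
  drawing_arc_vertex : forall x y z : T, e x y ->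
    {in `]0, 1[, forall t : R, a x y t <> p z};
  drawing_arc_disjoint : forall x y x' y' : T, e x y -> e x' y' ->
    [set x; y]%SET != [set x'; y']%SET ->
    {in `]0, 1[ &, forall s t : R, a x y s <> a x' y' t}
}.

Definition planar (R : realType) (T : finType) (e : rel T) : Prop :=
  exists (p : T -> R * R) (a : T -> T -> R -> R * R), plane_drawing e p a.

(* Main.v *)
Require Import Defs.
From HB Require Import structures.
From mathcomp Require Import all_boot all_order all_algebra.
From mathcomp Require Import boolp reals zify.
From mathcomp Require mathcomp_extra classical_sets set_interval.
From mathcomp Require prodnormedzmodule topology normedtype derive lra.

Set Implicit Arguments.
Unset Strict Implicit.
Unset Printing Implicit Defensive.

(** The coloring argument sees the graph only through its numbers of edges.
    Call a graph sparse if every set X of at least two vertices spans at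
    most 2|X| - 3 edges. The theorem is the conjunction of planar_sparse (a
    planar graph without chordal 4-cycles and 6-cycles is sparse) and of
    equitable_exists (a sparse graph with all degrees at most k, where k >=
    7, is equitably k-colorable).

    Sparsity. In a smallest vertex set X that spans too many edges, every
    edge cut has at least three edges, so that two faces share at most one
    edge. The forbidden chords then leave few ways for short faces to be
    adjacent: two triangles, two quadrilaterals, or a triangle and a
    pentagon never share an edge, and a quadrilateral meets at most one
    triangle. Give each face its length minus 4 as a charge, and let a
    triangle receive 1/3 through each of its sides and a quadrilateral 1/9
    through each side that lies on a longer face. No face ends with a
    negative charge (face_charge), so 4|F| <= 2|E| (face_count); with the
    Euler bound |F| >= |E| - |X| + 2 (euler_bound) this gives |E| <= 2|X| -
    4, against the choice of X.

    Faces. The arcs of a drawing are arbitrary continuous curves, so the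
    faces are constructed combinatorially. On a fine enough square grid, the
    grid points close to the arcs exhibit the graph as a minor of the grid
    (drawing_grid_model). In the grid, an even edge set is the boundary of a
    set of cells, namely of the cells that have an odd number of its
    vertical edges on their left (even_chain_cells). Contracting and
    deleting edges of the grid amounts to deleting and contracting edges of
    its dual, so the minor inherits a dual in the sense of Whitney
    (grid_faces): every side of every edge has a face, and the even edge
    sets are exactly the boundaries of sets of faces. All that is needed of
    faces follows by linear algebra modulo 2: the Euler bound counts even
    edge sets, and two edges with the same two faces belong to the same
    cycles, hence form an edge cut.

    Coloring. Work with proper colorings by k colors whose classes have at
    most t vertices; when there are kt vertices, such a coloring is
    equitable. Color all vertices but one vertex x of degree at most 3. If x
    cannot be added, even after moving vertices from class to class towards
    a class with fewer than t vertices, then the classes from which such a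
    class can be reached are at most three, and each of them contains a
    neighbour of every vertex outside of these classes
    (blocked_or_capped_colorable). That forces many edges, which is already
    absurd if the graph has few of them (few_edges_capped_colorable).
    Otherwise a deficient class contains a vertex u having two nonadjacent
    neighbours p and q with no further neighbour in that class. Exchanging u
    for p and q fills up the reachable classes, and what is left has so few
    edges that the remaining colors suffice (peel); at most two such
    exchanges are needed (middle_capped_colorable,
    sparse_capped_colorable). *)

(** * Connected vertex sets *)

Section RelIn.
Variables (V : finType) (r : rel V).
Hypothesis r_sym : symmetric r.

Definition rel_in (A : {set V}) :
  rel V := [rel u v | [&& u \in A, v \in A & r u v]].

Definition connected_in (A : {set V}) : Prop :=
  forall u v, u \in A -> v \in A -> connect (rel_in A) u v.

Lemma rel_in_sym A : symmetric (rel_in A).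
Proof. by move=> u v; rewrite /rel_in /= r_sym andbCA. Qed.

Lemma connect_rel_in_sym A u v :
  connect (rel_in A) u v = connect (rel_in A) v u.
Proof. exact: (sym_connect_sym (rel_in_sym A)). Qed.

Lemma connect_rel_inS (A B : {set V}) u v : A \subset B ->
  connect (rel_in A) u v -> connect (rel_in B) u v.
Proof.
move=> /subsetP AB; apply: connect_sub => x y /= /and3P[xA yA xy].
by apply: connect1; rewrite /rel_in /= !AB.
Qed.

(** Cutting a path just before it enters Z gives a connected set that avoids Z
    and is joined to Z by an edge; this is how the part of a curve near one
    endpoint is separated from the vertices near the other. *)
Lemma path_prefix (L Z : {set V}) u0 s : path (rel_in L) u0 s ->
  u0 \in L -> u0 \notin Z -> last u0 s \in Z ->
  exists P : {set V}, [/\ u0 \in P, P \subset L, [disjoint P & Z],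
    (forall u, u \in P -> connect (rel_in P) u0 u) &
    exists u v, [/\ u \in P, v \in Z & r u v]].
Proof.
elim: s u0 => [|v s IH] u0 /=; first by move=> _ _ /negPf->.
case/andP=> /and3P[_ vL uv] ps u0L u0Z lZ.
have [vZ|vZ] := boolP (v \in Z).
  exists [set u0]; split; rewrite ?set11 ?sub1set ?disjoints1 //.
    by move=> u /set1P->.
  by exists u0, v; rewrite set11.
have [P [vP PL PZ cP [u [w [uP wZ uw]]]]] := IH v ps vL vZ lZ.
exists (u0 |: P); split.
- exact: setU11.
- by rewrite subUset sub1set u0L.
- by rewrite disjoints_subset subUset sub1set inE u0Z -disjoints_subset.
- have PS : P \subset u0 |: P by apply: subsetUr.
  have u0v : connect (rel_in (u0 |: P)) u0 v.
    by apply: connect1; rewrite /rel_in /= !inE eqxx vP orbT.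
  move=> t /setU1P[->|tP]; first exact: connect0.
  exact: connect_trans u0v (connect_rel_inS PS (cP t tP)).
- by exists u, w; rewrite inE uP orbT.
Qed.
End RelIn.

(** * Edge sets modulo 2 *)

Section Chains.
Variable (V : finType).
Implicit Types (c d : V -> V -> bool) (A : {set V}) (r : rel V).

(** Edge sets are represented by symmetric boolean functions of two vertices;
    their sum is the exclusive or. The boundary of an edge set consists of the
    vertices of odd degree, so even edge sets, the elements of the cycle
    space, are those with boundary zero. *)
Definition boundary c (x : V) : bool := \big[addb/false]_y c x y.

Lemma xor_delta (v : V) (F : V -> bool) :
  \big[addb/false]_y ((y == v) && F y) = F v.
Proof.
rewrite (bigD1 v) //= eqxx big1 ?addbF // => y /negPf->.
by [].
Qed.

Lemma xor_distr (I : finType) (b : bool) (F : I -> bool) :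
  \big[addb/false]_i (b && F i) = b && \big[addb/false]_i F i.
Proof. by case: b => //=; rewrite big1. Qed.

Lemma boundaryD c d x : boundary (fun x y => c x y (+) d x y) x =
  boundary c x (+) boundary d x.
Proof. by rewrite /boundary big_split. Qed.

(** The handshake lemma modulo 2. *)
Lemma sym_xor_sum c : symmetric c -> irreflexive c ->
  \big[addb/false]_x boundary c x = false.
Proof.
move=> csym cirr; rewrite /boundary.
elim: (index_enum V) => [|x s IH]; first by rewrite big_nil.
rewrite big_cons big_cons cirr /=.
under [X in _ (+) X]eq_bigr => y _ do rewrite big_cons csym.
by rewrite big_split /= IH addbF addbb.
Qed.

Lemma path_chain r u v : symmetric r -> irreflexive r -> connect r u v ->
  exists c, [/\ symmetric c, forall x y, c x y -> r x y &
    forall x, boundary c x = (x == u) (+) (x == v)].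
Proof.
move=> rsym rirr /connectP[s ps ->] {v}.
elim: s u ps => [|v s IH] u /=.
  move=> _; exists (fun _ _ => false); split=> // x.
  by rewrite addbb /boundary big1.
case/andP=> uv /IH[c [csym cr cbd]].
have NE : u != v by apply/eqP => E; rewrite E rirr in uv.
exists (fun x y => c x y (+) (((y == v) && (x == u)) (+) ((y == u) &&
  (x == v)))); split.
- move=> x y; rewrite csym; congr (_ (+) _).
  by rewrite addbC (andbC (x == u)) (andbC (x == v)).
- move=> x y; case E: (c x y); first by rewrite (cr _ _ E).
  case: eqP => [->|_] /=; last by case: eqP => [->|//] /= /eqP->; rewrite rsym.
  case: (x =P u) => [->|_] //=.
  case: (v =P u) => [E'|_] //=; first by rewrite E' eqxx in NE.
- move=> x; rewrite boundaryD cbd boundaryD /boundary !xor_delta.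
  by case: (x == u); case: (x == v); case: (x == _).
Qed.

(** In a connected set, every even set of vertices is the boundary of some
    edge set: join all its points to a base point, whose own contribution
    cancels by parity. *)
Lemma tjoin r A (tau : V -> bool) : symmetric r -> irreflexive r ->
  connected_in r A ->
  (forall x, tau x -> x \in A) -> \big[addb/false]_x tau x = false ->
  exists c, [/\ symmetric c, forall x y, c x y ->
    rel_in r A x y & forall x, boundary c x = tau x].
Proof.
move=> rsym rirr cA tA t0.
case: (pickP tau) => [o /tA oA|tau0]; last first.
  exists (fun _ _ => false); split=> // x.
  by rewrite tau0 /boundary big1.
have rAirr : irreflexive (rel_in r A) by move=> x;
  rewrite /rel_in /= rirr !andbF.
have /choice[J HJ] : forall w, exists c, w \in A -> [/\ symmetric c,
    forall x y, c x y -> rel_in r A x y & forall x,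
      boundary c x = (x == o) (+) (x == w)].
  move=> w; have [wA|] := boolP (w \in A); last by exists (fun _ _ => false).
  have [c Hc] := path_chain (rel_in_sym rsym A) rAirr (cA o w oA wA).
  by exists c.
exists (fun x y => \big[addb/false]_w (tau w && J w x y)); split.
- move=> x y; apply: eq_bigr => w _; case E: (tau w) => //=.
  by have [-> _ _] := HJ w (tA _ E).
- move=> x y; apply: contraTT => nr; rewrite big1 // => w _;
    case E: (tau w) => //=.
  by have [_ H _] := HJ w (tA _ E); apply: contraNF nr; apply: H.
- move=> x; rewrite /boundary exchange_big /=.
  under eq_bigr => w _.
    rewrite xor_distr.
    have -> : tau w && \big[addb/false]_y J w x y =
      (tau w && (x == o)) (+) ((w == x) && tau w).
      case E: (tau w) => //=; last by rewrite andbF.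
      by have [_ _ H] := HJ w (tA _ E); have := H x; rewrite /boundary => ->;
        rewrite andbT (eq_sym w).
    over.
  rewrite big_split /= xor_delta.
  under eq_bigr => w _ do rewrite andbC.
  by rewrite xor_distr t0 andbF.
Qed.
End Chains.

(** * The square grid and its cells *)

(** A pair of indices denotes both a grid point and the unit cell having that
    point as its lower left corner. *)
Definition gridpt N := ('I_N * 'I_N)%type.

Definition grid_adj N : rel (gridpt N) := fun u v =>
  ((u.1 == v.1) && ((u.2.+1 == v.2) || (v.2.+1 == u.2))) ||
  ((u.2 == v.2) && ((u.1.+1 == v.1) || (v.1.+1 == u.1))).

Lemma grid_adj_sym N : symmetric (@grid_adj N).
Proof.
move=> u v; rewrite /grid_adj (eq_sym u.1) (eq_sym u.2).
by rewrite (orbC (u.2.+1 == _)) (orbC (u.1.+1 == _)).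
Qed.

Definition inner_pt N (u : gridpt N) : bool :=
  [&& 0 < u.1, u.1.+1 < N, 0 < u.2 & u.2.+1 < N].

(** The data of a minor of the grid: the sets B x are disjoint and connected,
    and an edge of the graph is witnessed by an edge of the grid. Keeping away
    from the sides of the grid gives every edge in use a cell on both
    sides. *)
Definition grid_model (T : finType) (e : rel T) N (B : T -> {set gridpt N}) :
  Prop :=
  [/\ forall x y u, u \in B x -> u \in B y -> x = y,
      forall x u, u \in B x -> inner_pt u,
      forall x, connected_in (@grid_adj N) (B x) &
      forall x y, e x y -> exists u v,
        [/\ u \in B x, v \in B y & grid_adj u v]].

(** The corners of the unit cell at (i, j), the unit out of which
    neighbourhoods of curves are built: cells whose indices differ by at most
    one have a corner in common. *)
Definition box N (i j : nat) : {set gridpt N} :=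
  [set g : gridpt N | (i <= g.1 <= i.+1) && (j <= g.2 <= j.+1)].

Lemma box_connected N i j : connected_in (@grid_adj N) (box N i j).
Proof.
move=> u v; rewrite !inE => /andP[u1 u2] /andP[v1 v2].
apply: (@connect_trans _ _ (u.1, v.2)).
- have [E|NE] := eqVneq u.2 v.2; first by rewrite -E -surjective_pairing.
  apply: connect1; rewrite /rel_in /= !inE u1 u2 v2 /grid_adj /= eqxx.
  by move: NE; rewrite -val_eqE /=; lia.
- have [E|NE] := eqVneq u.1 v.1; first by rewrite E -surjective_pairing.
  apply: connect1; rewrite /rel_in /= !inE u1 v1 v2 /grid_adj /= eqxx orbC.
  by move: NE; rewrite -val_eqE /=; lia.
Qed.

Lemma box_meet N i j i' j' : i <= i'.+1 -> i' <= i.+1 -> j <= j'.+1 ->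
  j' <= j.+1 ->
  i.+1 < N -> i'.+1 < N -> j.+1 < N -> j'.+1 < N ->
  exists g, g \in box N i j /\ g \in box N i' j'.
Proof.
move=> *; have h1 : maxn i i' < N by lia.
have h2 : maxn j j' < N by lia.
by exists (Ordinal h1, Ordinal h2); rewrite !inE /=; lia.
Qed.

Section Grid.
Variable (n : nat).
Local Notation V := (gridpt n.+1).
Local Notation adj := (@grid_adj n.+1).

Definition grid_pt (i j : nat) : V := (inord i, inord j).

(** The cell on the left of the grid edge directed from u to v; the one on its
    right is the left cell of the reversed edge. *)
Definition left_cell (u v : V) : V :=
  if u.2 == v.2 then (if u.1 < v.1 then grid_pt u.1 u.2 else grid_pt v.1 u.2.-1)
  else (if u.2 < v.2 then grid_pt u.1.-1 u.2 else grid_pt u.1 v.2).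

Lemma grid_ptK (u : V) : grid_pt u.1 u.2 = u.
Proof. by rewrite /grid_pt !inord_val -surjective_pairing. Qed.

Lemma grid_pt_eq (v : V) i j : i < n.+1 -> j < n.+1 ->
  (v == grid_pt i j) = (v.1 == i :> nat) && (v.2 == j :> nat).
Proof.
by case: v => v1 v2 hi hj; rewrite xpair_eqE -!val_eqE /= !inordK.
Qed.

(** Written as an exclusive or of singletons, adjacency makes sums over the
    neighbours of a point linear. *)
Lemma adjE i j (v : V) : i.+2 < n.+1 -> j.+2 < n.+1 ->
  adj (grid_pt i.+1 j.+1) v =
   ((v == grid_pt i.+2 j.+1) (+) (v == grid_pt i j.+1)) (+)
     ((v == grid_pt i.+1 j.+2) (+) (v == grid_pt i.+1 j)).
Proof.
move=> hi hj; have hi1 := ltnW hi; have hi0 := ltnW hi1.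
have hj1 := ltnW hj; have hj0 := ltnW hj1.
rewrite !grid_pt_eq // /grid_adj -!val_eqE /= !inordK //.
move: (nat_of_ord v.1) (nat_of_ord v.2) => a b; clear.
rewrite !(eq_sym _ a) !(eq_sym _ b) !eqSS.
by case: (a =P i.+1) => [->|?]; case: (b =P j.+1) => [->|?];
  do ?case: eqP => //= ?; lia.
Qed.

Lemma sum_adj i j (F : V -> bool) : i.+2 < n.+1 -> j.+2 < n.+1 ->
  \big[addb/false]_v (adj (grid_pt i.+1 j.+1) v && F v) =
  (F (grid_pt i.+2 j.+1) (+) F (grid_pt i j.+1)) (+)
    (F (grid_pt i.+1 j.+2) (+) F (grid_pt i.+1 j)).
Proof.
move=> hi hj; under eq_bigr => v _ do rewrite adjE // !andb_addl.
by rewrite !big_split /= !xor_delta.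
Qed.

Lemma inner_grid_pt (u : V) : inner_pt u ->
  exists i j, [/\ i.+2 < n.+1, j.+2 < n.+1 & u = grid_pt i.+1 j.+1].
Proof.
rewrite /inner_pt => /and4P[a b c d]; exists u.1.-1, u.2.-1.
by rewrite !prednK // grid_ptK; split.
Qed.

Lemma left_cell_h a b : a.+1 < n.+1 -> b < n.+1 ->
  left_cell (grid_pt a b) (grid_pt a.+1 b) = grid_pt a b /\
    left_cell (grid_pt a.+1 b) (grid_pt a b) = grid_pt a b.-1.
Proof.
move=> ha hb; have ha0 := ltnW ha.
by rewrite /left_cell -!val_eqE /= !inordK // eqxx ltnSn ltnNge leqnSn.
Qed.

Lemma left_cell_v a b : a < n.+1 -> b.+1 < n.+1 ->
  left_cell (grid_pt a b) (grid_pt a b.+1) = grid_pt a.-1 b /\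
    left_cell (grid_pt a b.+1) (grid_pt a b) = grid_pt a b.
Proof.
move=> ha hb; have hb0 := ltnW hb.
rewrite /left_cell -!val_eqE /= !inordK //.
by rewrite (gtn_eqF (ltnSn b)) (ltn_eqF (ltnSn b)) ltnSn [b.+1 < b]ltnNge
  leqnSn.
Qed.

(** Around an inner point, each of the four incident cells is met by exactly
    two of the four edges, so all contributions cancel. *)
Lemma cell_coboundary_even (psi : V -> bool) u : inner_pt u ->
  boundary (fun u v => adj u v &&
    (psi (left_cell u v) (+) psi (left_cell v u))) u = false.
Proof.
case/inner_grid_pt => i [j [hi hj ->]].
have hi1 := ltnW hi; have hi0 := ltnW hi1.
have hj1 := ltnW hj; have hj0 := ltnW hj1.
rewrite /boundary sum_adj //.
have [-> ->] := left_cell_h hi hj1; have [-> ->] := left_cell_h hi1 hj1.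
have [-> ->] := left_cell_v hi1 hj; have [-> ->] := left_cell_v hi1 hj1.
rewrite /=; by do 4!case: (psi _).
Qed.

(** The planarity of the grid. Color a cell by the parity of the number of
    edges of c among the vertical edges on its left in the same row. Crossing
    a vertical edge changes this count by that edge; crossing a horizontal
    edge changes it by the number of vertical edges at the points of its line
    up to its left end. These points have even degree, and each horizontal
    edge between them counts twice, so only the edge that is crossed
    remains. *)
Lemma even_chain_cells (c : V -> V -> bool) : symmetric c ->
  (forall u v, c u v -> [/\ adj u v, inner_pt u & inner_pt v]) ->
  (forall u, boundary c u = false) ->
  exists phi : V -> bool, forall u v, adj u v -> inner_pt u ->
    c u v = phi (left_cell u v) (+) phi (left_cell v u).
Proof.
move=> csym cadj ceven.
(* Indices out of range are rounded to 0 by inord, hence name points on the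
   side of the grid, where c vanishes. *)
pose W i j := c (grid_pt i j) (grid_pt i j.+1);
  pose H i j := c (grid_pt i j) (grid_pt i.+1 j).
have cN u v : ~~ inner_pt u -> c u v = false.
  by move=> nu; apply: contraNF nu => /cadj[].
have z0 : (inord 0 : 'I_n.+1) = 0 :> nat by rewrite inordK.
have zbig k : n < k -> (inord k : 'I_n.+1) = 0 :> nat.
  by move=> h; rewrite /inord val_insubd ltnS leqNgt h.
have N0 i j : [|| i == 0, j == 0, n <= i | n <= j] -> ~~ inner_pt (grid_pt i j).
  rewrite /inner_pt /grid_pt /=; case/or4P => [/eqP->|/eqP->|h|h].
  - by rewrite z0.
  - by rewrite z0 !andbF.
  - have [hi|hi] := ltnP i n.+1;
      first by rewrite (inordK hi) ltnS [i < n]ltnNge h andbF.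
    by rewrite zbig.
  - have [hi|hi] := ltnP j n.+1;
      first by rewrite (inordK hi) [j.+1 < _]ltnS [j < n]ltnNge h !andbF.
    by rewrite (zbig j) // !andbF.
have even4 i j : (H i.+1 j.+1 (+) H i j.+1) (+) (W i.+1 j.+1 (+) W i.+1 j) =
  false.
  rewrite /H /W [c (grid_pt i _) _]csym [c (grid_pt _ j) _]csym.
  have [/andP[hi hj]|] := boolP ((i.+2 < n.+1) && (j.+2 < n.+1)); last first.
    move=> h; rewrite !cN //; apply: N0; lia.
  rewrite -(sum_adj _ hi hj) -[RHS](ceven (grid_pt i.+1 j.+1)) /boundary.
  apply: eq_bigr => v _; case E: (c _ v); rewrite ?andbF //.
  by case: (cadj _ _ E) => ->.
(* The parity of the vertical edges on the left of the cell (i, j), its own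
   left side included. *)
pose ph i j := \big[addb/false]_(0 <= k < i.+1) W k j.
exists (fun C : V => ph C.1 C.2).
have vert i j : W i.+1 j = ph i.+1 j (+) ph i j.
  by rewrite /ph [in RHS]big_nat_recr //= addbC addKb.
have horiz i j : H i j.+1 = ph i j.+1 (+) ph i j.
  elim: i => [|i IH].
    by rewrite /ph !big_nat1 /H /W !cN //; apply: N0.
  rewrite /ph (big_nat_recr i.+1) // [in X in _ (+) X](big_nat_recr i.+1) //=.
  rewrite -/(ph i j.+1) -/(ph i j).
  have := even4 i j; rewrite IH.
  by case: (H _ _); case: (W _ _); case: (W _ _); case: (ph _ _);
    case: (ph _ _).
have phE a b : a < n.+1 -> b < n.+1 ->
  ph (grid_pt a b).1 (grid_pt a b).2 = ph a b.
  by move=> ha hb; rewrite /grid_pt /= !inordK.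
move=> u v uv /inner_grid_pt[i [j [hi hj Eu]]]; move: uv; rewrite {u}Eu.
have hi1 := ltnW hi; have hi0 := ltnW hi1.
have hj1 := ltnW hj; have hj0 := ltnW hj1.
rewrite adjE //.
case: (v =P grid_pt i.+2 j.+1) => [-> _|_].
  by have [-> ->] := left_cell_h hi hj1; rewrite !phE // -horiz.
case: (v =P grid_pt i j.+1) => [-> _|_].
  by have [-> ->] := left_cell_h hi1 hj1; rewrite !phE // csym addbC -horiz.
case: (v =P grid_pt i.+1 j.+2) => [-> _|_].
  by have [-> ->] := left_cell_v hi1 hj; rewrite !phE // addbC -vert.
case: (v =P grid_pt i.+1 j) => [-> _|//].
by have [-> ->] := left_cell_v hi1 hj1; rewrite !phE // csym -vert.
Qed.
End Grid.

(** * Face structures, and those of minors of the grid *)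

(** A Whitney dual of the graph e: fc x y is the face on the left of the edge
    directed from x to y, and the even edge sets are exactly the boundaries of
    the sets phi of faces. *)
Definition face_structure (T : finType) (e : rel T) (F : finType) (fc : T ->
  T -> F) : Prop :=
  (forall c : T -> T -> bool, symmetric c -> (forall x y, c x y -> e x y) ->
     (forall x, boundary c x = false) ->
     exists phi : F -> bool, forall x y, e x y ->
       c x y = phi (fc x y) (+) phi (fc y x)) /\
  (forall (phi : F -> bool) x,
     boundary (fun x y => e x y && (phi (fc x y) (+) phi (fc y x))) x = false).

Lemma xor_delta2 (V W : finType) (p : V * W) (F : V -> W -> bool) :
  \big[addb/false]_u \big[addb/false]_v ((p == (u, v)) && F u v) = F p.1 p.2.
Proof.
case: p => a b /=; rewrite -[RHS](xor_delta a (fun u => F u b)).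
apply: eq_bigr => u _; rewrite -(xor_delta b (fun v => F u v)) -xor_distr.
by apply: eq_bigr => v _; rewrite xpair_eqE (eq_sym a) (eq_sym b) andbA.
Qed.

Section GridFaces.
Variables (T : finType) (e : rel T) (n : nat) (B : T -> {set gridpt n.+1}).
Hypotheses (e_sym : symmetric e) (e_irr : irreflexive e) (gm : grid_model e B).
Local Notation V := (gridpt n.+1).
Local Notation adj := (@grid_adj n.+1).

(** The grid edge that represents an edge of the graph is chosen once for each
    unordered pair, so that reversing the edge reverses its representative. *)
Lemma link_exists : exists G : T -> T -> V * V, forall x y, e x y ->
  [/\ (G x y).1 \in B x, (G x y).2 \in B y, adj (G x y).1 (G x y).2 &
      G y x = ((G x y).2, (G x y).1)].
Proof.
case: gm => _ _ _ He.
have /choice[g Hg] : forall xy : T * T, exists uv : V * V, e xy.1 xy.2 ->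
  [/\ uv.1 \in B xy.1, uv.2 \in B xy.2 & adj uv.1 uv.2].
  move=> [x y] /=; have [xy|] := boolP (e x y).
    by have [u [v H]] := He x y xy; exists (u, v).
  by exists (ord0, ord0, (ord0, ord0)).
pose rk (x : T) : nat := enum_rank x.
exists (fun x y => if rk x < rk y then g (x, y) else ((g (y, x)).2,
  (g (y, x)).1)).
move=> x y xy; have yx : e y x by rewrite e_sym.
have [lt|gt|E] := ltngtP (rk x) (rk y).
- by have [? ? ?] := Hg (x, y) xy.
- have [? ? ?] := Hg (y, x) yx; split => //=; last by case: (g _).
  by rewrite grid_adj_sym.
- by move: xy; rewrite (enum_rank_inj (val_inj E)) e_irr.
Qed.

(** The faces are the classes of cells that can be reached from each other
    across grid edges outside of the model, that is, edges which neither lie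
    in some B x nor represent an edge of the graph. An even edge set of the
    graph lifts to one of the grid by joining, inside each connected set B x,
    the ends of its representatives; the set of cells bounded by this lift is
    a union of faces. Conversely a union of faces has an even boundary in the
    grid, and adding up its degrees over B x leaves the edges at x. *)
Lemma grid_faces : exists (F : finType) (fc : T -> T -> F), face_structure e fc.
Proof.
have [G HG] := link_exists; have [Bdis Binn Bcon _] := gm.
have adj_irr : irreflexive adj.
  by move=> u; rewrite /grid_adj !eqxx /= !(gtn_eqF (ltnSn _)).
have Gsym x y : e x y -> G y x = ((G x y).2, (G x y).1) by case/HG.
pose wall (u v : V) := [exists x, (u \in B x) && (v \in B x)] ||
   [exists x, exists y, e x y && (G x y == (u, v))].
have wall_sym u v : wall u v -> wall v u.
  case/orP => [/existsP[x xuv]|/existsP[x /existsP[y /andP[xy /eqP E]]]];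
    apply/orP.
    by left; apply/existsP; exists x; rewrite andbC.
  right; apply/existsP; exists y; apply/existsP; exists x.
  by rewrite e_sym xy Gsym // E /=.
pose rr : rel V := fun C D => [exists u, exists v,
  [&& adj u v, inner_pt u || inner_pt v, ~~ wall u v, C == left_cell u v &
    D == left_cell v u]].
have rr_sym : symmetric rr.
  suff H C D : rr C D -> rr D C by move=> C D; apply/idP/idP; apply: H.
  case/existsP => u /existsP[v /and5P[uv iuv nw CE DE]].
  apply/existsP; exists v; apply/existsP; exists u.
  rewrite grid_adj_sym uv orbC iuv CE DE !andbT.
  by apply: contra nw; apply: wall_sym.
have rr_csym := sym_connect_sym rr_sym.
exists V, (fun x y => fingraph.root rr (left_cell (G x y).1 (G x y).2)); split.
- move=> c csym ce ceven.
  pose tau x u := \big[addb/false]_y (((G x y).1 == u) && c x y).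
  have /choice[K HK] : forall x, exists K : V -> V -> bool, [/\ symmetric K,
      forall u v, K u v -> rel_in adj (B x) u v & forall u,
        boundary K u = tau x u].
    move=> x; apply: (@tjoin V adj (B x) (tau x) (@grid_adj_sym _) adj_irr
      (Bcon x)).
      move=> u; apply: contraTT => nu; rewrite /tau big1 // => y _.
      case E: (c x y); rewrite ?andbF // andbT.
      have [G1 _ _ _] := HG _ _ (ce _ _ E).
      by apply: contraNF nu => /eqP<-.
    rewrite /tau exchange_big /= -[RHS](ceven x); apply: eq_bigr => y _.
    under eq_bigr => u _ do rewrite eq_sym.
    exact: xor_delta.
  (* The lift of c: the paths K x inside the branch sets and the
     representatives L of the edges of c. *)
  pose L u v := \big[addb/false]_x \big[addb/false]_y ((G x y == (u, v)) &&
    c x y).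
  pose ch u v := \big[addb/false]_x K x u v (+) L u v.
  have chP u v : ch u v -> (exists x, K x u v) \/
    (exists x y, c x y /\ G x y = (u, v)).
    move=> H; have [[x Kx]|nK] := pselect (exists x, K x u v);
      [by left; exists x|right].
    apply: contrapT => nG; move: H; rewrite /ch /L !big1 // => x _.
      rewrite big1 // => y _; apply/negP => /andP[/eqP E cxy].
      by apply: nG; exists x, y.
    by apply/negP => Kx; apply: nK; exists x.
  have ch_sym : symmetric ch.
    move=> u v; rewrite /ch /L; congr (_ (+) _).
      by apply: eq_bigr => x _; have [-> _ _] := HK x.
    rewrite exchange_big /=; apply: eq_bigr => y _; apply: eq_bigr => x _.
    rewrite csym; case E: (c y x); rewrite ?andbF // !andbT.
    by rewrite (Gsym _ _ (ce _ _ E)); case: (G y x) => a b;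
      rewrite /= !xpair_eqE andbC.
  have ch_adj u v : ch u v -> [/\ adj u v, inner_pt u & inner_pt v].
    case/chP => [[x]|[x [y [cxy E]]]].
      have [_ H _] := HK x; move/H; rewrite /rel_in /= => /and3P[uB vB uv].
      by split; [|apply: Binn uB|apply: Binn vB].
    have [] := HG _ _ (ce _ _ cxy); rewrite E /= => uB vB uv _.
    by split; [|apply: Binn uB|apply: Binn vB].
  have ch_even u : boundary ch u = false.
    rewrite /ch boundaryD; suff -> :
      boundary L u = boundary (fun u v => \big[addb/false]_x K x u v) u.
      by rewrite addbb.
    rewrite /boundary /L exchange_big [RHS]exchange_big /=;
      apply: eq_bigr => x _.
    have [_ _ HKx] := HK x; rewrite -[RHS]/(boundary (K x) u) HKx /tau.
    rewrite exchange_big /=; apply: eq_bigr => y _.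
    case: (G x y) => a b /=.
    under eq_bigr => v _ do rewrite xpair_eqE andbC andbA andbC (eq_sym b).
    by rewrite xor_delta andbC.
  have ch_wall u v : ch u v -> wall u v.
    case/chP => [[x Kx]|[x [y [cxy E]]]]; apply/orP.
      have [_ H _] := HK x; move/H: Kx; rewrite /rel_in /= => /and3P[uB vB _].
      by left; apply/existsP; exists x; rewrite uB.
    right; apply/existsP; exists x; apply/existsP; exists y.
    by rewrite (ce _ _ cxy) E eqxx.
  have ch_link x y : e x y -> ch (G x y).1 (G x y).2 = c x y.
    move=> xy; have [G1 G2 _ _] := HG _ _ xy.
    rewrite /ch big1 => [|z _]; last first.
      apply/negP; have [_ H _] := HK z; move/H;
        rewrite /rel_in /= => /and3P[z1 z2 _].
      have E1 := Bdis _ _ _ G1 z1; have E2 := Bdis _ _ _ G2 z2.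
      by rewrite E1 E2 e_irr in xy.
    rewrite /L /= -(xor_delta2 (x, y) c); apply: eq_bigr => z _;
      apply: eq_bigr => w _.
    case E: (c z w); rewrite ?andbF // !andbT.
    have [H1 H2 _ _] := HG _ _ (ce _ _ E).
    apply/eqP/eqP => [E'|[-> ->]]; last exact: surjective_pairing.
    rewrite E' /= in H1 H2.
    by rewrite (Bdis _ _ _ H1 G1) (Bdis _ _ _ H2 G2).
  have [phi Hphi] := even_chain_cells ch_sym ch_adj ch_even.
  have Hphi2 u v : adj u v -> inner_pt u || inner_pt v ->
     ch u v = phi (left_cell u v) (+) phi (left_cell v u).
    move=> uv /orP[iu|iv]; first exact: Hphi.
    by rewrite ch_sym addbC; apply: Hphi => //; rewrite grid_adj_sym.
  have phi_inv C D : connect rr C D -> phi C = phi D.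
    case/connectP => s ps -> {D}; elim: s C ps => //= D s IH C /andP[CD /IH <-].
    case/existsP: CD => u /existsP[v /and5P[uv iuv nw /eqP-> /eqP->]].
    apply/eqP; rewrite -negb_add -Hphi2 //.
    by apply: contra nw; apply: ch_wall.
  exists phi => x y xy; rewrite -!(phi_inv _ _ (connect_root rr _)) -ch_link //.
  have [G1 _ Ga _] := HG _ _ xy.
  by rewrite Hphi ?(Binn _ _ G1) // (Gsym _ _ xy).
- move=> phi x.
  (* The set of faces phi as a set of cells; dl is its boundary in the
     grid. *)
  pose psi C := phi (fingraph.root rr C).
  pose dl u v := adj u v && (psi (left_cell u v) (+) psi (left_cell v u)).
  have dl_sym : symmetric dl by move=> u v; rewrite /dl grid_adj_sym addbC.
  have dl_irr : irreflexive dl by move=> u; rewrite /dl addbb andbF.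
  have dl_wall u v : inner_pt u -> dl u v -> wall u v.
    move=> iu /andP[uv]; apply: contraLR => nw; rewrite negb_add; apply/eqP.
    congr phi; apply/(fingraph.rootP rr_csym); apply: connect1.
    apply/existsP; exists u; apply/existsP; exists v.
    by rewrite uv iu nw !eqxx.
  have tot : \big[addb/false]_u ((u \in B x) && boundary dl u) = false.
    rewrite big1 // => u _; case uB: (u \in B x) => //=.
    exact: cell_coboundary_even (Binn _ _ uB).
  rewrite -[RHS]tot.
  have -> : \big[addb/false]_u ((u \in B x) && boundary dl u) =
      \big[addb/false]_u \big[addb/false]_v [&& u \in B x, v \notin B x &
        dl u v].
    have H0 : \big[addb/false]_u boundary (fun u v =>
      [&& u \in B x, v \in B x & dl u v]) u = false.
      apply: sym_xor_sum => [u v|u]; last by rewrite dl_irr !andbF.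
      by rewrite dl_sym andbCA.
    rewrite -[RHS]addbF -[X in _ = _ (+) X]H0 -big_split; apply: eq_bigr => u _.
    rewrite /boundary -xor_distr -big_split; apply: eq_bigr => v _ /=.
    by case: (u \in B x); case: (v \in B x); case: (dl u v).
  rewrite /boundary [LHS](_ : _ =
    \big[addb/false]_y (e x y && dl (G x y).1 (G x y).2)); last first.
    apply: eq_bigr => y _; case xy: (e x y) => //=.
    by have [_ _ Ga _] := HG _ _ xy; rewrite /dl Ga (Gsym _ _ xy).
  under eq_bigr => y _ do rewrite
    -(xor_delta2 (G x y) (fun u v => e x y && dl u v)).
  rewrite exchange_big; apply: eq_bigr => u _.
  rewrite exchange_big; apply: eq_bigr => v _.
  have [/and3P[uB vB duv]|H] := boolP [&& u \in B x, v \notin B x & dl u v];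
    last first.
    rewrite big1 // => y _; apply/negP => /andP[/eqP E /andP[xy duv]].
    have [G1 G2 _ _] := HG _ _ xy; move: H; rewrite duv E /= in G1 G2 *.
    rewrite G1 andbT /=; case/negP; apply/negP => vB.
    by rewrite (Bdis _ _ _ vB G2) e_irr in xy.
  have /orP[/existsP[z /andP[uz vz]]|] := dl_wall _ _ (Binn _ _ uB) duv.
    by rewrite -(Bdis _ _ _ uB uz) (negPf vB) in vz.
  case/existsP=> z /existsP[w /andP[zw /eqP E]].
  have [G1 G2 _ _] := HG _ _ zw; rewrite E /= in G1 G2.
  have Ez := Bdis _ _ _ uB G1; subst z.
  rewrite (bigD1 w) //= E eqxx zw duv big1 // => y yw.
  apply/negP => /andP[/eqP Ey /andP[xy _]].
  have [_ H2 _ _] := HG _ _ xy; rewrite Ey /= in H2.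
  by rewrite (Bdis _ _ _ H2 G2) eqxx in yw.
Qed.
End GridFaces.

Lemma grid_model_faces (T : finType) (e : rel T) N (B : T -> {set gridpt N}) :
  symmetric e -> irreflexive e -> grid_model e B ->
  exists (F : finType) (fc : T -> T -> F), face_structure e fc.
Proof.
case: N B => [|n] B e_sym e_irr gm; last exact: grid_faces gm.
have e0 x y : e x y = false.
  by apply/negP; case: gm => _ _ _ H /H[[[i hi] j]].
exists unit, (fun _ _ => tt); split=> [c _ _ _|phi x].
  by exists (fun _ => false) => x y; rewrite e0.
by rewrite /boundary big1 // => y _; rewrite e0.
Qed.

(** * A plane drawing makes the graph a minor of a grid *)

Module Plane.
Import mathcomp_extra boolp classical_sets set_interval.
Import reals prodnormedzmodule topology normedtype derive lra.
Import Order.TTheory GRing.Theory Num.Theory.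
Import numFieldNormedType.Exports.

Section Plane.
Local Open Scope classical_set_scope.
Local Open Scope ring_scope.
Variable R : realType.
Local Notation plane := ((R * R)%type : normedModType R).

(** The distance attains its minimum on the product of the two compact
    sets. *)
Lemma compact_separation (K L : set plane) :
  compact K -> compact L -> (forall z, K z -> ~ L z) ->
  exists2 d : R, 0 < d & forall z w, K z -> L w -> d <= `|z - w|.
Proof.
move=> cK cL KL.
have [[[z0 w0] [Kz0 Lw0]]|KL0] := pselect (K `*` L !=set0); last first.
  exists 1 => // z w Kz Lw; exfalso; apply: KL0; by exists (z, w).
have cf : {within K `*` L, continuous (fun u : plane * plane => `|u.1 - u.2|)}.
  apply: continuous_subspaceT => u.
  apply: (@cvg_norm _ _ _ _ _ (fun u : plane * plane => u.1 - u.2)).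
  apply: cvgB; [exact: cvg_fst | exact: cvg_snd].
have [[z1 w1] /set_mem[/= K1 L1] min1] :=
  compact_EVT_min (ex_intro _ (z0, w0) (conj Kz0 Lw0)) (compact_setX cK cL) cf.
exists `|z1 - w1|.
  rewrite normr_gt0 subr_eq0; apply/eqP => zw; apply: (KL z1) => //.
  by rewrite zw.
by move=> z w Kz Lw; apply: (min1 (z, w)); apply/mem_set.
Qed.

(** An equivalence relation with open classes has a single class on an
    interval: the indicator function of a class is continuous, so the
    intermediate value theorem makes it constant. *)
Lemma interval_chain (E : R -> R -> Prop) (l r : R) :
  (forall s t u, l <= t <= r -> E s t -> E t u -> E s u) ->
  (forall s t, E s t -> E t s) ->
  (forall t, l <= t <= r -> exists2 d, 0 < d &
     forall s, l <= s <= r -> `|t - s| < d -> E t s) ->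
  forall s t, l <= s <= r -> l <= t <= r -> E s t.
Proof.
move=> Etr Esy Eloc.
suff H t : l <= t <= r -> E l t.
  move=> s t hs ht; apply: (Etr _ l); [|exact/Esy/H|exact: H].
  by move: hs => /andP[ls sr]; rewrite lexx (le_trans ls sr).
move=> /andP[lt tr]; apply: contrapT => nE.
have lr := le_trans lt tr.
(* A locally constant function, which takes no value between 0 and 1. *)
pose g s : R := if `[< E l s >] then 0 else 1.
have cg : {within `[l, t], continuous g}.
  apply/subspace_continuousP => s; rewrite /= in_itv/= => /andP[ls st].
  have [d d0 Hd] := Eloc s (introT andP (conj ls (le_trans st tr))).
  apply/cvgrPdist_lt => eps eps0.
  rewrite near_withinE; near=> u; rewrite /= in_itv/= => /andP[lu ut].
  have Esu : E s u.
    apply: Hd; first by rewrite lu (le_trans ut tr).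
    by near: u; apply: nbhsx_ballx.
  suff : g s = g u by move=> gsu; move: eps0;
    rewrite -(normr0 R) -(subrr (g s)) {2}gsu.
  rewrite /g; congr (if _ then _ else _); apply/asboolP/asboolP => h.
    by apply: (Etr _ s) => //; rewrite ls (le_trans st tr).
  by apply: (Etr _ u) (Esy _ _ Esu) => //; rewrite lu (le_trans ut tr).
have Ell : E l l.
  have [|d d0 Hd] := Eloc l; first by rewrite lexx.
  by apply: Hd; rewrite ?lexx // subrr normr0.
have gl : g l = 0 by rewrite /g asboolT.
have gt : g t = 1 by rewrite /g asboolF.
have [c _ gc] : exists2 c, c \in `[l, t]%R & g c = 2^-1.
  apply: IVT => //; rewrite gl gt.
  rewrite minEle maxEle ler01; apply/andP; split; lra.
move: gc; rewrite /g; case: ifP => _; lra.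
Unshelve. all: by end_near.
Qed.

End Plane.

Section Drawing.
Local Open Scope classical_set_scope.
Local Open Scope ring_scope.
Variables (R : realType) (T : finType) (e : rel T).
Variables (p : T -> R * R) (a : T -> T -> R -> R * R).
Hypothesis D : plane_drawing e p a.
Local Notation plane := ((R * R)%type : normedModType R).

(** Puts the clauses of a drawing about vertices and about interiors of arcs
    into a single case distinction. *)
Lemma arcs_meet x y z w (s t : R) : e x y -> e z w -> 0 <= s <= 1 ->
  0 <= t <= 1 ->
  a x y s = a z w t ->
  [set x; y]%SET = [set z; w]%SET \/
  [/\ s = 0 \/ s = 1, t = 0 \/ t = 1 & (s = 0 -> t = 0 -> x = z)].
Proof.
move=> xy zw /andP[s0 s1] /andP[t0 t1] st.
have [E|NE] := eqVneq [set x; y]%SET [set z; w]%SET; [by left|right].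
have cs (u : R) : 0 <= u -> u <= 1 -> u = 0 \/ u = 1 \/ 0 < u < 1.
  rewrite !le_eqVlt => /orP[/eqP|u0 /orP[/eqP|u1]]; [by left| by right; left|].
  by right; right; rewrite u0.
have ends x' y' u : e x' y' -> u = 0 \/ u = 1 -> exists v, a x' y' u = p v.
  move=> xy' [->|->]; first by exists x'; exact: (drawing_arc_source D).
  by exists y'; exact: (drawing_arc_target D).
have Hs : s = 0 \/ s = 1.
  have [|[|si]] := cs s s0 s1; [by left| by right|].
  have [t01|[t01|ti]] := cs t t0 t1.
  - have [v ev] := ends _ _ t zw (or_introl t01).
    by case: (@drawing_arc_vertex _ _ _ _ _ D x y v xy s);
      rewrite ?in_itv // st.
  - have [v ev] := ends _ _ t zw (or_intror t01).
    by case: (@drawing_arc_vertex _ _ _ _ _ D x y v xy s);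
      rewrite ?in_itv // st.
  - by case: (@drawing_arc_disjoint _ _ _ _ _ D x y z w xy zw NE s t);
      rewrite ?in_itv.
split=> //.
- have [v ev] := ends _ _ s xy Hs.
  have [|[|ti]] := cs t t0 t1; [by left| by right|].
  by case: (@drawing_arc_vertex _ _ _ _ _ D z w v zw t); rewrite ?in_itv // -st.
- move=> s00 t00; apply: (drawing_vertex_inj D).
  by rewrite -(drawing_arc_source D xy) -(drawing_arc_source D zw) -{1}s00 -t00.
Qed.

(** An arc is cut into the third next to its source and the middle third; the
    remaining third belongs to the reversed arc. The sets near_arc x y for
    fixed x all contain the point of x and together form the core of the
    branch set of x, while the middle third links the cores of x and y. *)
Definition near_arc (x y : T) : set plane := a x y @` `[0, 3^-1].
Definition mid_arc (x y : T) : set plane := a x y @` `[3^-1, 2 / 3].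

Lemma edge_set_eq x y z w : [set x; y]%SET = [set z; w]%SET :> {set T} ->
  (x = z /\ y = w) \/ (x = w /\ y = z).
Proof.
move=> E.
have : x \in [set z; w]%SET by rewrite -E !inE eqxx.
have : y \in [set z; w]%SET by rewrite -E !inE eqxx orbT.
have : z \in [set x; y]%SET by rewrite E !inE eqxx.
have : w \in [set x; y]%SET by rewrite E !inE eqxx orbT.
rewrite !inE => /orP[]/eqP? /orP[]/eqP? /orP[]/eqP? /orP[]/eqP?; subst;
 by [left|right].
Qed.

Lemma near_near x y z w : e x y -> e z w -> x != z ->
  forall u, near_arc x y u -> ~ near_arc z w u.
Proof.
move=> xy zw xz u [s /=]; rewrite in_itv/= => /andP[s0 s1] <- [t /=].
rewrite in_itv/= => /andP[t0 t1] /esym st.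
have [||/edge_set_eq[[/eqP]|[xw yz]]|[s01 t01 H]] := arcs_meet xy zw _ _ st.
- by rewrite s0; lra.
- by rewrite t0; lra.
- by rewrite (negPf xz).
- subst z w; move: st; rewrite (drawing_arc_rev D xy); last first.
    by rewrite in_itv/= t0; lra.
  move/(drawing_arc_inj D xy); rewrite !in_itv/= => st.
  have : s = 1 - t by apply: st; lra.
  lra.
- move/eqP: xz; apply; apply: H; lra.
Qed.

Lemma mid_near x y z w : e x y -> e z w -> z != x -> z != y ->
  forall u, mid_arc x y u -> ~ near_arc z w u.
Proof.
move=> xy zw zx zy u [s /=]; rewrite in_itv/= => /andP[s0 s1] <- [t /=].
rewrite in_itv/= => /andP[t0 t1] /esym st.
have [||/edge_set_eq[[/eqP]|[_ /eqP]]|[s01 t01 H]] := arcs_meet xy zw _ _ st.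
- lra.
- lra.
- by rewrite eq_sym (negPf zx).
- by rewrite eq_sym (negPf zy).
- lra.
Qed.

Lemma mid_mid x y z w : e x y -> e z w -> [set x; y]%SET != [set z; w]%SET ->
  forall u, mid_arc x y u -> ~ mid_arc z w u.
Proof.
move=> xy zw NE u [s /=]; rewrite in_itv/= => /andP[s0 s1] <- [t /=].
rewrite in_itv/= => /andP[t0 t1] /esym st.
have [||/eqP|[s01 t01 H]] := arcs_meet xy zw _ _ st.
- lra.
- lra.
- by rewrite (negPf NE).
- lra.
Qed.

Lemma arc_segment_compact x y l r : e x y -> 0 <= l -> r <= 1 ->
  compact (a x y @` `[l, r] : set plane).
Proof.
move=> xy l0 r1; apply: continuous_compact; last exact: segment_compact.
apply: continuous_subspaceW (drawing_arc_continuous D xy).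
by move=> t /=; rewrite !in_itv/= => /andP[lt tr]; lra.
Qed.

(** The flag tells near pieces from middle ones, so that a single finite
    family covers all the distances to be bounded below. *)
Definition piece (i : T * T * bool) : set plane :=
  if i.2 then near_arc i.1.1 i.1.2 else mid_arc i.1.1 i.1.2.

Lemma piece_compact i : e i.1.1 i.1.2 -> compact (piece i).
Proof. by move=> ei; rewrite /piece; case: ifP => _;
  apply: arc_segment_compact => //; lra. Qed.

Lemma pieces_gap : exists2 d : R, 0 < d & forall i j : T * T * bool,
  e i.1.1 i.1.2 -> e j.1.1 j.1.2 -> (forall u, piece i u -> ~ piece j u) ->
  forall z w, piece i z -> piece j w -> d <= `|z - w|.
Proof.
pose Q ij := [/\ e ij.1.1.1 ij.1.1.2, e ij.2.1.1 ij.2.1.2 &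
  (forall u, piece ij.1 u -> ~ piece ij.2 u)].
have /choice[d Hd] : forall ij : (T * T * bool) * (T * T * bool),
   exists d : R, 0 < d /\ (Q ij -> forall z w, piece ij.1 z -> piece ij.2 w ->
     d <= `|z - w|).
  move=> ij; have [[e1 e2 dis]|nQ] := pselect (Q ij).
    have [d d0 H] := compact_separation (piece_compact e1) (piece_compact e2)
      dis.
    by exists d; split.
  by exists 1; split.
exists (\big[Order.min/1]_ij d ij).
  by apply: lt_bigmin => // ij _; case: (Hd ij).
move=> i j ei ej dis z w iz jw.
apply: le_trans (bigmin_le _ (i, j) _) _.
by case: (Hd (i, j)) => _; apply.
Qed.

Lemma arcs_bounded : exists M : R, forall x y t, e x y -> 0 <= t <= 1 ->
  `|(a x y t : plane)| <= M.
Proof.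
have /choice[b Hb] : forall xy : T * T, exists M : R, e xy.1 xy.2 -> forall t,
    0 <= t <= 1 -> `|(a xy.1 xy.2 t : plane)| <= M.
  move=> xy; have [exy|] := boolP (e xy.1 xy.2); last by exists 0.
  have /compact_bounded[M [_ HM]] := arc_segment_compact exy (lexx 0) (lexx 1).
  exists (M + 1) => _ t t01; apply: (HM (M + 1)); first by rewrite ltrDl.
  by exists t => //=; rewrite in_itv.
exists (\big[Order.max/0]_xy b xy) => x y t exy t01.
by apply: le_trans (Hb (x, y) exy t t01) _; apply: (le_bigmax _ _ (x, y)).
Qed.
End Drawing.

Section Discretize.
Local Open Scope classical_set_scope.
Local Open Scope ring_scope.
Variables (R : realType) (M : nat) (b : R).
Hypothesis M0 : (0 < M)%N.
Hypothesis b0 : 0 <= b.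
Local Notation plane := ((R * R)%type : normedModType R).

(** Points with coordinates in [-b, b] are scaled by M and shifted to positive
    coordinates, then rounded down to grid indices. *)
Definition gcoord (r : R) : nat := Num.truncn ((r + b) * M%:R + 1).
(** The four extra columns keep all the corners in use away from the sides of
    the grid. *)
Definition gsize : nat := (Num.truncn ((b + b) * M%:R + 1)).+4.
Definition corners (z : R * R) :
  {set gridpt gsize} := box gsize (gcoord z.1) (gcoord z.2).

Lemma norm_coords (z : plane) : `|z.1| <= `|z| /\ `|z.2| <= `|z|.
Proof. by rewrite prod_normE !le_max !lexx orbT. Qed.

Lemma gcoord_arg (r : R) : `|r| <= b -> 1 <= (r + b) * M%:R + 1.
Proof.
rewrite ler_norml => /andP[h _]; rewrite lerDr mulr_ge0 //; lra.
Qed.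

Lemma gcoord_itv (r : R) : `|r| <= b ->
  (gcoord r)%:R <= (r + b) * M%:R + 1 < (gcoord r).+1%:R.
Proof. by move=> /gcoord_arg h; apply: truncn_itv; lra. Qed.

Lemma gcoord_gt0 (r : R) : `|r| <= b -> (0 < gcoord r)%N.
Proof. by move=> h; rewrite truncn_gt0 gcoord_arg. Qed.

Lemma gcoord_lt (r : R) : `|r| <= b -> ((gcoord r).+3 < gsize)%N.
Proof.
move=> h; rewrite /gsize !ltnS; apply: le_truncn.
rewrite lerD2r ler_wpM2r //; move: h; rewrite ler_norml; lra.
Qed.

Lemma gcoord_close (r s : R) : `|r| <= b -> `|s| <= b -> `|r - s| * M%:R < 1 ->
  (gcoord r <= (gcoord s).+1)%N.
Proof.
move=> /gcoord_itv/andP[r1 _] /gcoord_itv/andP[_ s2] rs.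
have h : (r - s) * M%:R < 1.
  by apply: le_lt_trans rs; rewrite ler_wpM2r // ler_norm.
suff : (gcoord r)%:R < (gcoord s).+2%:R :> R by rewrite ltr_nat.
have -> : (gcoord s).+2%:R = (gcoord s).+1%:R + 1 :> R by rewrite -natr1.
by move: h; rewrite mulrBl; move: r1 s2; rewrite !mulrDl; lra.
Qed.

Lemma corners_neq0 (z : R * R) : `|z.1| <= b -> `|z.2| <= b ->
  exists g, g \in corners z.
Proof.
move=> z1 z2; have [] := @box_meet gsize (gcoord z.1) (gcoord z.2) (gcoord z.1)
  (gcoord z.2);
 try (by have := gcoord_lt z1; have := gcoord_lt z2; lia).
by move=> g [gz _]; exists g.
Qed.

Lemma corners_interior (z : R * R) g : `|z.1| <= b -> `|z.2| <= b ->
  g \in corners z -> inner_pt g.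
Proof.
move=> z1 z2; rewrite inE /inner_pt.
have := gcoord_lt z1; have := gcoord_lt z2.
have := gcoord_gt0 z1; have := gcoord_gt0 z2; lia.
Qed.

Lemma corners_meet (z w : plane) : `|z| <= b -> `|w| <= b ->
  `|z - w| * M%:R < 1 -> exists g, g \in corners z /\ g \in corners w.
Proof.
move=> zb wb zw.
have [z1 z2] := norm_coords z; have [w1 w2] := norm_coords w.
have z1b := le_trans z1 zb; have z2b := le_trans z2 zb.
have w1b := le_trans w1 wb; have w2b := le_trans w2 wb.
have [d1 d2] := norm_coords (z - w).
have c1 : `|z.1 - w.1| * M%:R < 1 by apply: le_lt_trans zw; rewrite ler_wpM2r.
have c2 : `|z.2 - w.2| * M%:R < 1 by apply: le_lt_trans zw; rewrite ler_wpM2r.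
apply: box_meet; do ?by apply: gcoord_close; rewrite // distrC.
all: by do 2!apply: ltnW; apply: gcoord_lt.
Qed.

Lemma gcoord_near (r : R) (i : nat) : `|r| <= b ->
  (gcoord r <= i <= (gcoord r).+1)%N ->
  `|(r + b) * M%:R + 1 - i%:R| <= 1.
Proof.
move=> /gcoord_itv/andP[r1 r2] /andP[i1 i2].
have : (gcoord r)%:R <= i%:R :> R by rewrite ler_nat.
have : i%:R <= (gcoord r).+1%:R :> R by rewrite ler_nat.
move: r2; rewrite -!natr1 ler_norml; lra.
Qed.

(** Each corner of the cell of a point is at distance at most 1 from that
    point after scaling. *)
Lemma corners_far (z w : plane) g : `|z| <= b -> `|w| <= b ->
  g \in corners z -> g \in corners w -> `|z - w| * M%:R <= 2.
Proof.
move=> zb wb; rewrite !inE => /andP[g1 g2] /andP[h1 h2].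
have [z1 z2] := norm_coords z; have [w1 w2] := norm_coords w.
have z1b := le_trans z1 zb; have z2b := le_trans z2 zb.
have w1b := le_trans w1 wb; have w2b := le_trans w2 wb.
have key (r s : R) (i : nat) : `|r| <= b -> `|s| <= b ->
    (gcoord r <= i <= (gcoord r).+1)%N -> (gcoord s <= i <= (gcoord s).+1)%N ->
    `|r - s| * M%:R <= 2.
  move=> rb sb /(gcoord_near rb) hr /(gcoord_near sb) hs.
  have -> : `|r - s| * M%:R =
     `|((r + b) * M%:R + 1 - i%:R) - ((s + b) * M%:R + 1 - i%:R)|.
    rewrite -{1}(ger0_norm (ler0n R M)) -normrM; congr `|_|.
    by rewrite mulrBl !mulrDl; lra.
  by apply: le_trans (ler_normB _ _) _; lra.
rewrite prod_normE maxr_pMl // ge_max; apply/andP; split.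
  exact: key g1 h1.
exact: key g2 h2.
Qed.

(** Points of the curve with close parameters have cells with a common corner,
    so the corners of all cells met by the curve form a connected set. *)
Lemma curve_connected (c : R -> R * R) l r (S : {set gridpt gsize}) :
  {within `[l, r], continuous (c : R -> plane)} ->
  (forall t, l <= t <= r -> `|(c t : plane)| <= b) ->
  (forall t, l <= t <= r -> corners (c t) \subset S) ->
  forall s t g h, l <= s <= r -> l <= t <= r ->
    g \in corners (c s) -> h \in corners (c t) ->
    connect (rel_in (@grid_adj gsize) S) g h.
Proof.
move=> cc cb cS s t g h hs ht gs.
suff H : forall g h, g \in corners (c s) -> h \in corners (c t) ->
   connect (rel_in (@grid_adj gsize) S) g h by apply: H.
move: {g h gs} s t hs ht.
apply: (@interval_chain R (fun s t => forall g h, g \in corners (c s) ->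
  h \in corners (c t) -> connect (rel_in (@grid_adj gsize) S) g h)).
- move=> s t u htu st tu g h gs hu.
  have [n1 n2] := norm_coords (c t); have cbt := cb t htu.
  have [k kt] := corners_neq0 (le_trans n1 cbt) (le_trans n2 cbt).
  exact: connect_trans (st g k gs kt) (tu k h kt hu).
- move=> s t st g h gt hs.
  by rewrite (connect_rel_in_sym (@grid_adj_sym gsize)); apply: st.
- move=> t htr.
  have /subspace_continuousP/(_ t) := cc.
  rewrite /= in_itv /= => /(_ htr)/cvgrPdist_lt/(_ M%:R^-1).
  rewrite invr_gt0 ltr0n M0 => /(_ isT).
  rewrite near_withinE => /nbhs_ballP[d /= d0 Hd].
  exists d => // s hs ts g h gt hs'.
  have cts : `|(c t : plane) - c s| * M%:R < 1.
    by rewrite -ltr_pdivlMr ?ltr0n // div1r; apply: Hd => //=.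
  have [k [kt ks]] := corners_meet (cb t htr) (cb s hs) cts.
  apply: (connect_trans (connect_rel_inS (cS t htr) (box_connected gt kt))).
  exact: (connect_rel_inS (cS s hs) (box_connected ks hs')).
Qed.
End Discretize.

Section Model.
Local Open Scope ring_scope.
Variables (R : realType) (T : finType) (e : rel T).
Variables (p : T -> R * R) (a : T -> T -> R -> R * R).
Hypothesis D : plane_drawing e p a.
Hypothesis e_irr : irreflexive e.
Hypothesis e_sym : symmetric e.
Local Notation plane := ((R * R)%type : normedModType R).

(** At this scale two pieces that are disjoint are more than two grid steps
    apart, so that by corners_far they share no corner. *)
Lemma drawing_scale : exists (M : nat) (b : R),
  [/\ (0 < M)%N, 0 <= b, forall x y (t : R), e x y -> 0 <= t <= 1 ->
    `|(a x y t : plane)| <= b &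
   forall i j : T * T * bool,
  e i.1.1 i.1.2 -> e j.1.1 j.1.2 -> (forall u, piece a i u -> ~ piece a j u) ->
  forall z w, piece a i z -> piece a j w -> 2 < `|(z : plane) - w| * M%:R].
Proof.
have [d d0 gap] := pieces_gap D.
have [b Hb] := arcs_bounded D.
have [M HM] : exists M : nat, 2 / d < M%:R.
  by exists (Num.bound (2 / d)); apply: archi_boundP; rewrite divr_ge0 // ltW.
exists M, (Num.max 0 b); split.
- by rewrite -(ltr_nat R); apply: lt_trans HM; rewrite divr_gt0.
- by rewrite le_max lexx.
- by move=> x y t xy t01; rewrite le_max Hb ?orbT.
- move=> i j ei ej dis z w iz jw.
  apply: (@lt_le_trans _ _ (d * M%:R)); first by rewrite mulrC -ltr_pdivrMr.
  by rewrite ler_wpM2r // (gap i j).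
Qed.

(** The branch set of x contains the corners near the first thirds of the arcs
    leaving x. For an edge oriented by the numbering of the vertices, it also
    contains the part of the path along the middle third that precedes the
    first corner near the other endpoint. *)
Lemma drawing_grid_model : exists N (B : T -> {set gridpt N}), grid_model e B.
Proof.
have [M [b [M0 b0 bnd gap]]] := drawing_scale.
pose N := gsize M b; pose cr := @corners R M b.
pose adj := @grid_adj N.
pose S x : {set gridpt N} := [set g | `[< exists y (t : R),
  [/\ e x y, 0 <= t <= 3^-1 & g \in cr (a x y t)] >]].
pose L x y : {set gridpt N} :=
  [set g | `[< exists t : R, 3^-1 <= t <= 2/3 /\ g \in cr (a x y t) >]].
have bnd1 x y (t : R) : e x y -> 0 <= t <= 1 ->
  `|(a x y t).1| <= b /\ `|(a x y t).2| <= b.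
  move=> xy t01; have [h1 h2] := norm_coords (a x y t).
  by split; [apply: le_trans h1 _|apply: le_trans h2 _]; apply: bnd.
have S_in x y (t : R) g : e x y -> 0 <= t <= 3^-1 -> g \in cr (a x y t) ->
  g \in S x.
  by move=> xy t0 gt; rewrite inE; apply/asboolP; exists y, t.
have L_in x y (t : R) g : 3^-1 <= t <= 2/3 -> g \in cr (a x y t) -> g \in L x y.
  by move=> t0 gt; rewrite inE; apply/asboolP; exists t.
have S_out x g : g \in S x -> exists y (t : R),
  [/\ e x y, 0 <= t <= 3^-1 & g \in cr (a x y t)].
  by rewrite inE => /asboolP.
have L_out x y g : g \in L x y -> exists t :
  R, 3^-1 <= t <= 2/3 /\ g \in cr (a x y t).
  by rewrite inE => /asboolP.
have third (t : R) : 0 <= t <= 3^-1 -> 0 <= t <= 1 by lra.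
have mid (t : R) : 3^-1 <= t <= 2/3 -> 0 <= t <= 1 by lra.
have nearP x y (t : R) : 0 <= t <= 3^-1 -> piece a (x, y, true) (a x y t).
  by move=> ht; exists t => //=; rewrite in_itv.
have midP x y (t : R) : 3^-1 <= t <= 2/3 -> piece a (x, y, false) (a x y t).
  by move=> ht; exists t => //=; rewrite in_itv.
(* Disjoint pieces share no corner. *)
have cut x y z w (s t : R) g (bx bz : bool) : e x y -> e z w ->
    0 <= s <= 1 -> 0 <= t <= 1 ->
    (forall u, piece a (x, y, bx) u -> ~ piece a (z, w, bz) u) ->
    piece a (x, y, bx) (a x y s) -> piece a (z, w, bz) (a z w t) ->
    g \in cr (a x y s) -> g \in cr (a z w t) -> False.
  move=> xy zw hs ht dis ps pt gs gt.
  have := gap (x, y, bx) (z, w, bz) xy zw dis _ _ ps pt.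
  have := corners_far (bnd _ _ _ xy hs) (bnd _ _ _ zw ht) gs gt.
  by move=> h1 h2; have := le_lt_trans h1 h2; rewrite ltxx.
have SS x z g : g \in S x -> g \in S z -> x = z.
  move=> /S_out[y [s [xy hs gs]]] /S_out[w [t [zw ht gt]]];
    apply/eqP/negP => /negP xz.
  apply: (cut x y z w s t g true true) => //; do ?[exact: third|exact: nearP].
  exact: (near_near D xy zw xz).
have LS x y z g : e x y -> g \in L x y -> g \in S z -> z = x \/ z = y.
  move=> xy /L_out[s [hs gs]] /S_out[w [t [zw ht gt]]].
  have [->|zx] := eqVneq z x; first by left.
  have [->|zy] := eqVneq z y; first by right.
  exfalso; apply: (cut x y z w s t g false true) => //;
    do ?[exact: third|exact: nearP|exact: mid|exact: midP].
  exact: (mid_near D xy zw zx zy).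
have LL x y z w g : e x y -> e z w -> g \in L x y -> g \in L z w ->
    [set x; y]%SET = [set z; w]%SET.
  move=> xy zw /L_out[s [hs gs]] /L_out[t [ht gt]].
  apply/eqP/negP => /negP NE.
  apply: (cut x y z w s t g false false) => //; do ?[exact: mid|exact: midP].
  exact: (mid_mid D xy zw NE).
have cont x y (l r : R) : e x y -> 0 <= l -> r <= 1 ->
    {within `[l, r], continuous (a x y : R -> plane)}%classic.
  move=> xy l0 r1; apply: continuous_subspaceW (drawing_arc_continuous D xy).
  by move=> t /=; rewrite !in_itv/= => /andP[lt tr]; lra.
have le13 : (3^-1 <= 1 :> R) by lra.
have le23 : (2 / 3 <= 1 :> R) by lra.
have ge13 : (0 <= 3^-1 :> R) by lra.
have itv0 : 0 <= (0 : R) <= 3^-1 by rewrite lexx.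
have itv1 : 0 <= (3^-1 : R) <= 3^-1 by rewrite ge13 lexx.
have itv2 : 3^-1 <= (3^-1 : R) <= 2 / 3 by lra.
have itv3 : 3^-1 <= (2 / 3 : R) <= 2 / 3 by lra.
have flip : 1 - 3^-1 = 2 / 3 :> R by lra.
have Sarc x y s t g h : e x y -> 0 <= s <= 3^-1 -> 0 <= t <= 3^-1 ->
    g \in cr (a x y s) -> h \in cr (a x y t) -> connect (rel_in adj (S x)) g h.
  move=> xy hs ht gs; apply: (curve_connected M0 b0
    (cont x y _ _ xy (lexx 0) le13) _ _ hs ht gs).
    by move=> q hq; apply: bnd => //; exact: third.
  by move=> q hq; apply/fintype.subsetP => k; exact: S_in.
have Larc x y s t g h : e x y -> 3^-1 <= s <= 2/3 -> 3^-1 <= t <= 2/3 ->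
    g \in cr (a x y s) -> h \in cr (a x y t) ->
      connect (rel_in adj (L x y)) g h.
  move=> xy hs ht gs; apply: (curve_connected M0 b0 (cont x y _ _ xy ge13 le23)
    _ _ hs ht gs).
    by move=> q hq; apply: bnd => //; exact: mid.
  by move=> q hq; apply/fintype.subsetP => k; exact: L_in.
have cr_neq0 x y (t : R) : e x y -> 0 <= t <= 1 -> exists k, k \in cr (a x y t).
  by move=> xy ht; have [n1 n2] := bnd1 x y t xy ht; apply: corners_neq0 n1 n2.
have Sconn x : connected_in adj (S x).
  move=> u v /S_out[y [s [xy hs us]]] /S_out[w [t [zw ht vt]]].
  have a0 : a x y 0 = a x w 0 by rewrite !(drawing_arc_source D).
  have [k k0] := cr_neq0 x y 0 xy (third _ itv0).
  apply: (connect_trans (Sarc _ _ _ _ _ _ xy hs itv0 us k0)).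
  by apply: (Sarc _ _ _ _ _ _ zw itv0 ht _ vt); rewrite -a0.
(* P (x, y) joins the core of x to a neighbour of the core of y, along the
   middle third of the arc. *)
have /choice[P HP] : forall xy : T * T, exists P :
  {set gridpt N}, e xy.1 xy.2 ->
   [/\ P \subset L xy.1 xy.2, [disjoint P & S xy.2],
     (exists2 u0, u0 \in P /\ u0 \in S xy.1 & forall u, u \in P ->
       connect (rel_in adj P) u0 u) &
     exists u v, [/\ u \in P, v \in S xy.2 & adj u v]].
  move=> [x y] /=; have [xy|] := boolP (e x y); last by exists finset.set0.
  have yx : e y x by rewrite e_sym.
  have [g g0] := cr_neq0 x y 3^-1 xy (third _ itv1).
  have [h h0] := cr_neq0 x y (2/3) xy (mid _ itv3).
  have gS : g \in S x by apply: (S_in x y 3^-1).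
  have hS : h \in S y.
    apply: (S_in y x 3^-1) => //.
    by rewrite (drawing_arc_rev D xy) ?in_itv/= ?ge13 // flip.
  have gL : g \in L x y by apply: (L_in x y 3^-1).
  have gh := Larc _ _ _ _ _ _ xy itv2 itv3 g0 h0.
  have /connectP[s ps lasth] := gh.
  have [||P [gP PL PS Pc Pe]] := path_prefix (Z := S y) ps gL.
  - by apply/negP => /(SS _ _ _ gS) E; rewrite E e_irr in xy.
  - by rewrite -lasth.
  by exists P => _; split => //; exists g.
pose rk (x : T) : nat := enum_rank x.
(* Only one of the two orientations of an edge contributes its path. *)
pose dir x y := e x y && (rk x < rk y)%N.
pose B x := S x :|: \bigcup_(y | dir x y) P (x, y).
have B_out x g : g \in B x -> g \in S x \/ exists2 y, dir x y & g \in P (x, y).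
  by case/finset.setUP => [|/finset.bigcupP[y xy gy]]; [left|right; exists y].
have PB x y : dir x y -> P (x, y) \subset B x.
  by move=> xy; apply: fintype.subset_trans (finset.subsetUr _ _);
    apply: (finset.bigcup_sup y).
have SB x : S x \subset B x by apply: finset.subsetUl.
have PL x y g : dir x y -> g \in P (x, y) -> g \in L x y.
  by case/andP => xy _; case: (HP (x, y) xy) => /fintype.subsetP PL _ _ _;
    apply: PL.
have PS x y g : dir x y -> g \in P (x, y) -> g \in S y -> False.
  case/andP => xy _ gP gS; case: (HP (x, y) xy) => _ /= dis _ _.
  by rewrite (disjointFr dis gP) in gS.
have SP x y z g : g \in S x -> dir y z -> g \in P (y, z) -> x = y.
  move=> gS dyz gP; have := PL _ _ _ dyz gP; case/andP: (dyz) => yz _ gL.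
  case: (LS _ _ _ _ yz gL gS) => // xz; subst z; case: (PS _ _ _ dyz gP gS).
exists N, B; split.
- move=> x y g /B_out[gx|[x' dx gx]] /B_out[gy|[y' dy gy]].
  + exact: SS gx gy.
  + exact: SP gx dy gy.
  + by symmetry; apply: SP gy dx gx.
  + have /andP[ex rx] := dx; have /andP[ey ry] := dy.
    have := LL _ _ _ _ _ ex ey (PL _ _ _ dx gx) (PL _ _ _ dy gy).
    case/edge_set_eq => [[]//|[E1 E2]]; subst.
    by move: (ltn_trans rx ry); rewrite ltnn.
- move=> x g /B_out[/S_out[y [t [xy ht gt]]]|[y dxy
    /(PL _ _ _ dxy)/L_out[t [ht gt]]]].
    by have [n1 n2] := bnd1 x y t xy (third t ht); apply: corners_interior gt.
  have /andP[xy _] := dxy.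
  by have [n1 n2] := bnd1 x y t xy (mid t ht); apply: corners_interior gt.
- move=> x.
  have toS u : u \in B x -> exists2 v, v \in S x &
    connect (rel_in adj (B x)) u v.
    case/B_out => [uS|[y dxy uP]]; first by exists u.
    have /andP[xy _] := dxy; have [_ _ [u0 [u0P u0S] cP] _] := HP (x, y) xy.
    exists u0 => //; rewrite (connect_rel_in_sym (@grid_adj_sym N)).
    exact: connect_rel_inS (PB _ _ dxy) (cP u uP).
  move=> u v /toS[u' u'S uu'] /toS[v' v'S vv'].
  apply: connect_trans uu' _; rewrite (connect_rel_in_sym (@grid_adj_sym N)).
  apply: connect_trans vv' _.
  exact: connect_rel_inS (SB x) (Sconn x _ _ v'S u'S).
- have H x y : dir x y -> exists u v, [/\ u \in B x, v \in B y & adj u v].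
    move=> dxy; have /andP[xy _] := dxy;
      have [_ _ _ [u [v [uP vS uv]]]] := HP (x, y) xy.
    exists u, v; split=> //; first exact: (fintype.subsetP (PB _ _ dxy)).
    exact: (fintype.subsetP (SB y)).
  move=> x y xy; have [lt|gt|E] := ltngtP (rk x) (rk y).
  + by apply: H; rewrite /dir xy.
  + have [|u [v [uB vB uv]]] := H y x; first by rewrite /dir e_sym xy.
    by exists v, u; split=> //; rewrite grid_adj_sym.
  + by move: xy; rewrite (enum_rank_inj (val_inj E)) e_irr.
Qed.
End Model.
End Plane.

(** * Edge counts and sparse graphs *)

Section EdgeCount.
Variables (T : finType) (e : rel T).
Implicit Types (A B C D X Y Z : {set T}).

(** The number of ordered adjacent pairs in A x B; the set X spans half of
    adj_count X X edges. *)
Definition adj_count A B : nat := \sum_(x in A) \sum_(y in B) e x y.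

Lemma adj_count_splitl A B C :
  adj_count A B = adj_count (A :&: C) B + adj_count (A :\: C) B.
Proof. exact: big_setID. Qed.

Lemma adj_count_splitr A B C :
  adj_count A B = adj_count A (B :&: C) + adj_count A (B :\: C).
Proof. by rewrite /adj_count -big_split; apply: eq_bigr => x _;
  apply: big_setID. Qed.

Lemma adj_count_monol A B C : A \subset B -> adj_count A C <= adj_count B C.
Proof. by move=> /setIidPr E; rewrite (adj_count_splitl B C A) E leq_addr. Qed.

Lemma adj_count_monor A B C : A \subset B -> adj_count C A <= adj_count C B.
Proof. by move=> /setIidPr E; rewrite (adj_count_splitr C B A) E leq_addr. Qed.

Lemma adj_count_mono A B C D : A \subset B -> C \subset D ->
  adj_count A C <= adj_count B D.
Proof. by move=> AB CD; apply: leq_trans (adj_count_monol C AB)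
  (adj_count_monor B CD). Qed.

Lemma adj_countE A B : adj_count A B = \sum_(x in A) #|[set y in B | e x y]|.
Proof.
apply: eq_bigr => x _; rewrite -sum1_card big_mkcond [RHS]big_mkcond /=.
by apply: eq_bigr => y _; rewrite inE; case: (y \in B); case: (e x y).
Qed.

Lemma adj_count1 x A : adj_count [set x] A = #|[set y in A | e x y]|.
Proof. by rewrite adj_countE big_set1. Qed.

Lemma adj_count_leP A B (k : nat) :
  (forall x, x \in A -> k <= #|[set y in B | e x y]|) ->
  k * #|A| <= adj_count A B.
Proof. by move=> H; rewrite adj_countE mulnC -sum_nat_const; apply: leq_sum.
  Qed.

Lemma adj_count_geP A B (k : nat) :
  (forall x, x \in A -> #|[set y in B | e x y]| <= k) ->
  adj_count A B <= k * #|A|.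
Proof. by move=> H; rewrite adj_countE mulnC -sum_nat_const; apply: leq_sum.
  Qed.

Lemma adj_count_darts A B : adj_count A B =
  #|[set p : T * T | [&& p.1 \in A, p.2 \in B & e p.1 p.2]]|.
Proof.
rewrite -sum1_card (eq_bigl (fun p :
  T * T => (p.1 \in A) && ((p.2 \in B) && e p.1 p.2))); last by move=> p;
  rewrite inE.
rewrite -(pair_big_dep (mem A) (fun x y => (y \in B) && e x y) (fun _ _ => 1))
  /=.
apply: eq_bigr => x _; rewrite big_mkcondr /=.
by apply: eq_bigr => y _; case: (e x y).
Qed.

Hypothesis e_sym : symmetric e.

Lemma adj_count_sym A B : adj_count A B = adj_count B A.
Proof.
rewrite /adj_count exchange_big; apply: eq_bigr => x _; apply: eq_bigr => y _.
by rewrite e_sym.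
Qed.

Lemma adj_count_cut X Z : Z \subset X ->
  adj_count X X = adj_count Z Z + 2 * adj_count Z (X :\: Z) +
    adj_count (X :\: Z) (X :\: Z).
Proof.
move=> /setIidPr E; rewrite (adj_count_splitl X X Z) (adj_count_splitr _ X Z)
  (adj_count_splitr (X :\: Z) X Z) E.
by rewrite (adj_count_sym (X :\: Z) Z); lia.
Qed.

Hypothesis e_irr : irreflexive e.

Lemma adj_count11 x : adj_count [set x] [set x] = 0.
Proof. by rewrite /adj_count !big_set1 e_irr. Qed.

(** The bound 2|X| - 3 on the edges spanned by X, doubled because adj_count
    counts every edge in both directions. *)
Definition sparse := forall X, 1 < #|X| -> adj_count X X + 6 <= 4 * #|X|.

(** The average degree inside X is less than 4. *)
Lemma sparse_low_degree X : sparse -> X != set0 ->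
  exists2 x, x \in X & #|[set y in X | e x y]| <= 3.
Proof.
move=> sp X0; have [le1|gt1] := leqP #|X| 1.
  have /cards1P[x ->] : #|X| == 1 by rewrite eqn_leq le1 card_gt0.
  exists x; rewrite ?set11 //; apply: leq_trans (_ : #|[set x]| <= _);
    last by rewrite cards1.
  by apply: subset_leq_card; apply/subsetP => y; rewrite inE => /andP[].
have [/exists_inP[x xX hx]|] :=
  boolP [exists x in X, #|[set y in X | e x y]| <= 3]; first by exists x.
rewrite negb_exists_in => /forall_inP H.
have := sp X gt1.
have : 4 * #|X| <= adj_count X X by apply: adj_count_leP => x /H;
  rewrite -ltnNge.
lia.
Qed.
End EdgeCount.

(** * Even edge sets with at most five edges *)

Section SmallEven.
Variables (V : finType) (c : V -> V -> bool).
Hypotheses (c_sym : symmetric c) (c_irr : irreflexive c).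
Hypothesis c_even : forall x, boundary c x = false.

Definition nbrs u := [set v | c u v].
Definition supp := [set u | nbrs u != set0].

Lemma xor_odd (I : finType) (P : pred I) :
  \big[addb/false]_i P i = odd #|[set i | P i]|.
Proof.
rewrite -sum1_card (@big_morph _ _ odd false addb 0 addn oddD) //
  [RHS]big_mkcond.
by apply: eq_bigr => i _; rewrite inE; case: (P i).
Qed.

Lemma nbrs_even u : ~~ odd #|nbrs u|.
Proof. by rewrite -xor_odd; have := c_even u; rewrite /boundary => ->. Qed.

Lemma nbrs_ge2 u v : c u v -> 1 < #|nbrs u|.
Proof.
move=> uv; have := nbrs_even u.
have : 0 < #|nbrs u| by apply/card_gt0P; exists v; rewrite inE.
by case: #|_| => [|[|]].
Qed.

Lemma supp_l u v : c u v -> u \in supp.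
Proof. by move=> uv; rewrite inE; apply/set0Pn; exists v; rewrite inE. Qed.

Lemma supp_r u v : c u v -> v \in supp.
Proof. by rewrite c_sym; apply: supp_l. Qed.

Lemma nbrs_supp u : nbrs u \subset supp :\ u.
Proof.
apply/subsetP => v; rewrite inE => uv; rewrite in_setD1 (supp_r uv) andbT.
by apply/eqP => E; rewrite E c_irr in uv.
Qed.

Definition darts := [set p : V * V | c p.1 p.2].

Lemma card_darts : #|darts| = \sum_(u in supp) #|nbrs u|.
Proof.
rewrite -sum1_card (eq_bigl (fun p : V * V => c p.1 p.2)); last by move=> p;
  rewrite inE.
rewrite -(pair_big_dep xpredT c (fun _ _ => 1)) /= [RHS]big_mkcond.
apply: eq_bigr => u _; rewrite inE.
have [E|_] := eqVneq (nbrs u) set0.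
  rewrite big1 // => v uv; have : v \in nbrs u by rewrite inE.
  by rewrite E inE.
by rewrite -sum1_card; apply: eq_bigl => v; rewrite inE.
Qed.

(** A vertex of an even edge set has two neighbours, which makes three
    vertices with itself. *)
Lemma supp_gt2 x y : c x y -> 2 < #|supp|.
Proof.
move=> xy; have h := nbrs_ge2 xy; apply: leq_trans (_ : #|x |: nbrs x| <= _).
  by rewrite cardsU1 inE c_irr.
apply: subset_leq_card; rewrite subUset sub1set (supp_l xy).
by apply: subset_trans (nbrs_supp x) (subD1set _ _).
Qed.

Lemma supp_le : 2 * #|supp| <= #|darts|.
Proof.
rewrite card_darts mulnC -sum_nat_const; apply: leq_sum => u.
by rewrite inE => /set0Pn[v]; rewrite inE => /nbrs_ge2.
Qed.

Hypothesis c_small : #|darts| <= 10.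

(** Five edges leave room for at most five vertices of degree 2 or more; a
    vertex of degree at least 4 would need all five of them and six edges. *)
Lemma supp_2regular u : u \in supp -> #|nbrs u| = 2.
Proof.
move=> us; have [v uv] : exists v, c u v.
  by move: us; rewrite inE => /set0Pn[v]; rewrite inE; exists v.
have h2 := nbrs_ge2 uv; have h1 := supp_le.
have h3 : #|nbrs u| < #|supp|.
  have := subset_leq_card (nbrs_supp u); rewrite (cardsD1 u supp) us; lia.
have ev := nbrs_even u.
have [le4|gt4] := leqP #|supp| 4.
  by move: ev h2 h3; case: #|nbrs u| => [|[|[|[|k]]]] //; lia.
have : \sum_(w in supp :\ u) 2 <= \sum_(w in supp :\ u) #|nbrs w|.
  apply: leq_sum => w; rewrite !inE => /andP[_ /set0Pn[z]]; rewrite inE.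
  exact: nbrs_ge2.
rewrite sum_nat_const => h4.
move: c_small; rewrite card_darts (big_setD1 u) //=.
have := cardsD1 u supp; rewrite us; lia.
Qed.

Lemma two_nbrs u v w t : c u v -> c u w -> v != w -> c u t -> t = v \/ t = w.
Proof.
move=> uv uw vw ut.
have E : [set v; w] = nbrs u.
  apply/eqP; rewrite eqEcard supp_2regular ?(supp_l uv) // cards2 vw andbT.
  by apply/subsetP => s /set2P[]->; rewrite inE.
have : t \in nbrs u by rewrite inE.
by rewrite -E => /set2P.
Qed.

Lemma other_nbr u v : c u v -> exists w, [/\ c v w, w != u & w != v].
Proof.
move=> uv; have vu : c v u by rewrite c_sym.
have /card_gt1P[a [b [ha hb ab]]] := nbrs_ge2 vu.
rewrite !inE in ha hb.
have irr w : c v w -> w != v by move=> vw; apply/eqP => E;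
  rewrite E c_irr in vw.
have [E|NE] := eqVneq a u; last by exists a; rewrite irr.
by exists b; rewrite irr // hb -E eq_sym ab.
Qed.

(** A further cycle would need three more vertices. *)
Lemma closed_supp (S : {set V}) : S \subset supp ->
  (forall u v, u \in S -> c u v -> v \in S) -> #|supp| <= #|S| + 2 -> supp = S.
Proof.
move=> Ss Sc le2; apply/eqP; rewrite eqEsubset Ss andbT.
apply/subsetP => t ts; apply: contraLR le2 => tS; rewrite -ltnNge.
have ss : t |: nbrs t \subset supp :\: S.
  apply/subsetP => w /setU1P[->|]; first by rewrite inE tS.
  rewrite inE => tw; rewrite inE (supp_r tw) andbT.
  by apply: contra tS => wS; apply: (Sc w) => //; rewrite c_sym.
have := subset_leq_card ss.
rewrite cardsU1 supp_2regular // inE c_irr cardsD (setIidPr Ss) /=.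
have := subset_leq_card Ss; lia.
Qed.

Lemma dartsE : #|darts| = 2 * #|supp|.
Proof.
rewrite card_darts mulnC -sum_nat_const; apply: eq_bigr => u.
exact: supp_2regular.
Qed.

Lemma supp_le5 : #|supp| <= 5.
Proof. by have := dartsE; lia. Qed.

(** Follow the edges from x y. The walk can close up only at x, because the
    other vertices already have their two neighbours, and it closes after
    three, four or five steps; closed_supp excludes any other component. *)
Lemma short_cycle x y : c x y -> exists z, [/\ c y z, z != x, z != y &
  [\/ c z x /\ #|darts| = 6,
      exists w, [/\ c z w, c w x, uniq [:: x; y; z; w], #|darts| = 8 &
        supp = [set x; y; z; w]]
    | exists w v, [/\ c z w, c w v, c v x, uniq [:: x; y; z; w; v] &
      #|darts| = 10]]].
Proof.
move=> xy; have [z [yz zx zy]] := other_nbr xy.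
have [w [zw wy wz]] := other_nbr yz.
have yx : c y x by rewrite c_sym.
have zy' : c z y by rewrite c_sym.
have wz' : c w z by rewrite c_sym.
have x_y : x != y by apply/eqP => E; rewrite E c_irr in xy.
exists z; split=> //.
have le5 := supp_le5.
have [E|wx] := eqVneq w x.
  subst w; apply: Or31; split=> //; rewrite dartsE.
  have -> : supp = [set x; y; z].
    apply: closed_supp.
    - by rewrite !subUset !sub1set (supp_l xy) (supp_l yz) (supp_l zw).
    - move=> u v; rewrite !inE => /orP[/orP[]|] /eqP->.
      + by case/(two_nbrs xy wz'); rewrite 1?eq_sym // => ->;
          rewrite eqxx !orbT.
      + by case/(two_nbrs yx yz); rewrite 1?eq_sym // => ->; rewrite eqxx ?orbT.
      + by case/(two_nbrs zy' zw); rewrite 1?eq_sym // => ->;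
          rewrite eqxx ?orbT.
    - by rewrite -setUA cardsU1 cards2 !inE negb_or x_y (eq_sym x) zx
        (eq_sym y) zy; lia.
  by rewrite -setUA cardsU1 cards2 !inE negb_or x_y (eq_sym x) zx (eq_sym y) zy.
have [v [wv vz vw]] := other_nbr zw.
have vw' : c v w by rewrite c_sym.
have vy : v != y.
  apply/eqP => E; subst v; case: (two_nbrs yx yz _ vw');
    rewrite 1?eq_sym // => E; subst.
    by rewrite eqxx in wx.
  by rewrite eqxx in wz.
have U4 : uniq [:: x; y; z; w].
  rewrite /= !inE !negb_or x_y [x == z]eq_sym zx [x == w]eq_sym wx
    [y == z]eq_sym zy.
  by rewrite [y == w]eq_sym wy [z == w]eq_sym wz.
have C4 : #|[set x; y; z; w]| = 4.
  by rewrite -[RHS]/(size [:: x; y; z; w]) -(card_uniqP U4);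
    apply: eq_card => t; rewrite !inE -!orbA.
have S4 : [set x; y; z; w] \subset supp.
  by rewrite !subUset !sub1set (supp_l xy) (supp_l yz) (supp_l zw) (supp_l wv).
have [E|vx] := eqVneq v x.
  subst v; apply: Or32; exists w.
  have Es : supp = [set x; y; z; w].
    apply: (closed_supp S4); last first.
      rewrite C4; exact: leq_trans le5 _.
    move=> u v; rewrite !inE => /orP[/orP[/orP[]|]|] /eqP->.
    + by case/(two_nbrs xy vw'); rewrite 1?eq_sym // => ->; rewrite eqxx ?orbT.
    + by case/(two_nbrs yx yz); rewrite 1?eq_sym // => ->; rewrite eqxx ?orbT.
    + by case/(two_nbrs zy' zw); rewrite 1?eq_sym // => ->; rewrite eqxx ?orbT.
    + by case/(two_nbrs wz' wv); rewrite 1?eq_sym // => ->; rewrite eqxx ?orbT.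
  by split; rewrite // dartsE Es C4.
apply: Or33; exists w, v.
have U5 : uniq [:: x; y; z; w; v].
  move: U4; rewrite /= !inE !negb_or.
  by rewrite [x == v]eq_sym vx [y == v]eq_sym vy [z == v]eq_sym vz
    [w == v]eq_sym vw !andbT.
have C5 : #|[set x; y; z; w; v]| = 5.
  by rewrite -[RHS]/(size [:: x; y; z; w; v]) -(card_uniqP U5);
    apply: eq_card => t; rewrite !inE -!orbA.
have Es : supp = [set x; y; z; w; v].
  apply/esym/eqP; rewrite eqEcard C5 le5 andbT.
  by rewrite subUset S4 sub1set (supp_r wv).
have [s [vs sw sv]] := other_nbr wv.
have : s \in supp by apply: supp_r vs.
have sv' : c s v by rewrite c_sym.
rewrite Es !inE (negPf sv) (negPf sw) !orbF.
case/orP=> [/orP[/eqP E|/eqP E]|/eqP E]; subst s.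
- by split=> //; rewrite dartsE Es C5.
- case: (two_nbrs yx yz _ sv'); rewrite 1?eq_sym // => E; subst.
    by rewrite eqxx in vx.
  by rewrite eqxx in vz.
- case: (two_nbrs zy' zw _ sv'); rewrite 1?eq_sym // => E; subst.
    by rewrite eqxx in vy.
  by rewrite eqxx in vw.
Qed.
End SmallEven.

(** * Forbidden chords *)

Section Chords.
Variables (T : finType) (e : rel T).

Lemma chord4 a b c d : ~ (exists s, chordal_cycle e 4 s) ->
  uniq [:: a; b; c; d] ->
  e a b -> e b c -> e c d -> e d a -> ~~ e a c.
Proof.
move=> no U ab bc cd da; apply/negP => ac; apply: no; exists [:: a; b; c; d];
  split.
  by rewrite /graph_cycle /ucycleb /= ab bc cd da; move: U => /= ->.
exists a, c; split; rewrite ?inE ?eqxx ?orbT //.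
move: U; rewrite /cycle_edge /= !inE !negb_or !andbT.
case/and3P=> /and3P[nab nac nad] /andP[nbc nbd] ncd.
by rewrite !eqxx [c == a]eq_sym [c == b]eq_sym (negPf nab) (negPf nac)
  (negPf nad) (negPf nbc) (negPf ncd) /= ?orbT /=.
Qed.

Lemma chord6_2 a b c d f g : ~ (exists s, chordal_cycle e 6 s) ->
  uniq [:: a; b; c; d; f; g] ->
  e a b -> e b c -> e c d -> e d f -> e f g -> e g a -> ~~ e a c.
Proof.
move=> no U ab bc cd df fg ga; apply/negP => ac; apply: no;
  exists [:: a; b; c; d; f; g]; split.
  by rewrite /graph_cycle /ucycleb /= ab bc cd df fg ga; move: U => /= ->.
exists a, c; split; rewrite ?inE ?eqxx ?orbT //.
move: U; rewrite /cycle_edge /= !inE !negb_or !andbT.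
case/and5P=> /and5P[nab nac nad naf nag] /and4P[nbc nbd nbf nbg]
  /and3P[ncd ncf ncg] _ _.
by rewrite !eqxx [c == a]eq_sym [c == b]eq_sym (negPf nab) (negPf nac)
  (negPf nad) (negPf nbc) (negPf ncd) /= ?orbT /=.
Qed.

Lemma chord6_3 a b c d f g : ~ (exists s, chordal_cycle e 6 s) ->
  uniq [:: a; b; c; d; f; g] ->
  e a b -> e b c -> e c d -> e d f -> e f g -> e g a -> ~~ e a d.
Proof.
move=> no U ab bc cd df fg ga; apply/negP => ad; apply: no;
  exists [:: a; b; c; d; f; g]; split.
  by rewrite /graph_cycle /ucycleb /= ab bc cd df fg ga; move: U => /= ->.
exists a, d; split; rewrite ?inE ?eqxx ?orbT //.
move: U; rewrite /cycle_edge /= !inE !negb_or !andbT.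
case/and5P=> /and5P[nab nac nad naf nag] /and4P[nbc nbd nbf nbg]
  /and3P[ncd ncf ncg] /andP[ndf ndg] _.
by rewrite !eqxx [d == a]eq_sym [d == b]eq_sym [d == c]eq_sym (negPf nab)
  (negPf nac) (negPf nad) (negPf nbd) (negPf ncd) (negPf naf) (negPf ndf) /=
  ?orbT /=.
Qed.
End Chords.

(** * Faces of a graph without small edge cuts *)

Section MinimalGraph.
Variables (T : finType) (e : rel T).
Hypotheses (e_sym : symmetric e) (e_irr : irreflexive e).
Hypothesis no4 : ~ exists s, chordal_cycle e 4 s.
Hypothesis no6 : ~ exists s, chordal_cycle e 6 s.
Variable X : {set T}.
Hypothesis cut3 : forall Z : {set T}, Z \subset X -> Z != set0 -> Z != X ->
  2 < adj_count e Z (X :\: Z).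
Local Notation E := (rel_in e X).
Variables (F : finType) (fc : T -> T -> F).
Hypothesis fs : face_structure E fc.

Lemma E_sym : symmetric E. Proof. exact: rel_in_sym. Qed.
Lemma E_irr : irreflexive E. Proof. by move=> x;
  rewrite /rel_in /= e_irr !andbF. Qed.
Lemma E_e x y : E x y -> e x y. Proof. by case/and3P. Qed.

(** Delete both edges. If the ends of x y are still connected, then a path
    between them closes up to a cycle; otherwise the component of x is one
    side of an edge cut with at most two edges. *)
Lemma separating_cycle x y z w : E x y -> E z w ->
  exists c : T -> T -> bool, [/\ symmetric c, forall u v, c u v -> E u v,
    forall u, boundary c u = false, c x y & c z w ->
      (z, w) = (x, y) \/ (z, w) = (y, x)].
Proof.
move=> xy zw; have x_y : x != y by apply/eqP => eq; rewrite eq E_irr in xy.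
pose r u v := E u v && ((u, v) \notin [:: (x, y); (y, x); (z, w); (w, z)]).
have r_sym : symmetric r.
  move=> u v; rewrite /r (E_sym u v) !inE !xpair_eqE; congr (_ && ~~ _).
  by do ![case: eqP => _ //=].
have r_irr : irreflexive r by move=> u; rewrite /r E_irr.
have [rxy|nrxy] := boolP (connect r x y).
  have [c [csym cr cbd]] := path_chain r_sym r_irr rxy.
  exists (fun u v => c u v (+)
    (((v == y) && (u == x)) (+) ((v == x) && (u == y)))); split.
  - move=> u v; rewrite csym; congr (_ (+) _).
    by rewrite addbC (andbC (u == x)) (andbC (u == y)).
  - move=> u v; case cuv: (c u v); first by case/andP: (cr _ _ cuv).
    case E1: ((v == y) && (u == x)); first by case/andP: E1 => /eqP-> /eqP->.
    by move=> /andP[/eqP-> /eqP->]; rewrite E_sym.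
  - move=> u; rewrite boundaryD cbd boundaryD /boundary !xor_delta.
    by case: (u == x); case: (u == y).
  - rewrite !eqxx (negPf x_y) andbF /=; apply/negPn/negP => h.
    have : c x y by move: h; case: (c x y).
    by move/cr; rewrite /r inE eqxx andbF.
  - have -> : c z w = false.
      by apply/negP => /cr; rewrite /r !inE eqxx !orbT andbF.
    case E1: ((w == y) && (z == x)); first by case/andP: E1 => /eqP-> /eqP->;
      left.
    by move=> /andP[/eqP-> /eqP->]; right.
pose Z := [set u in X | connect r x u].
have /and3P[xX yX exy] := xy; have /and3P[zX wX ezw] := zw.
have xZ : x \in Z by rewrite inE xX connect0.
have yZ : y \notin Z by rewrite inE (negPf nrxy) andbF.
have ZX : Z \subset X by apply/subsetP => u; rewrite inE => /andP[].
have := cut3 ZX; rewrite adj_count_darts.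
have -> : Z != set0 by apply/set0Pn; exists x.
have -> : Z != X by apply: contra yZ => /eqP->.
have H p : p \in [set p : T * T | [&& p.1 \in Z, p.2 \in X :\: Z & e p.1 p.2]]
  ->
   [/\ p.1 \in Z, p.2 \notin Z & p \in [:: (x, y); (y, x); (z, w); (w, z)]].
  case: p => u v; rewrite inE /= => /and3P[uZ]; rewrite inE => /andP[vZ vX] uv.
  split=> //; have uX : u \in X := subsetP ZX u uZ.
  apply: contraR vZ => nl; rewrite inE vX /=.
  apply: (@connect_trans _ _ u); first by move: uZ; rewrite inE => /andP[].
  by apply: connect1; rewrite /r nl andbT /rel_in /= uX vX.
move=> /(_ isT isT); rewrite ltnNge; case/negP.
have [zZ|zZ] := boolP (z \in Z).
  apply: leq_trans (_ : #|[set (x, y); (z, w)]| <= _); last by rewrite cards2;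
    case: (_ != _).
  apply: subset_leq_card; apply/subsetP => p /H[p1 p2].
  rewrite !inE => /or4P[] /eqP eq; subst p; rewrite ?eqxx ?orbT //= in p1 p2 *.
  - by rewrite p1 in yZ.
  - by rewrite zZ in p2.
apply: leq_trans (_ : #|[set (x, y); (w, z)]| <= _); last by rewrite cards2;
  case: (_ != _).
apply: subset_leq_card; apply/subsetP => p /H[p1 p2].
rewrite !inE => /or4P[] /eqP eq; subst p; rewrite ?eqxx ?orbT //= in p1 p2 *.
- by rewrite p1 in yZ.
- by rewrite p1 in zZ.
Qed.

Lemma fc_neq x y : E x y -> fc x y != fc y x.
Proof.
move=> xy; have [c [csym cE ceven cxy _]] := separating_cycle xy xy.
have [phi /(_ x y xy)] := fs.1 c csym cE ceven.
by rewrite cxy; apply: contraPneq => ->; rewrite addbb.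
Qed.

(** A cycle through one edge and not the other is the boundary of a set of
    faces, which therefore distinguishes the faces of the two edges. *)
Lemma fc_inj x y z w : E x y -> E z w -> fc x y = fc z w -> fc y x = fc w z ->
  x = z /\ y = w.
Proof.
move=> xy zw e1 e2; have [c [csym cE ceven cxy czw]] := separating_cycle xy zw.
have [phi Hphi] := fs.1 c csym cE ceven.
have := Hphi x y xy; rewrite cxy e1 e2 -(Hphi z w zw) =>
  /esym/czw[[-> ->]//|[ez ew]].
by have := fc_neq xy; rewrite e1 ez ew eqxx.
Qed.

(** The edges with the face f on exactly one side, which is the coboundary of
    f and hence an even edge set. *)
Definition border f u v := E u v && ((fc u v == f) (+) (fc v u == f)).

Lemma border_sym f : symmetric (border f).
Proof. by move=> u v; rewrite /border (E_sym u v) addbC. Qed.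
Lemma border_irr f : irreflexive (border f).
Proof. by move=> u; rewrite /border E_irr. Qed.
Lemma border_even f u : boundary (border f) u = false.
Proof. exact: (fs.2 (fun g => g == f) u). Qed.
Lemma border_E f u v : border f u v -> E u v.
Proof. by case/andP. Qed.
Lemma border_e f u v : border f u v -> e u v.
Proof. by move/border_E/E_e. Qed.

Lemma borderE f u v : border f u v = E u v && ((fc u v == f) || (fc v u == f)).
Proof.
rewrite /border; case uv: (E u v) => //=; have := fc_neq uv.
by case: (fc u v =P f) => [->|//]; rewrite eq_sym => /negPf->.
Qed.

Definition fdarts f := [set p : T * T | E p.1 p.2 && (fc p.1 p.2 == f)].
(** Each edge of the border of f has a single orientation with f on its
    left. *)
Definition face_len f := #|fdarts f|.

Lemma card_border f : #|darts (border f)| = 2 * face_len f.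
Proof.
pose sw (p : T * T) := (p.2, p.1).
have swK : involutive sw by case.
have -> : darts (border f) = fdarts f :|: sw @: fdarts f.
  apply/setP => -[u v]; rewrite !inE /= borderE.
  have -> : ((u, v) \in sw @: fdarts f) = E u v && (fc v u == f).
    rewrite -[(u, v)]/(sw (v, u)) (mem_imset _ _ (inv_inj swK)) inE /=.
    by rewrite E_sym.
  by rewrite -andb_orr.
rewrite cardsU (card_imset _ (inv_inj swK)) disjoint_setI0 ?cards0 /face_len;
  first lia.
rewrite -setI_eq0; apply/set0Pn => -[[u v]]; rewrite inE => /andP[].
rewrite -[(u, v)]/(sw (v, u)) (mem_imset _ _ (inv_inj swK)) !inE /=.
by case/andP=> uv /eqP <- /andP[_]; rewrite eq_sym (negPf (fc_neq uv)).
Qed.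

Lemma len_ge3 x y : E x y -> 3 <= face_len (fc x y).
Proof.
move=> xy; have bxy : border (fc x y) x y by rewrite borderE xy eqxx.
have := supp_gt2 (@border_sym _) (@border_irr _) (@border_even _) bxy.
have := supp_le (@border_even (fc x y)).
by rewrite card_border; lia.
Qed.

Lemma border_l x y : E x y -> border (fc x y) x y.
Proof. by move=> xy; rewrite borderE xy eqxx. Qed.
Lemma border_r x y : E x y -> border (fc y x) x y.
Proof. by move=> xy; rewrite borderE xy eqxx orbT. Qed.

(** By fc_inj two distinct faces have at most one common edge. *)
Lemma share_one f g x y u v : f != g -> border f x y -> border g x y ->
  border f u v -> border g u v -> (u = x /\ v = y) \/ (u = y /\ v = x).
Proof.
move=> fg; rewrite !borderE =>
  /andP[xy f1] /andP[_ g1] /andP[uv f2] /andP[_ g2].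
have yx : E y x by rewrite E_sym.
have aux a b : fc a b == f -> fc a b == g -> False.
  by move=> /eqP-> /eqP e1; rewrite e1 eqxx in fg.
case/orP: f1 => f1; case/orP: g1 => g1; try (by case: (aux _ _ f1 g1));
case/orP: f2 => f2; case/orP: g2 => g2; try (by case: (aux _ _ f2 g2)).
all: move: f1 g1 f2 g2 => /eqP f1 /eqP g1 /eqP f2 /eqP g2.
- by left; apply: fc_inj => //; congruence.
- by right; apply: fc_inj => //; congruence.
- by right; apply: fc_inj => //; congruence.
- by left; apply: fc_inj => //; congruence.
Qed.

Lemma triangle_border f x y : face_len f = 3 -> border f x y ->
  exists z, [/\ z != x, z != y, border f y z & border f z x].
Proof.
move=> l3 xy; have cb := card_border f.
have [|z [yz zx zy H]] := short_cycle (@border_sym f) (@border_irr f)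
  (@border_even f) _ xy.
  by rewrite cb l3.
exists z; split=> //; rewrite cb l3 in H.
by case: H => [[]//|[w []]//|[w [v []]]//].
Qed.

Lemma quad_border f x y : face_len f = 4 -> border f x y ->
  exists z w, [/\ uniq [:: x; y; z; w], border f y z, border f z w &
    border f w x] /\
    forall u v, border f u v -> u \in [:: x; y; z; w].
Proof.
move=> l4 xy; have cb := card_border f.
have [|z [yz zx zy H]] := short_cycle (@border_sym f) (@border_irr f)
  (@border_even f) _ xy.
  by rewrite cb l4.
rewrite cb l4 in H; case: H => [[]//|[w [zw wx U _ Es]]|[w [v []]]//].
exists z, w; split=> // u v uv; have := supp_l uv.
by rewrite Es !inE -!orbA.
Qed.

Lemma penta_border f x y : face_len f = 5 -> border f x y ->
  exists z w v, [/\ uniq [:: x; y; z; w; v], border f y z, border f z w,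
    border f w v & border f v x].
Proof.
move=> l5 xy; have cb := card_border f.
have [|z [yz zx zy H]] := short_cycle (@border_sym f) (@border_irr f)
  (@border_even f) _ xy.
  by rewrite cb l5.
rewrite cb l5 in H; case: H => [[]//|[w []]//|[w [v [zw wv vx U _]]]].
by exists z, w, v.
Qed.

(** The two triangles would form a 4-cycle with their common edge as a
    chord. *)
Lemma no_tri_tri x y : E x y -> face_len (fc x y) = 3 ->
  face_len (fc y x) = 3 -> False.
Proof.
move=> xy l3 l3'; have fg := fc_neq xy.
have [z [zx zy yz zx']] := triangle_border l3 (border_l xy).
have [w [wx wy yw wx']] := triangle_border l3' (border_r xy).
have zw : z != w.
  apply/eqP => eq; subst w.
  have [[]|[]] := share_one fg (border_l xy) (border_r xy) yz yw.
    by move=> _ eq; rewrite eq eqxx in zy.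
  by move=> _ eq; rewrite eq eqxx in zx.
have xny : x != y by apply/eqP => eq; rewrite eq E_irr in xy.
have := @chord4 _ e x z y w no4.
rewrite (E_e xy) /= !inE !negb_or (eq_sym x z) zx xny (eq_sym x w) wx zy zw
  (eq_sym y w) wy.
rewrite e_sym (border_e zx') e_sym (border_e yz) (border_e yw) (border_e wx').
by move=> /(_ isT isT isT isT isT).
Qed.

(** If the quadrilaterals have six vertices altogether, their union is a
    6-cycle with the common edge as a chord; any coincidence between further
    vertices is a second common edge or a chord of one of the 4-cycles. *)
Lemma no_quad_quad x y : E x y -> face_len (fc x y) = 4 ->
  face_len (fc y x) = 4 -> False.
Proof.
move=> xy l4 l4'; have fg := fc_neq xy; have exy := E_e xy.
have [z [w [[U1 yz zw wx] _]]] := quad_border l4 (border_l xy).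
have [p [q [[U2 yp pq qx] _]]] := quad_border l4' (border_r xy).
have Hs := share_one fg (border_l xy) (border_r xy).
have := U1; have := U2; rewrite /= !inE !negb_or !andbT.
case/and3P=> /and3P[xny xp xq] /andP[y_p y_q] p_q
  /and3P[/and3P[_ xz xw] /andP[y_z y_w] z_w].
have zp : z != p.
  apply/eqP => eq; subst p; have [[eq _]|[_ eq]] := Hs _ _ yz yp.
    by rewrite eq eqxx in xny.
  by rewrite eq eqxx in xz.
have wq : w != q.
  apply/eqP => eq; subst q; have [[eq _]|[eq _]] := Hs _ _ wx qx.
    by rewrite eq eqxx in xw.
  by rewrite eq eqxx in y_w.
have zq : z != q.
  apply/eqP => eq; subst q; have :=
    chord4 no4 U1 exy (border_e yz) (border_e zw) (border_e wx).
  by rewrite e_sym (border_e qx).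
have wp : w != p.
  apply/eqP => eq; subst p.
  have := @chord4 _ e y z w x no4.
  rewrite (border_e yz) (border_e zw) (border_e wx) exy (border_e yp) /= !inE
    !negb_or.
  rewrite y_z y_w (eq_sym y x) xny z_w (eq_sym z x) xz (eq_sym w x) xw.
  by move=> /(_ isT isT isT isT isT).
have := @chord6_3 _ e x w z y p q no6.
rewrite exy /= !inE !negb_or xw xz xny xp xq (eq_sym w z) z_w (eq_sym w y) y_w
  wp wq.
rewrite (eq_sym z y) y_z zp zq y_p y_q p_q.
rewrite e_sym (border_e wx) e_sym (border_e zw) e_sym (border_e yz)
  (border_e yp) (border_e pq) (border_e qx).
by move=> /(_ isT isT isT isT isT isT isT).
Qed.

(** The apex of the triangle extends the pentagon to a 6-cycle with the common
    edge as a chord, unless it lies on the pentagon; then it gives a second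
    common edge or a chordal 4-cycle. *)
Lemma no_tri_penta x y : E x y -> face_len (fc x y) = 3 ->
  face_len (fc y x) = 5 -> False.
Proof.
move=> xy l3 l5; have fg := fc_neq xy; have exy := E_e xy.
have [t [tx ty yt tx']] := triangle_border l3 (border_l xy).
have [z [w [v [U yz zw wv vx]]]] := penta_border l5 (border_r xy).
have Hs := share_one fg (border_l xy) (border_r xy).
have := U; rewrite /= !inE !negb_or !andbT.
case/and4P=> /and4P[xny xz xw xv] /and3P[y_z y_w y_v] /andP[z_w z_v] w_v.
have tz : t != z.
  apply/eqP => eq; subst t; have [[eq _]|[_ eq]] := Hs _ _ yt yz.
    by rewrite eq eqxx in xny.
  by rewrite eq eqxx in xz.
have tv : t != v.
  apply/eqP => eq; subst t; have [[eq _]|[eq _]] := Hs _ _ tx' vx.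
    by rewrite eq eqxx in xv.
  by rewrite eq eqxx in y_v.
have tw : t != w.
  apply/eqP => eq; subst t.
  have := @chord4 _ e y z w x no4.
  rewrite (border_e yz) (border_e zw) (border_e tx') exy (border_e yt) /= !inE
    !negb_or.
  rewrite y_z y_w (eq_sym y x) xny z_w (eq_sym z x) xz (eq_sym w x) xw.
  by move=> /(_ isT isT isT isT isT).
have := @chord6_2 _ e x t y z w v no6.
rewrite exy /= !inE !negb_or (eq_sym x t) tx xny xz xw xv ty tz tw tv y_z y_w
  y_v z_w z_v w_v.
rewrite e_sym (border_e tx') e_sym (border_e yt) (border_e yz) (border_e zw)
  (border_e wv) (border_e vx).
by move=> /(_ isT isT isT isT isT isT isT).
Qed.

(** The two apexes extend the 4-cycle to a 6-cycle with the side x y as a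
    chord. An apex cannot lie on the 4-cycle without giving it a diagonal, and
    if the apexes coincide they give a chordal 4-cycle. *)
Lemma two_apexes_adjacent x y z w p q : uniq [:: x; y; z; w] ->
  e x y -> e y z -> e z w -> e w x ->
  p != x -> p != y -> e x p -> e y p -> q != y -> q != z -> e y q -> e z q ->
    False.
Proof.
move=> U xy yz zw wx px py xp yp qy qz y_q z_q.
have := U; rewrite /= !inE !negb_or !andbT.
case/and3P=> /and3P[nxy nxz nxw] /andP[nyz nyw] nzw.
have nexz := chord4 no4 U xy yz zw wx.
have neyw : ~~ e y w.
  have := @chord4 _ e y z w x no4; rewrite /= !inE !negb_or nyz nyw nzw.
  by rewrite (eq_sym y x) nxy (eq_sym z x) nxz (eq_sym w x) nxw; apply.
have pz : p != z by apply: contraNneq nexz => <-.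
have pw : p != w by apply: contraNneq neyw => <-.
have qx : q != x by apply: contraNneq nexz => <-; rewrite e_sym.
have qw : q != w by apply: contraNneq neyw => <-.
have [eq|pq] := eqVneq p q.
  subst q; have := @chord4 _ e p x y z no4.
  rewrite /= !inE !negb_or px py pz nxy nxz nyz.
  by rewrite e_sym xp xy yz z_q e_sym yp => /(_ isT isT isT isT isT).
have := @chord6_2 _ e x p y q z w no6.
rewrite /= !inE !negb_or (eq_sym x p) px nxy (eq_sym x q) qx nxz nxw py pq pz
  pw.
rewrite (eq_sym y q) qy nyz nyw qz qw nzw xp e_sym yp y_q e_sym z_q zw wx xy.
by move=> /(_ isT isT isT isT isT isT isT).
Qed.

Lemma two_apexes_opposite x y z w p q : uniq [:: x; y; z; w] ->
  e x y -> e y z -> e z w -> e w x ->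
  p != x -> p != y -> e x p -> e y p -> q != z -> q != w -> e z q -> e w q ->
    False.
Proof.
move=> U xy yz zw wx px py xp yp qz qw z_q w_q.
have := U; rewrite /= !inE !negb_or !andbT.
case/and3P=> /and3P[nxy nxz nxw] /andP[nyz nyw] nzw.
have nexz := chord4 no4 U xy yz zw wx.
have neyw : ~~ e y w.
  have := @chord4 _ e y z w x no4; rewrite /= !inE !negb_or nyz nyw nzw.
  by rewrite (eq_sym y x) nxy (eq_sym z x) nxz (eq_sym w x) nxw; apply.
have pz : p != z by apply: contraNneq nexz => <-.
have pw : p != w by apply: contraNneq neyw => <-.
have qx : q != x by apply: contraNneq nexz => <-; rewrite e_sym.
have qy : q != y by apply: contraNneq neyw => <-; rewrite e_sym.
have [eq|pq] := eqVneq p q.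
  subst q; have := @chord4 _ e p x y z no4.
  rewrite /= !inE !negb_or px py pz nxy nxz nyz.
  by rewrite e_sym xp xy yz z_q e_sym yp => /(_ isT isT isT isT isT).
have := @chord6_2 _ e x p y z q w no6.
rewrite /= !inE !negb_or (eq_sym x p) px nxy (eq_sym x q) qx nxz nxw py pq pz
  pw.
rewrite (eq_sym y q) qy nyz nyw (eq_sym z q) qz nzw qw xp e_sym yp yz z_q e_sym
  w_q wx xy.
by move=> /(_ isT isT isT isT isT isT isT).
Qed.

(** The two sides of the quadrilateral are either consecutive or opposite, up
    to its symmetries. *)
Lemma quad_one_tri f x y u v : face_len f = 4 -> E x y -> E u v ->
  fc x y = f -> fc u v = f ->
  face_len (fc y x) = 3 -> face_len (fc v u) = 3 -> x = u /\ y = v.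
Proof.
move=> l4 xy uv fx fu t1 t2.
have bxy : border f x y by rewrite -fx border_l.
have buv : border f u v by rewrite -fu border_l.
have [z [w [[U yz zw wx] S]]] := quad_border l4 bxy.
have [p [px py yp px']] := triangle_border t1 (border_r xy).
have [q [qu qv vq qu']] := triangle_border t2 (border_r uv).
have exy := E_e xy; have xp : e x p by rewrite e_sym (border_e px').
have uq : e u q by rewrite e_sym (border_e qu').
have := U; rewrite /= !inE !negb_or !andbT.
case/and3P=> /and3P[nxy nxz nxw] /andP[nyz nyw] nzw.
have uS := S u v buv.
have vS : v \in [:: x; y; z; w] by apply: (S v u); rewrite border_sym.
have nexz := chord4 no4 U exy (border_e yz) (border_e zw) (border_e wx).
have neyw : ~~ e y w.
  have := @chord4 _ e y z w x no4; rewrite /= !inE !negb_or nyz nyw nzw.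
  rewrite (eq_sym y x) nxy (eq_sym z x) nxz (eq_sym w x) nxw.
  by rewrite (border_e yz) (border_e zw) (border_e wx) exy; apply.
have euv := E_e uv.
have Ur : uniq [:: y; x; w; z].
  by rewrite /= !inE !negb_or (eq_sym y x) nxy nyw nyz nxw nxz (eq_sym w z) nzw.
have Eyx : e y x by rewrite e_sym. have Exw :
  e x w by rewrite e_sym (border_e wx).
have Ewz : e w z by rewrite e_sym (border_e zw). have Ezy :
  e z y by rewrite e_sym (border_e yz).
have adj1 := two_apexes_adjacent U exy (border_e yz) (border_e zw)
  (border_e wx) px py xp (border_e yp).
have opp := two_apexes_opposite U exy (border_e yz) (border_e zw) (border_e wx)
  px py xp (border_e yp).
have adj2 := two_apexes_adjacent Ur Eyx Exw Ewz Ezy py px (border_e yp) xp.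
have evq := border_e vq.
move: uS vS; rewrite !inE => /or4P[] /eqP eu /or4P[] /eqP ev; subst u v.
all: try by [].
all: try by rewrite e_irr in euv.
all: try by rewrite euv in nexz.
all: try by rewrite euv in neyw.
all: try by rewrite e_sym euv in nexz.
all: try by rewrite e_sym euv in neyw.
- case: (adj2 q) => //.
- by have := fc_neq xy; rewrite fx -fu eqxx.
- case: (adj1 q) => //.
- case: (adj1 q) => //.
- case: (opp q) => //.
- case: (adj2 q) => //.
- case: (opp q) => //.
Qed.
End MinimalGraph.

(** * Counting faces: Euler and discharging *)

Section Euler.
Variables (T : finType) (e : rel T).
Hypotheses (e_sym : symmetric e) (e_irr : irreflexive e).
Variable X : {set T}.
Local Notation E := (rel_in e X).
Variables (F : finType) (fc : T -> T -> F).
Hypothesis fs : face_structure E fc.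

Definition used_faces := [set f | [exists x, exists y, E x y && (fc x y == f)]].

Lemma fc_used x y : E x y -> fc x y \in used_faces.
Proof.
by move=> xy; rewrite inE; apply/existsP; exists x; apply/existsP; exists y;
  rewrite xy eqxx.
Qed.

Implicit Types A B : {set T * T}.
(** Selecting one orientation of each edge makes the sets of edges plain sets
    of pairs, which can be counted. *)
Definition edges := [set p : T * T | E p.1 p.2 &&
  (enum_rank p.1 < enum_rank p.2)].

Lemma card_edges : adj_count e X X = 2 * #|edges|.
Proof.
pose sw (p : T * T) := (p.2, p.1).
have swK : involutive sw by case.
rewrite adj_count_darts.
have -> : [set p : T * T | [&& p.1 \in X, p.2 \in X & e p.1 p.2]] =
  edges :|: sw @: edges.
  apply/setP => -[u v]; rewrite !inE /=.
  have -> : ((u, v) \in sw @: edges) = E u v && (enum_rank v < enum_rank u).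
    rewrite -[(u, v)]/(sw (v, u)) (mem_imset _ _ (inv_inj swK)) inE /=.
    by rewrite (rel_in_sym e_sym X v u).
  rewrite -andb_orr -neq_ltn -[rel_in e X u v]/([&& u \in X, v \in X & e u v]).
  case: and3P => // -[_ _ uv]; apply/esym/eqP => eq.
  by move: uv; rewrite (enum_rank_inj (val_inj eq)) e_irr.
rewrite cardsU (card_imset _ (inv_inj swK)) disjoint_setI0 ?cards0; first lia.
rewrite -setI_eq0; apply/set0Pn => -[[u v]]; rewrite inE => /andP[].
rewrite -[(u, v)]/(sw (v, u)) (mem_imset _ _ (inv_inj swK)) !inE /=.
by case/andP=> _ /ltnW; rewrite leqNgt => /negPf-> /andP[].
Qed.

Definition chain_of (A : {set T * T}) x y := ((x, y) \in A) (+) ((y, x) \in A).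

Lemma chain_of_sym A : symmetric (chain_of A).
Proof. by move=> x y; rewrite /chain_of addbC. Qed.

Lemma chain_of_E A x y : A \subset edges -> chain_of A x y -> E x y.
Proof.
move=> /subsetP AE; rewrite /chain_of.
case xy: ((x, y) \in A); first by have := AE _ xy; rewrite inE => /andP[].
by move=> /= /AE; rewrite inE => /andP[/=]; rewrite (rel_in_sym e_sym X y x).
Qed.

(** An edge set A is determined by two data: its boundary outside of the
    vertex x0, and a set of faces avoiding f0. Indeed the boundary determines
    a representative edge set rep, the sum of A and rep is even, and it is the
    boundary of a set of faces which may be complemented so as to avoid f0.
    Hence 2 ^ |E| <= 2 ^ (|X| - 1) * 2 ^ (|F| - 1). *)
Lemma euler_bound x0 f0 : x0 \in X -> f0 \in used_faces ->
  #|edges| + 2 <= #|X| + #|used_faces|.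
Proof.
move=> x0X f0F.
pose bdX A := [set x in X :\ x0 | boundary (chain_of A) x].
have /choice[rep Hrep] : forall S, exists B,
  (exists2 A : {set T * T}, A \subset edges & bdX A = S) ->
    B \subset edges /\ bdX B = S.
  move=> S; have [[A AE HA]|n] :=
    pselect (exists2 A : {set T * T}, A \subset edges & bdX A = S).
    by exists A.
  by exists set0.
have repP A : A \subset edges ->
  rep (bdX A) \subset edges /\ bdX (rep (bdX A)) = bdX A.
  by move=> AE; apply: Hrep; exists A.
pose cc A x y := chain_of A x y (+) chain_of (rep (bdX A)) x y.
have /choice[ph Hph] : forall A, exists S : {set F}, A \subset edges ->
   S \subset used_faces :\ f0 /\ forall x y, E x y ->
     cc A x y = (fc x y \in S) (+) (fc y x \in S).
  move=> A; have [AE|] := boolP (A \subset edges); last by exists set0.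
  have [RE Rbd] := repP A AE.
  have csym : symmetric (cc A) by move=> x y; rewrite /cc !(chain_of_sym _ x).
  have cE x y : cc A x y -> E x y.
    rewrite /cc; case Hx: (chain_of A x y); first by move=> _;
      apply: chain_of_E Hx.
    exact: chain_of_E.
  have cirr : irreflexive (cc A) by move=> x; rewrite /cc /chain_of !addbb.
  have ceven1 x : x != x0 -> boundary (cc A) x = false.
    move=> xx0; have [xX|xX] := boolP (x \in X).
      have : (x \in bdX (rep (bdX A))) = (x \in bdX A) by rewrite Rbd.
      by rewrite !inE xx0 xX /= /cc boundaryD => ->; rewrite addbb.
    rewrite /boundary big1 // => y _; apply/negP => /cE /and3P[].
    by rewrite (negPf xX).
  have ceven x : boundary (cc A) x = false.
    have [->|] := eqVneq x x0; last exact: ceven1.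
    have := sym_xor_sum csym cirr; rewrite (bigD1 x0) //= big1;
      first by rewrite addbF.
    by move=> y; exact: ceven1.
  have [phi Hphi] := fs.1 _ csym cE ceven.
  exists [set f in used_faces | phi f (+) phi f0] => _; split.
    apply/subsetP => f; rewrite inE => /andP[fF ff0]; rewrite in_setD1 fF andbT.
    by apply: contraTneq ff0 => ->; rewrite addbb.
  move=> x y xy; have yx : E y x by rewrite (rel_in_sym e_sym X y x).
  rewrite Hphi // ![_ \in [set _ in _ | _]]inE !fc_used //=.
  by case: (phi _); case: (phi _); case: (phi _).
pose code A := (bdX A, ph A).
have inj : {in powerset edges &, injective code}.
  move=> A B; rewrite !powersetE => AE BE [e1 e2].
  have [_ HA] := Hph A AE; have [_ HB] := Hph B BE.
  have ch x y : E x y -> chain_of A x y = chain_of B x y.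
    move=> xy; have := HA _ _ xy; rewrite e2 -(HB _ _ xy) /cc e1.
    by case: (chain_of A x y); case: (chain_of B x y); case: (chain_of _ x y).
  have half A' x y : A' \subset edges -> enum_rank x < enum_rank y ->
    ((y, x) \in A') = false.
    move=> /subsetP S lt; apply/negP => /S; rewrite inE /= => /andP[_].
    by rewrite ltnNge (ltnW lt).
  apply/setP => -[x y]; have [xyE|nE] := boolP ((x, y) \in edges).
    have := xyE; rewrite inE /= => /andP[xy lt].
    by have := ch _ _ xy; rewrite /chain_of !(half _ _ _ _ lt) // !addbF.
  by rewrite (negPf (contra (subsetP AE _) nE))
    (negPf (contra (subsetP BE _) nE)).
have sub : code @: powerset edges \subset setX (powerset (X :\ x0))
  (powerset (used_faces :\ f0)).
  apply/subsetP => S /imsetP[A]; rewrite powersetE => AE -> {S}.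
  rewrite inE /= !powersetE; apply/andP; split; last by case: (Hph A AE).
  by apply/subsetP => x; rewrite inE => /andP[].
have := subset_leq_card sub.
rewrite (card_in_imset inj) cardsX !card_powerset -expnD leq_exp2l //.
have := cardsD1 x0 X; have := cardsD1 f0 used_faces; rewrite x0X f0F; lia.
Qed.
End Euler.

Section Discharge.
Variables (T : finType) (e : rel T).
Hypotheses (e_sym : symmetric e) (e_irr : irreflexive e).
Hypothesis no4 : ~ exists s, chordal_cycle e 4 s.
Hypothesis no6 : ~ exists s, chordal_cycle e 6 s.
Variable X : {set T}.
Hypothesis cut3 : forall Z : {set T}, Z \subset X -> Z != set0 -> Z != X ->
  2 < adj_count e Z (X :\: Z).
Local Notation E := (rel_in e X).
Variables (F : finType) (fc : T -> T -> F).
Hypothesis fs : face_structure E fc.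
Local Notation len := (face_len e X fc).

(** The charge, in units of 1/9, sent through a common edge by a face of
    length a to one of length b. *)
Definition give (a b : nat) : nat :=
  if (b == 3) && (a != 3) then 3 else if (b == 4) && (4 < a) then 1 else 0.

(** Charges are counted in ninths, so that 36 stands for 4. A triangle starts
    with -1 and receives 3/3; a quadrilateral gives at most 1/3 to its only
    triangle and recovers it from its other three sides; a pentagon with
    charge 1 gives at most 5/9; a face of length d >= 6 gives at most d/3 <= d
    - 4. *)
Lemma face_charge f : f \in used_faces e X fc ->
  36 + \sum_(p in fdarts e X fc f) give (len f) (len (fc p.2 p.1)) <=
  9 * len f + \sum_(p in fdarts e X fc f) give (len (fc p.2 p.1)) (len f).
Proof.
rewrite inE => /existsP[x /existsP[y /andP[xy /eqP fxy]]].
have l3 : 3 <= len f by rewrite -fxy; apply: (@len_ge3 T e).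
have dartP p : p \in fdarts e X fc f ->
  [/\ E p.1 p.2, fc p.1 p.2 = f & 3 <= len (fc p.2 p.1)].
  rewrite inE => /andP[pE /eqP pf]; split=> //; apply: (@len_ge3 T e) => //.
  by rewrite (rel_in_sym e_sym X).
have sum_const k : \sum_(p in fdarts e X fc f) k =
  k * len f by rewrite sum_nat_const mulnC.
have [eq3|n3] := eqVneq (len f) 3.
  rewrite big1 ?addn0; last first.
    by move=> p _; rewrite eq3 /give andbF; case: (_ == 4).
  rewrite (eq_bigr (fun _ => 3)); first by rewrite sum_const eq3.
  move=> p /dartP[pE pf _]; rewrite /give eq3 eqxx /=.
  case: eqP => // l3'; case: (no_tri_tri e_sym e_irr no4 cut3 fs pE _ l3').
  by rewrite pf.
have [eq4|n4] := eqVneq (len f) 4.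
  have E1 p : p \in fdarts e X fc f ->
      give (len f) (len (fc p.2 p.1)) = 3 * (len (fc p.2 p.1) == 3) /\
      give (len (fc p.2 p.1)) (len f) + (len (fc p.2 p.1) == 3) = 1.
    case/dartP=> pE pf ge3; rewrite /give eq4 /= andbT andbF.
    have : len (fc p.2 p.1) != 4.
      by apply/eqP => l4; case:
        (no_quad_quad e_sym e_irr no4 no6 cut3 fs pE _ l4); rewrite pf.
    by move: ge3; case: (len (fc p.2 p.1)) => [|[|[|[|[|k]]]]].
  rewrite (eq_bigr (fun p => 3 * (len (fc p.2 p.1) == 3)));
    last by move=> p /E1[].
  rewrite -big_distrr /=.
  have S1 : \sum_(p in fdarts e X fc f) (len (fc p.2 p.1) == 3) <= 1.
    rewrite leqNgt; apply/negP => gt1.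
    have : 1 < #|[set p in fdarts e X fc f | len (fc p.2 p.1) == 3]|.
      apply: leq_trans gt1 _; rewrite -sum1_card [leqRHS]big_mkcond
        [leqLHS]big_mkcond /=.
      by apply: leq_sum => p _; rewrite [p \in [set _ in _ | _]]inE;
        case: (p \in _); case: (_ == 3).
    case/card_gt1P => p [q [+ + pq]]; rewrite !inE.
    case/andP=> /andP[pE /eqP pf] /eqP pl /andP[/andP[qE /eqP qf] /eqP ql].
    have [e1 e2] := quad_one_tri e_sym e_irr no4 no6 cut3 fs eq4 pE qE pf qf pl
      ql.
    by case/eqP: pq; rewrite [p]surjective_pairing [q]surjective_pairing e1 e2.
  have S2 : \sum_(p in fdarts e X fc f) give (len (fc p.2 p.1)) (len f) +
      \sum_(p in fdarts e X fc f) (len (fc p.2 p.1) == 3) = 4.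
    rewrite -big_split /= (eq_bigr (fun _ => 1)); last by move=> p /E1[].
    by rewrite sum_const eq4.
  move: S1 S2; set s1 := \sum_(p in _) (_ == 3);
    set s2 := \sum_(p in _) give _ _.
  by rewrite eq4; move: s1 s2 => s1 s2; clear; lia.
have ge5 : 4 < len f by move: l3 n3 n4; case: (len f) => [|[|[|[|[|k]]]]].
have [eq5|n5] := eqVneq (len f) 5.
  apply: leq_trans (leq_addr _ _).
  apply: (@leq_trans (36 + \sum_(p in fdarts e X fc f) 1));
    last by rewrite sum_const eq5.
  rewrite leq_add2l; apply: leq_sum => p /dartP[pE pf _].
  rewrite /give; case: eqP => [l3'|_] /=; last by case: ifP.
  case: (@no_tri_penta T e e_sym e_irr no4 no6 X cut3 F fc fs p.2 p.1) => //.
    by rewrite (rel_in_sym e_sym X).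
  by rewrite pf.
apply: leq_trans (leq_addr _ _).
apply: (@leq_trans (36 + \sum_(p in fdarts e X fc f) 3)).
  rewrite leq_add2l; apply: leq_sum => p _; rewrite /give.
  by case: ifP => // _; case: ifP.
have ge6 : 5 < len f by rewrite ltn_neqAle eq_sym n5.
rewrite sum_const; move: (len f) ge6 => l; clear; lia.
Qed.

(** Reversing the edges exchanges what is given and what is received, so the
    transfers cancel in the sum over all faces. *)
Lemma face_count : 4 * #|used_faces e X fc| <= adj_count e X X.
Proof.
pose U := used_faces e X fc.
have sw_sum : \sum_(f in U) \sum_(p in fdarts e X fc f) give (len f)
  (len (fc p.2 p.1)) =
    \sum_(f in U) \sum_(p in fdarts e X fc f) give (len (fc p.2 p.1)) (len f).
  have flat (G : F -> F -> nat) :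
    \sum_(f in U) \sum_(p in fdarts e X fc f) G f (fc p.2 p.1) =
      \sum_(p : T * T | E p.1 p.2) G (fc p.1 p.2) (fc p.2 p.1).
    rewrite (exchange_big_dep (fun p : T * T => E p.1 p.2)) /=;
      last by move=> f p _; rewrite inE => /andP[].
    apply: eq_bigr => p pE; rewrite (big_pred1 (fc p.1 p.2)) // => f.
    rewrite [p \in _]inE pE /=; apply/andP/eqP => [[_ /eqP->]|->] //.
    by split=> //; apply: fc_used.
  rewrite (flat (fun f g => give (len f) (len g)))
    (flat (fun f g => give (len g) (len f))).
  rewrite (reindex_inj (h := fun p : T * T => (p.2, p.1))) /=;
    last by move=> [a b] [c d] [-> ->].
  by apply: eq_bigl => p; rewrite (rel_in_sym e_sym X).
have tot : \sum_(f in U) len f = adj_count e X X.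
  rewrite adj_count_darts -sum1_card;
    under eq_bigr => f _ do rewrite /face_len -sum1_card.
  rewrite (exchange_big_dep (fun p : T * T => E p.1 p.2)) /=;
    last by move=> f p _; rewrite inE => /andP[].
  rewrite [RHS](eq_bigl (fun p : T * T => E p.1 p.2)); last by move=> p;
    rewrite inE.
  apply: eq_bigr => p pE; rewrite (big_pred1 (fc p.1 p.2)) // => f.
  rewrite [p \in _]inE pE /=; apply/andP/eqP => [[_ /eqP->]|->] //.
  by split=> //; apply: fc_used.
have ch : \sum_(f in U) 36 <= \sum_(f in U) 9 * len f.
  rewrite -(leq_add2r (\sum_(f in U) \sum_(p in fdarts e X fc f) give (len f)
    (len (fc p.2 p.1)))).
  by rewrite {2}sw_sum -!big_split /=; apply: leq_sum => f; apply: face_charge.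
move: ch; rewrite -big_distrr /= tot sum_nat_const -/U; lia.
Qed.
End Discharge.

(** Take X as small as possible. Its proper subsets satisfy the bound, so any
    cut of X has at least three edges, and face_count contradicts
    euler_bound. *)
Lemma planar_faces_sparse (T : finType) (e : rel T) : symmetric e ->
  irreflexive e ->
  ~ (exists s, chordal_cycle e 4 s) -> ~ (exists s, chordal_cycle e 6 s) ->
  (forall X : {set T}, exists (F : finType) (fc : T -> T -> F),
    face_structure (rel_in e X) fc) ->
  sparse e.
Proof.
move=> e_sym e_irr no4 no6 faces X.
have [m] := ubnP #|X|; elim: m X => // m IH X leX gt1.
have [//|lt] := leqP (adj_count e X X + 6) (4 * #|X|).
have IH' (Z : {set T}) : Z \subset X -> Z != X -> 1 < #|Z| ->
  adj_count e Z Z + 6 <= 4 * #|Z|.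
  move=> ZX nZ; apply: IH.
  by apply: leq_trans (proper_card _) leX; rewrite properEneq nZ.
have n3 : 2 < #|X|.
  rewrite ltn_neqAle gt1 andbT eq_sym; apply/negP => /cards2P[a [b [ab EX]]].
  move: lt; rewrite EX cards2 ab /=.
  rewrite /adj_count big_setU1 ?inE //= big_set1 !big_setU1 ?inE //= !big_set1
    !e_irr.
  by case: (e a b); case: (e b a).
have cut3 (Z : {set T}) : Z \subset X -> Z != set0 -> Z != X ->
  2 < adj_count e Z (X :\: Z).
  move=> ZX Z0 ZnX; have eqn := adj_count_cut e_sym ZX.
  have cX : #|X| = #|Z| + #|X :\: Z|.
    by have := cardsID Z X; rewrite (setIidPr ZX).
  have Z1 : 0 < #|Z| by rewrite card_gt0.
  have W0 : X :\: Z != set0 by rewrite setD_eq0; apply: contra ZnX => h;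
    rewrite eqEsubset ZX.
  have W1 : 0 < #|X :\: Z| by rewrite card_gt0.
  (* A side of the cut is a single vertex or satisfies the bound of sparse
     graphs. *)
  have bnd (Y : {set T}) : Y \subset X -> Y != X -> 0 < #|Y| ->
     (#|Y| = 1 /\ adj_count e Y Y = 0) \/ (adj_count e Y Y + 6 <= 4 * #|Y|).
    move=> YX YnX; rewrite leq_eqVlt => /orP[/eqP/esym/eqP/cards1P[y ->]|];
      [left|right].
      by rewrite cards1 adj_count11.
    exact: IH'.
  have WnX : X :\: Z != X.
    by apply/negP => /eqP eq; move: cX; rewrite eq; lia.
  have [[c1 z1]|h1] := bnd Z ZX ZnX Z1;
    have [[c2 z2]|h2] := bnd _ (subsetDl X Z) WnX W1;
  lia.
have [F [fc fs]] := faces X.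
have card := card_edges e_sym e_irr X.
have cnt := face_count e_sym e_irr no4 no6 cut3 fs.
have [x0 x0X] : exists x0, x0 \in X by apply/card_gt0P; lia.
have [p pE] : exists p, p \in edges e X by apply/card_gt0P; lia.
have pf : fc p.1 p.2 \in used_faces e X fc.
  by apply: fc_used; move: pE; rewrite inE => /andP[].
have := euler_bound e_sym fs x0X pf; lia.
Qed.

(** * Colorings with bounded classes *)

Section Coloring.
Variables (T : finType) (e : rel T).
Hypotheses (e_sym : symmetric e) (e_irr : irreflexive e).
Implicit Types (X Y Z B : {set T}).

Definition proper_on Y m (f : T -> 'I_m) :=
  forall y z, y \in Y -> z \in Y -> e y z -> f y != f z.

Definition color_class Y m (f : T -> 'I_m) (i : 'I_m) :=
  [set z in Y | f z == i].

(** The cap on the sizes is all that an induction on induced subgraphs can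
    maintain; it yields an equitable coloring when Y has exactly m * t
    vertices. *)
Definition capped_colorable Y m t := exists f : T -> 'I_m,
  proper_on Y f /\ forall i, #|color_class Y f i| <= t.

Lemma capped_colorable_union Y1 Y2 m1 m2 t : [disjoint Y1 & Y2] ->
  capped_colorable Y1 m1 t -> capped_colorable Y2 m2 t ->
    capped_colorable (Y1 :|: Y2) (m1 + m2) t.
Proof.
move=> dis [f1 [p1 c1]] [f2 [p2 c2]].
exists (fun z => if z \in Y1 then lshift m2 (f1 z) else rshift m1 (f2 z));
  split.
  move=> y z; rewrite !inE.
  case yY: (y \in Y1); case zY: (z \in Y1) => //= h1 h2 yz.
  - by rewrite eq_lshift; apply: p1.
  - by rewrite eq_lrshift.
  - by rewrite eq_rlshift.
  - by rewrite eq_rshift; apply: p2.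
move=> i; case: (split_ordP i) => j ->.
  apply: leq_trans (c1 j); apply: subset_leq_card; apply/subsetP => z;
    rewrite !inE.
  by case: (z \in Y1) => /=; rewrite ?eq_lshift // eq_rlshift andbF.
apply: leq_trans (c2 j); apply: subset_leq_card; apply/subsetP => z;
  rewrite !inE.
by case: (z \in Y1) => /=; rewrite ?eq_rshift // eq_lrshift.
Qed.

Lemma capped_colorable_colors Y m t (f : T -> 'I_m) (A : {set 'I_m}) i0 :
  i0 \in A ->
  (forall z, z \in Y -> f z \in A) -> proper_on Y f ->
    (forall i, i \in A -> #|color_class Y f i| <= t) ->
  capped_colorable Y #|A| t.
Proof.
move=> i0A fA pf cf; exists (fun z => enum_rank_in i0A (f z)); split.
  move=> y z yY zY yz; apply: contra (pf y z yY zY yz) => /eqP eq.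
  by apply/eqP; move: (congr1 enum_val eq); rewrite !enum_rankK_in ?fA.
move=> i; apply: leq_trans (cf (enum_val i) (enum_valP i)).
apply: subset_leq_card; apply/subsetP => z; rewrite !inE => /andP[zY /eqP <-].
by rewrite zY enum_rankK_in ?fA ?eqxx.
Qed.

Lemma sparse_K4 u p q r : sparse e -> uniq [:: u; p; q; r] ->
  e u p -> e u q -> e u r -> e p q -> e p r -> e q r -> False.
Proof.
move=> sp U up uq ur pq pr qr.
have c4 : #|[set u; p; q; r]| = 4.
  by rewrite -[RHS]/(size [:: u; p; q; r]) -(card_uniqP U);
    apply: eq_card => t; rewrite !inE -!orbA.
have := sp [set u; p; q; r]; rewrite c4 => /(_ isT).
have : 3 * #|[set u; p; q; r]| <= adj_count e [set u; p; q; r] [set u; p; q; r].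
  move: U; rewrite /= !inE !negb_or !andbT.
  case/and3P=> /and3P[nup nuq nur] /andP[npq npr] nqr.
  have card3 (a b c : T) : a != b -> a != c -> b != c -> 3 <= #|[set a; b; c]|.
    by move=> ab ac bc; rewrite -setUA cardsU1 cards2 !inE negb_or ab ac bc.
  apply: adj_count_leP => x; rewrite !inE -!orbA => /or4P[] /eqP->.
  - apply: leq_trans (card3 p q r _ _ _) _ => //; apply: subset_leq_card.
    by apply/subsetP => z; rewrite !inE => /orP[/orP[]|] /eqP->;
      rewrite eqxx ?orbT.
  - apply: leq_trans (card3 u q r _ _ _) _ => //; apply: subset_leq_card.
    by apply/subsetP => z; rewrite !inE => /orP[/orP[]|] /eqP->;
      rewrite eqxx ?orbT // e_sym.
  - apply: leq_trans (card3 u p r _ _ _) _ => //; apply: subset_leq_card.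
    by apply/subsetP => z; rewrite !inE => /orP[/orP[]|] /eqP->;
      rewrite eqxx ?orbT // e_sym.
  - apply: leq_trans (card3 u p q _ _ _) _ => //; apply: subset_leq_card.
    by apply/subsetP => z; rewrite !inE => /orP[/orP[]|] /eqP->;
      rewrite eqxx ?orbT // e_sym.
by rewrite c4; lia.
Qed.

Section Shift.
Variables (Y : {set T}) (m t : nat) (f : T -> 'I_m).
Hypotheses (f_proper : proper_on Y f) (f_cap :
  forall i, #|color_class Y f i| <= t).

Definition can_give : rel 'I_m := fun i j =>
  [exists w in color_class Y f i, [forall v in color_class Y f j, ~~ e w v]].

Definition deficient i := #|color_class Y f i| < t.

(** Moves one vertex along each step of the path, starting from its far end so
    that every class has room when it receives. The class j only loses
    vertices, hence it can still receive any vertex that it could receive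
    before. *)
Lemma shift_path s j : path can_give j s -> uniq (j :: s) ->
  deficient (last j s) ->
  exists g : T -> 'I_m, [/\ proper_on Y g, forall i, #|color_class Y g i| <= t,
    #|color_class Y g j| < t, color_class Y g j \subset color_class Y f j &
    forall z, z \in Y -> (f z \notin j :: s) || (g z \notin j :: s) ->
      g z = f z].
Proof.
elim: s j => [|k s IH] j /=; first by move=> _ _ sm; exists f; split.
case/andP=> /exists_inP[w wj /forall_inP wk] ps /andP[jks uks] sm.
have [g1 [p1 c1 ck1 sk1 un1]] := IH k ps uks sm.
have Ej : color_class Y g1 j = color_class Y f j.
  apply/setP => z; rewrite !inE; apply: andb_id2l => zY.
  apply/eqP/eqP => eq; [rewrite -un1|rewrite un1] => //;
    by rewrite eq jks ?orbT.
have [wY /eqP fw] : w \in Y /\ f w == j by apply/andP; move: wj; rewrite inE.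
have jk : j != k by move: jks; rewrite inE negb_or => /andP[].
pose g z := if z == w then k else g1 z.
exists g; split.
- have aux y z : y \in Y -> z \in Y -> e y z -> y = w -> g1 z != k.
    move=> yY zY yz yw; subst y; apply/negP => /eqP gz.
    have : z \in color_class Y f k by apply: (subsetP sk1);
      rewrite inE zY gz eqxx.
    by move/wk; rewrite yz.
  move=> y z yY zY yz; rewrite /g; case: (y =P w) => yw; case: (z =P w) => zw.
  + by rewrite yw zw e_irr in yz.
  + by rewrite eq_sym; apply: aux yz yw.
  + by apply: (aux z y) => //; rewrite e_sym.
  + exact: p1.
- move=> i; have [->|ik] := eqVneq i k.
    apply: leq_trans (_ : #|w |: color_class Y g1 k| <= _).
      apply: subset_leq_card; apply/subsetP => z; rewrite !inE /g.
      by case: (z =P w).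
    by rewrite cardsU1; case: (_ \notin _); rewrite ?add1n // ltnW.
  apply: leq_trans (c1 i); apply: subset_leq_card; apply/subsetP => z;
    rewrite !inE /g.
  by case: (z =P w) => //; rewrite eq_sym (negPf ik) andbF.
- have wj1 : w \in color_class Y g1 j by rewrite Ej.
  have := c1 j; rewrite (cardsD1 w) wj1 add1n; apply: leq_trans; rewrite ltnS.
  apply: subset_leq_card; apply/subsetP => z; rewrite !inE /g.
  by case: (z =P w) => //; rewrite eq_sym (negPf jk) andbF.
- apply/subsetP => z; rewrite -Ej !inE /g.
  by case: (z =P w) => //; rewrite eq_sym (negPf jk) andbF.
- move=> z zY; rewrite /g; case: (z =P w) => [->|_].
    by rewrite fw !inE !eqxx /= orbT.
  rewrite inE negb_or [g1 z \in _]inE negb_or => H.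
  by apply: un1 => //; case/orP: H => /andP[_ ->]; rewrite ?orbT.
Qed.

(** Vertices can be passed on from the class j to a class with fewer than t
    vertices. *)
Definition accessible j := [exists i, deficient i && connect can_give j i].

Lemma accessible_shift j : accessible j -> exists g : T ->
  'I_m, [/\ proper_on Y g,
  forall i, #|color_class Y g i| <= t, #|color_class Y g j| < t &
    color_class Y g j \subset color_class Y f j].
Proof.
case/existsP=> i /andP[sm /connectP[s ps lasts]]; subst i.
case/shortenP: ps sm => s' ps' us' _ sm.
by have [g [h1 h2 h3 h4 _]] := shift_path ps' us' sm; exists g.
Qed.

Lemma deficient_accessible i : deficient i -> accessible i.
Proof. by move=> sm; apply/existsP; exists i; rewrite sm connect0. Qed.

(** Otherwise z could be moved to the class j, and its own class would be
    accessible. *)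
Lemma inaccessible_neighbour i j z : ~~ accessible i -> accessible j ->
  z \in color_class Y f i ->
  exists2 w, w \in color_class Y f j & e z w.
Proof.
move=> ni /existsP[k /andP[sm jk]] zi.
have [/exists_inP[w wj zw]|] := boolP [exists w in color_class Y f j, e z w];
  first by exists w.
rewrite negb_exists_in => no; case/negP: ni; apply/existsP; exists k;
  rewrite sm.
apply: connect_trans jk; apply: connect1; apply/exists_inP; by exists z.
Qed.
End Shift.

Definition far_side Y x m (f : T -> 'I_m) (A : {set 'I_m}) :=
  x |: [set z in Y :\ x | f z \notin A].

(** The situation in which a coloring of Y minus x resists extension. It
    arises with the accessible colors for A and with a deficient class for
    i0. *)
Definition blocked Y x m t (f : T -> 'I_m) (A : {set 'I_m}) i0 : Prop :=
  [/\ x \in Y, proper_on (Y :\ x) f, forall i,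
    #|color_class (Y :\ x) f i| <= t &
   [/\ i0 \in A, #|color_class (Y :\ x) f i0| < t, #|A| <= 3,
     #|far_side Y x f A| = (m - #|A|) * t + 1 &
     forall j z, j \in A -> z \in far_side Y x f A ->
       exists2 w, w \in color_class (Y :\ x) f j & e z w]].

Lemma card_color_class Y m (f : T -> 'I_m) (A : {set 'I_m}) :
  #|[set z in Y | f z \in A]| = \sum_(i in A) #|color_class Y f i|.
Proof.
rewrite -sum1_card (partition_big f (mem A)) /=; last by move=> z;
  rewrite inE => /andP[].
apply: eq_bigr => i iA; rewrite -sum1_card; apply: eq_bigl => z;
  rewrite !inE -andbA.
by case: eqP => [->|]; rewrite ?iA ?andbF.
Qed.

(** If x has no neighbour in some accessible class, then shifting makes room
    for x there. Otherwise each accessible class contains one of the at most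
    three neighbours of x, and the inaccessible classes are full. *)
Lemma blocked_or_capped_colorable Y x m t (f : T -> 'I_m) : x \in Y ->
  #|[set y in Y | e x y]| <= 3 -> #|Y| <= m * t ->
  proper_on (Y :\ x) f -> (forall i, #|color_class (Y :\ x) f i| <= t) ->
  capped_colorable Y m t \/ exists A i0, blocked Y x t f A i0.
Proof.
move=> xY dx cY pf cf; set Y' := Y :\ x in pf cf *.
have cY' : #|Y'| < m * t by move: cY; rewrite (cardsD1 x) xY.
pose A := [set j | accessible Y' t f j].
have [i0 sm0] : exists i0, deficient Y' t f i0.
  apply/existsP; apply: contraLR cY' => /existsPn no; rewrite -leqNgt.
  have := card_color_class Y' f setT; rewrite (_ : [set z in Y' | _] = Y');
    last first.
    by apply/setP => z; rewrite !inE andbT.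
  move=> ->; rewrite -{1}(card_ord m) -cardsT -sum_nat_const.
  by apply: leq_sum => i _; rewrite leqNgt no.
have [/exists_inP[j jA nox]|] :=
  boolP [exists j in A, [forall w in color_class Y' f j, ~~ e x w]].
  left; have [|g [pg cg cj sj]] := accessible_shift pf cf (j := j);
    first by move: jA; rewrite inE.
  exists (fun z => if z == x then j else g z); split.
    have aux z : z \in Y -> e x z -> z != x -> g z != j.
      move=> zY xz zx; apply/negP => /eqP gz.
      have : z \in color_class Y' f j by apply: (subsetP sj);
        rewrite !inE zx zY gz eqxx.
      by move/(forall_inP nox); rewrite xz.
    move=> y z yY zY yz; case: (y =P x) => [yx|/eqP yx];
      case: (z =P x) => [zx|/eqP zx].
    - by rewrite yx zx e_irr in yz.
    - by rewrite eq_sym; apply: aux => //; rewrite -yx.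
    - by apply: aux => //; rewrite -zx e_sym.
    - by apply: pg => //; rewrite in_setD1 ?yx ?zx.
  move=> i; have [->|ij] := eqVneq i j.
    apply: leq_trans (_ : #|x |: color_class Y' g j| <= _).
      by apply: subset_leq_card; apply/subsetP => z; rewrite !inE;
        case: (z =P x).
    by rewrite cardsU1; case: (_ \notin _); rewrite ?add1n // ltnW.
  apply: leq_trans (cg i); apply: subset_leq_card; apply/subsetP => z;
    rewrite !inE.
  by case: (z =P x) => //; rewrite eq_sym (negPf ij) andbF.
rewrite negb_exists_in => /forall_inP all_nbr; right; exists A, i0.
have xnbr j : j \in A -> exists2 w, w \in color_class Y' f j & e x w.
  by move/all_nbr; rewrite negb_forall_in => /exists_inP[w wj];
    rewrite negbK => xw; exists w.
split=> //; split=> //.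
- by rewrite inE deficient_accessible.
- apply: leq_trans dx; apply: leq_trans (leq_imset_card f _).
  apply: subset_leq_card; apply/subsetP => j /xnbr[w wj xw].
  apply/imsetP; exists w; last by move: wj; rewrite inE => /andP[_ /eqP].
  by move: wj; rewrite !inE xw andbT => /andP[/andP[]].
- rewrite /far_side cardsU1 !inE eqxx /= add1n addn1; congr _.+1.
  have -> : [set z in Y' | f z \notin A] = [set z in Y' | f z \in ~: A].
    by apply/setP => z; rewrite !inE.
  have -> : m - #|A| = #|~: A| by rewrite [RHS]cardsCs setCK card_ord.
  rewrite card_color_class -sum_nat_const; apply: eq_bigr => i.
  rewrite inE => iA; apply/eqP; rewrite eqn_leq cf leqNgt.
  by apply: contra iA => sm; rewrite inE deficient_accessible.
- move=> j z jA /setU1P[->|]; first exact: xnbr.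
  rewrite inE => /andP[zY' fzA];
    apply: (@inaccessible_neighbour Y' m t f (f z)).
  + by move: fzA; rewrite inE.
  + by move: jA; rewrite inE.
  + by rewrite inE zY' eqxx.
Qed.

Lemma capped_colorable_ind m t (H : {set T} -> Prop) : 0 < m -> sparse e ->
  (forall Y x, H Y -> H (Y :\ x)) -> (forall Y, H Y -> #|Y| <= m * t) ->
  (forall Y x (f : T -> 'I_m) A i0, H Y -> blocked Y x t f A i0 ->
    capped_colorable Y m t) ->
  forall Y, H Y -> capped_colorable Y m t.
Proof.
move=> m0 sp HD Hc Hb Y; have [n] := ubnP #|Y|; elim: n Y => // n IH Y leY HY.
have [Y0|Y0] := eqVneq Y set0.
  exists (fun _ => Ordinal m0); split=> [y z|i]; first by rewrite Y0 inE.
  rewrite (_ : color_class _ _ _ = set0) ?cards0 //.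
  by apply/setP => z; rewrite !inE Y0 inE.
have [x xY dx] := sparse_low_degree sp Y0.
have [|f [pf cf]] := IH (Y :\ x) _ (HD _ _ HY).
  by move: leY; rewrite (cardsD1 x) xY.
have [//|[A [i0 b]]] := blocked_or_capped_colorable xY dx (Hc _ HY) pf cf.
exact: Hb HY b.
Qed.
End Coloring.

(** * Peeling off the accessible classes *)

Section Arithmetic.
(** These inequalities, extracted from the counting arguments below, are to be
    read with N twice the number of edges, b the size of the far side, be the
    number of edges between the far side and a deficient class, a the number
    of accessible classes, and n twice the number of edges left after an
    exchange. *)
Lemma arith_few m t a N : 4 <= m -> 0 < a <= 3 -> N <= 2 * (m.-1 * t) ->
  2 * (a * ((m - a) * t + 1)) <= N -> False.
Proof.
move=> m4 /andP[a0 a3]; have [k ->] : exists k, m = k + 4 by exists (m - 4);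
  lia.
have -> : (k + 4).-1 = k + 3 by lia.
move: a0 a3; case: a => [|[|[|[|a]]]] // _ _.
- have -> : k + 4 - 1 = k + 3 by lia.
  nia.
- have -> : k + 4 - 2 = k + 2 by lia.
  nia.
- have -> : k + 4 - 3 = k + 1 by lia.
  nia.
Qed.

Lemma arith_mid1 m t N be b : 6 <= m -> m + 2 <= t -> b = (m - 1) * t + 1 ->
  2 * (be + 0 * b) <= N -> N + 10 <= 2 * ((m + 2) * t + m) ->
    be + 2 * t.-1 < 2 * b.
Proof.
move=> m6 tm ->; have [k ->] : exists k, m = k + 6 by exists (m - 6); lia.
have -> : k + 6 - 1 = k + 5 by lia.
have [s ->] : exists s, t = s.+1 by exists t.-1; lia.
by rewrite /=; nia.
Qed.

Lemma arith_mid1' m t N n b : 6 <= m -> m + 2 <= t -> b = (m - 1) * t + 1 ->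
  n + 2 * (1 * b) + 4 <= N + 2 * m.+1 -> N + 10 <= 2 * ((m + 2) * t + m) ->
  n <= 2 * ((m - 1).-1 * t).
Proof.
move=> m6 tm ->; have [k ->] : exists k, m = k + 6 by exists (m - 6); lia.
have -> : k + 6 - 1 = k + 5 by lia.
have -> : (k + 5).-1 = k + 4 by lia.
move: tm; nia.
Qed.

Lemma arith_mid23 m t a N : 6 <= m -> a = 2 \/ a = 3 ->
  2 * (a * ((m - a) * t + 1)) <= N -> N + 10 <= 2 * ((m + 2) * t + m) ->
    0 < t -> False.
Proof.
move=> m6; have [k ->] : exists k, m = k + 6 by exists (m - 6); lia.
case=> ->.
- have -> : k + 6 - 2 = k + 4 by lia.
  nia.
- have -> : k + 6 - 3 = k + 3 by lia.
  nia.
Qed.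

Lemma arith_top1_t k t b be : 7 <= k -> 0 < t -> b = (k - 1) * t + 1 ->
  b <= be -> be <= k * t.-1 ->
  k + 1 <= t.
Proof.
move=> k7 t0 ->; have [j ->] : exists j, k = j + 7 by exists (k - 7); lia.
have -> : j + 7 - 1 = j + 6 by lia.
have [s ->] : exists s, t = s.+1 by exists t.-1; lia.
by rewrite /=; nia.
Qed.

Lemma arith_top12 k t a b be : 7 <= k -> 0 < t -> a = 1 \/ a = 2 ->
  b = (k - a) * t + 1 ->
  be <= k * t.-1 -> be + 2 * t.-1 < 2 * b.
Proof.
move=> k7 t0 H ->; have [j ->] : exists j, k = j + 7 by exists (k - 7); lia.
have [s ->] : exists s, t = s.+1 by exists t.-1; lia.
case: H => -> /=.
- have -> : j + 7 - 1 = j + 6 by lia.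
  nia.
- have -> : j + 7 - 2 = j + 5 by lia.
  nia.
Qed.

Lemma arith_top3 k t b be N : 7 <= k -> 0 < t -> b = (k - 3) * t + 1 ->
  2 * (be + 2 * b) <= N -> N + 6 <= 4 * (k * t) -> be + 2 * t.-1 < 2 * b.
Proof.
move=> k7 t0 ->; have [j ->] : exists j, k = j + 7 by exists (k - 7); lia.
have -> : j + 7 - 3 = j + 4 by lia.
have [s ->] : exists s, t = s.+1 by exists t.-1; lia.
by rewrite /=; nia.
Qed.

Lemma arith_top1' k t b n N : 7 <= k -> b = (k - 1) * t + 1 ->
  n + 2 * (1 * b) + 4 <= N + 2 * k -> N + 6 <= 4 * (k * t) ->
  n + 10 <= 2 * ((k - 1 + 2) * t + (k - 1)).
Proof.
move=> k7 ->; have [j ->] : exists j, k = j + 7 by exists (k - 7); lia.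
have -> : j + 7 - 1 = j + 6 by lia.
nia.
Qed.

Lemma arith_top23' k t a b n N : 7 <= k -> 0 < t -> a = 2 \/ a = 3 ->
  b = (k - a) * t + 1 ->
  n + 2 * (a * b) + 4 <= N + 2 * k -> N + 6 <= 4 * (k * t) ->
  n <= 2 * ((k - a).-1 * t).
Proof.
move=> k7 t0 H ->; have [j ->] : exists j, k = j + 7 by exists (k - 7); lia.
case: H => ->.
- have -> : j + 7 - 2 = j + 5 by lia.
  have -> : (j + 5).-1 = j + 4 by lia.
  nia.
- have -> : j + 7 - 3 = j + 4 by lia.
  have -> : (j + 4).-1 = j + 3 by lia.
  nia.
Qed.
End Arithmetic.

Section Peel.
Variables (T : finType) (e : rel T).
Hypotheses (e_sym : symmetric e) (e_irr : irreflexive e) (e_sparse : sparse e).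
Implicit Types (X Y Z B : {set T}).

Definition deg_in Y u := #|[set y in Y | e u y]|.

Section Blocked.
Variables (Y : {set T}) (x : T) (m t : nat) (f : T -> 'I_m) (A :
  {set 'I_m}) (i0 : 'I_m).
Hypothesis blk : blocked e Y x t f A i0.
Local Notation B := (far_side Y x f A).
Local Notation K := (color_class (Y :\ x) f).

Definition colored_in (A' : {set 'I_m}) := [set z in Y :\ x | f z \in A'].

Lemma far_side_sub : B \subset Y.
Proof.
case: blk => xY _ _ _; rewrite subUset sub1set xY; apply/subsetP => z.
by rewrite !inE => /andP[/andP[]].
Qed.

Lemma far_side_compl : Y :\: B = colored_in A.
Proof.
apply/setP => z; rewrite !inE; case: (z =P x) => //= _.
by case: (z \in Y); case: (f z \in A).
Qed.

Lemma card_far_side : #|B| = (m - #|A|) * t + 1.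
Proof. by case: blk => _ _ _ []. Qed.

Lemma card_colors : 0 < #|A| <= 3.
Proof. by case: blk => _ _ _ [iA _ -> _ _]; rewrite andbT card_gt0;
  apply/set0Pn; exists i0. Qed.

Lemma colors_le : #|A| <= m.
Proof. by rewrite -[leqRHS]card_ord max_card. Qed.

Lemma far_side_edges (A' : {set 'I_m}) : A' \subset A ->
  #|A'| * #|B| <= adj_count e B (colored_in A').
Proof.
move=> /subsetP AA; apply: adj_count_leP => z zB.
apply: leq_trans (leq_imset_card f _); apply: subset_leq_card;
  apply/subsetP => j jA.
case: blk => _ _ _ [_ _ _ _ nb]; have [w wj zw] := nb j z (AA j jA) zB.
move: wj; rewrite inE => /andP[wY /eqP fw].
by apply/imsetP; exists w; rewrite // inE zw inE wY fw jA.
Qed.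

Lemma blocked_edges : 2 * (#|A| * #|B|) <= adj_count e Y Y.
Proof.
rewrite (adj_count_cut e_sym far_side_sub) far_side_compl.
by have := far_side_edges (subxx A); lia.
Qed.

Lemma colored_i0 : colored_in [set i0] = K i0.
Proof. by apply/setP => z; rewrite !inE. Qed.

(** Every accessible class other than i0 receives at least one edge from each
    vertex of the far side. *)
Lemma blocked_edges_class : 2 * (adj_count e B (K i0) + #|A|.-1 * #|B|) <=
  adj_count e Y Y.
Proof.
case: (blk) => _ _ _ [i0A _ _ _ _].
rewrite (adj_count_cut e_sym far_side_sub) far_side_compl
  (adj_count_splitr _ B (colored_in A) (K i0)).
have -> : colored_in A :&: K i0 = K i0.
  apply/setP => z; rewrite !inE; case: (f z =P i0) => [->|_];
    last by rewrite !andbF.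
  by rewrite i0A !andbT andbb.
have -> : colored_in A :\: K i0 = colored_in (A :\ i0).
  by apply/setP => z; rewrite !inE; case: (z == x); case: (z \in Y);
    case: (f z == i0).
have := far_side_edges (subD1set A i0).
have -> : #|A :\ i0| = #|A|.-1 by rewrite [in RHS](cardsD1 i0 A) i0A.
move=> h; apply: leq_trans (leq_addr _ _); apply: leq_trans (leq_addl _ _).
by rewrite leq_mul2l leq_add2l.
Qed.

Lemma class_edges (D : nat) : (forall u, u \in Y -> deg_in Y u <= D) ->
  adj_count e B (K i0) <= D * t.-1.
Proof.
case: (blk) => _ _ _ [_ deficient _ _ _] HD.
apply: leq_trans (_ : D * #|K i0| <= _);
  last by rewrite leq_mul2l -ltnS (ltn_predK deficient) deficient orbT.
rewrite (adj_count_sym e_sym); apply: adj_count_geP => u;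
  rewrite !inE => /andP[/andP[_ uY] _].
apply: leq_trans (HD u uY); apply: subset_leq_card; apply/subsetP => z.
by rewrite !inE => /andP[zB ->]; rewrite andbT; apply: (subsetP far_side_sub);
  rewrite !inE.
Qed.

Lemma class_edges_ge : #|B| <= adj_count e B (K i0).
Proof.
case: (blk) => _ _ _ [i0A _ _ _ _].
have := @far_side_edges [set i0]; rewrite cards1 mul1n colored_i0; apply.
by rewrite sub1set.
Qed.

Lemma blocked_gt1 : 1 < #|Y|.
Proof.
case: (blk) => xY _ _ [i0A _ _ _ nb].
have [|w wi xw] := nb i0 x i0A; first exact: setU11.
move: wi; rewrite inE => /andP[wY _].
by rewrite (cardsD1 x) xY add1n ltnS card_gt0; apply/set0Pn; exists w.
Qed.

(** Counting the edges to the class i0, more than twice as many vertices of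
    the far side as this class has members have a single neighbour in it. So
    some u of the class is the only neighbour of three of them, and these
    three are not pairwise adjacent, since a sparse graph contains no K4. *)
Lemma solo_pair : adj_count e B (K i0) + 2 * t.-1 < 2 * #|B| ->
  exists u p q, [/\ u \in K i0, p \in B, q \in B, p != q & ~~ e p q] /\
   [/\ e u p, e u q, forall w, w \in K i0 -> e p w -> w = u &
       forall w, w \in K i0 -> e q w -> w = u].
Proof.
case: (blk) => _ _ _ [i0A deficient _ _ nb] lt.
(* The vertices of the far side with a single neighbour in the class i0. *)
pose S := [set z in B | #|[set w in K i0 | e z w]| == 1].
have cS : 2 * #|B| <= adj_count e B (K i0) + #|S|.
  have -> : #|S| = \sum_(z in B) (#|[set w in K i0 | e z w]| == 1).
    rewrite -sum1_card big_mkcond [RHS]big_mkcond /=; apply: eq_bigr => z _.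
    by rewrite [z \in S]inE; case: (z \in B) => //=; case: (_ == 1).
  rewrite adj_countE -big_split /= mulnC -sum_nat_const; apply: leq_sum => z zB.
  have [w wK zw] := nb i0 z i0A zB.
  have : 0 < #|[set w in K i0 | e z w]| by apply/card_gt0P; exists w;
    rewrite inE wK.
  by case: #|_| => [|[|k]].
have SK : adj_count e S (K i0) = #|S|.
  rewrite adj_countE -sum1_card; apply: eq_bigr => z;
    rewrite inE => /andP[_ /eqP].
  by [].
have [/exists_inP[u uK hu]|] :=
  boolP [exists u in K i0, 2 < #|[set z in S | e u z]|]; last first.
  rewrite negb_exists_in => /forall_inP H; exfalso.
  have : adj_count e (K i0) S <= 2 * #|K i0| by apply: adj_count_geP => u /H;
    rewrite -leqNgt.
  by rewrite (adj_count_sym e_sym) SK; lia.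
have solo p : p \in S -> e u p -> forall w, w \in K i0 -> e p w -> w = u.
  rewrite inE => /andP[_ /cards1P[v Ev]] up w wK pw.
  have : u \in [set v] by rewrite -Ev inE uK e_sym.
  have : w \in [set v] by rewrite -Ev inE wK.
  by move=> /set1P-> /set1P->.
have res p q : p \in S -> q \in S -> e u p -> e u q -> p != q -> ~~ e p q ->
   exists u p q, [/\ u \in K i0, p \in B, q \in B, p != q & ~~ e p q] /\
   [/\ e u p, e u q, forall w, w \in K i0 -> e p w -> w = u &
       forall w, w \in K i0 -> e q w -> w = u].
  move=> pS qS up uq pq npq; exists u, p, q; split; split=> //; try exact: solo.
    by move: pS; rewrite inE => /andP[].
  by move: qS; rewrite inE => /andP[].
case/card_gt2P: hu => p [q [r [[hp hq hr] [pq qr rp]]]].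
move: hp hq hr; rewrite ![_ \in [set _ in S | _]]inE =>
  /andP[pS up] /andP[qS uq] /andP[rS ur].
have [epq|n] := boolP (e p q); last exact: (res p q).
have [epr|n] := boolP (e p r); last by apply: (res p r); rewrite // eq_sym.
have [eqr|n] := boolP (e q r); last by apply: (res q r).
have ne_ a b : e a b -> a != b by move=> ab; apply/eqP => eq;
  rewrite eq e_irr in ab.
case: (@sparse_K4 T e e_sym u p q r e_sparse _ up uq ur epq epr eqr).
by rewrite /= !inE !negb_or !ne_.
Qed.

(** With u exchanged for p and q, the accessible classes stay within the cap,
    and the set B' of the other vertices has exactly t vertices for each
    remaining color. Every vertex of the far side contributes an edge to each
    accessible class, and at most D of these edges, those at u, can end up
    inside B'. *)
Lemma peel D : (forall u, u \in Y -> deg_in Y u <= D) ->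
  adj_count e B (K i0) + 2 * t.-1 < 2 * #|B| ->
  (forall B' : {set T}, B' \subset Y -> #|B'| = (m - #|A|) * t ->
     adj_count e B' B' + 2 * (#|A| * #|B|) + 4 <= adj_count e Y Y + 2 * D ->
       capped_colorable e B' (m - #|A|) t) ->
  capped_colorable e Y m t.
Proof.
move=> HD /solo_pair[u [p [q [[uK pB qB pq npq] [up uq sp sq]]]]] IH.
case: (blk) => xY pf cf [i0A deficient _ cB nb].
have BY := subsetP far_side_sub.
have [uY' /eqP fu] : u \in Y :\ x /\ f u == i0 by apply/andP; move: uK;
  rewrite inE.
have uY : u \in Y by move: uY'; rewrite inE => /andP[].
have uA : u \in colored_in A by rewrite inE uY' fu.
have AY : colored_in A = Y :\: B by rewrite far_side_compl.
have uB : u \notin B by move: uA; rewrite AY inE => /andP[].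
have up_ : u != p by apply: contraNneq uB => ->.
have uq_ : u != q by apply: contraNneq uB => ->.
(* The vertices that keep an accessible color, and those left for the other
   colors. *)
pose Y1 := (colored_in A :\ u) :|: [set p; q].
pose B' := u |: (B :\ p :\ q).
have mY1 z : (z \in Y1) = (z != u) &&
  ((z \notin B) && (z \in Y)) || ((z == p) || (z == q)).
  by rewrite in_setU in_setD1 AY in_setD in_set2.
have mB' z : (z \in B') = (z == u) || [&& z != q, z != p & z \in B].
  by rewrite in_setU1 in_setD1 in_setD1.
have Yeq : Y = Y1 :|: B'.
  apply/setP => z; rewrite in_setU mY1 mB'.
  case zB: (z \in B); first by rewrite (BY z zB); case: (z == u);
    case: (z == p); case: (z == q).
  case: (z =P u) => [->|_] /=; first by rewrite uY !orbT.
  case zp: (z == p); first by rewrite -(eqP zp) zB in pB.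
  case zq: (z == q); first by rewrite -(eqP zq) zB in qB.
  by rewrite !andbF !orbF.
have dis : [disjoint Y1 & B'].
  rewrite -setI_eq0; apply/eqP/setP => z.
  rewrite in_setI mY1 mB' in_set0.
  case: (z =P u) => [->|_] /=; first by rewrite (negPf up_) (negPf uq_).
  by case: (z == p); case: (z == q); case: (z \in B); rewrite ?andbF.
have cB' : #|B'| = (m - #|A|) * t.
  have uB' : u \notin B :\ p :\ q by rewrite in_setD1 in_setD1 (negPf uB)
    !andbF.
  have h1 : #|B :\ p|.+1 = ((m - #|A|) * t).+1 by rewrite -addn1 -[RHS]addn1
    -cB (cardsD1 p B) pB addnC.
  have h2 : #|B :\ p :\ q|.+1 =
    #|B :\ p| by rewrite [RHS](cardsD1 q) in_setD1 qB eq_sym pq.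
  by rewrite /B' cardsU1 uB' add1n h2; case: h1.
have B'Y : B' \subset Y by rewrite Yeq subsetUr.
have edges : adj_count e B' B' + 2 * (#|A| * #|B|) + 4 <= adj_count e Y Y +
  2 * D.
  pose Z := u |: B.
  have ZY : Z \subset Y by rewrite subUset sub1set uY far_side_sub.
  rewrite (adj_count_cut e_sym ZY).
  have YZ : Y :\: Z = colored_in A :\ u by rewrite AY setDDl setUC.
  have h1 : adj_count e B (colored_in A :\ u) <= adj_count e Z (Y :\: Z).
    by rewrite YZ; apply: adj_count_monol; apply: subsetUr.
  have h2 : adj_count e B (colored_in A) = adj_count e B [set u] +
    adj_count e B (colored_in A :\ u).
    by rewrite (adj_count_splitr _ _ _ [set u]) (setIidPr _) ?sub1set.
  have h3 : adj_count e B [set u] <= D.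
    rewrite (adj_count_sym e_sym) adj_count1; apply: leq_trans (HD u uY);
      apply: subset_leq_card.
    by apply/subsetP => z; rewrite !inE => /andP[zB ->]; rewrite andbT;
      apply: BY; rewrite !inE.
  have h4 := far_side_edges (subxx A).
  have B'Z : B' \subset Z.
    by apply/subsetP => z; rewrite !inE => /orP[->//|/andP[_ /andP[_ ->]]];
      rewrite orbT.
  have h5 : adj_count e B' B' + 4 <= adj_count e Z Z.
    rewrite (adj_count_cut e_sym B'Z).
    suff h : 2 <= adj_count e B' (Z :\: B').
      rewrite -addnA leq_add2l; apply: leq_trans (leq_addr _ _).
      by rewrite -[4]/(2 * 2) leq_mul2l.
    apply: (@leq_trans (adj_count e [set u] [set p; q])).
      rewrite adj_count1; apply: leq_trans (_ : #|[set p; q]| <= _);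
        first by rewrite cards2 pq.
      by apply: subset_leq_card; apply/subsetP => z /set2P[]->;
        rewrite !inE eqxx ?orbT.
    apply: adj_count_mono; first by rewrite sub1set setU11.
    apply/subsetP => z hz.
    have zY1 : z \in Y1 by rewrite inE hz orbT.
    rewrite in_setD (disjointFr dis zY1) /= in_setU1.
    by case/set2P: hz => ->; rewrite ?pB ?qB orbT.
  move: h1 h2 h3 h4 h5; move: (adj_count e B' B') (adj_count e Z Z)
    (adj_count e Z (Y :\: Z)) (adj_count e B (colored_in A :\ u)).
  move: (adj_count e B (colored_in A)) (adj_count e B [set u]) (#|A| * #|B|)
    (adj_count e (Y :\: Z) _).
  clear; lia.
have col2 := IH B' B'Y cB' edges.
rewrite Yeq -(subnKC colors_le); apply: capped_colorable_union => //.
pose h z := if z \in [set p; q] then i0 else f z.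
have hA z : z \in Y1 -> z \notin [set p; q] ->
  [/\ z \in Y :\ x, f z \in A & z != u].
  move=> + n; rewrite in_setU (negPf n) orbF in_setD1 => /andP[zu].
  by rewrite inE => /andP[zY zA].
apply: (@capped_colorable_colors T e Y1 m t h A i0 i0A).
- by move=> z zY1; rewrite /h; case: ifP => [//|/negbT n]; case: (hA z zY1 n).
- have aux y z : y \in [set p; q] -> z \in Y1 -> z \notin [set p; q] ->
    e y z -> f z != i0.
    move=> yp zY1 n yz; have [zY _ zu] := hA z zY1 n; apply: contra zu => fz.
    have zK : z \in K i0 by rewrite inE zY.
    by case/set2P: yp => E; rewrite E in yz; apply/eqP; [apply: sp|apply: sq].
  move=> y z yY1 zY1 yz; rewrite /h; case: ifP => hy; case: ifP => hz.
  + exfalso; move/set2P: hy => [] Ey; move/set2P: hz => [] Ez; subst y z.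
    * by rewrite e_irr in yz.
    * by rewrite yz in npq.
    * by rewrite e_sym yz in npq.
    * by rewrite e_irr in yz.
  + by rewrite eq_sym; apply: aux yz => //; rewrite hz.
  + by apply: (aux z) => //; rewrite ?hy // e_sym.
  + have [yY _ _] := hA y yY1 (negbT hy); have [zY _ _] := hA z zY1 (negbT hz).
    exact: pf.
- move=> i iA; have [->|ii0] := eqVneq i i0.
    apply: (@leq_trans #|[set p; q] :|: (K i0 :\ u)|).
      apply: subset_leq_card; apply/subsetP => z; rewrite inE => /andP[zY1];
        rewrite /h.
      have [hz _|n fz] := boolP (z \in [set p; q]); apply/setUP;
        [by left|right].
      have [zY _ zu] := hA z zY1 n.
      by rewrite in_setD1 zu inE zY.
    apply: leq_trans (leq_card_setU _ _) _; rewrite cards2 pq.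
    by move: deficient; rewrite (cardsD1 u (K i0)) uK add1n.
  apply: leq_trans (cf i); apply: subset_leq_card; apply/subsetP => z.
  rewrite inE => /andP[zY1]; rewrite /h; case: ifP => [_|/negbT n fz].
    by rewrite eq_sym (negPf ii0).
  by have [zY _ _] := hA z zY1 n; rewrite inE zY.
Qed.
End Blocked.

(** A blocked coloring would have at least a * ((m - a) * t + 1) > (m - 1) * t
    edges. *)
Lemma few_edges_capped_colorable m t Y : 4 <= m -> #|Y| <= m * t ->
  adj_count e Y Y <= 2 * (m.-1 * t) ->
  capped_colorable e Y m t.
Proof.
move=> m4 cY nY.
apply: (@capped_colorable_ind T e e_sym e_irr m t (fun Y => #|Y| <= m * t /\
  adj_count e Y Y <= 2 * (m.-1 * t))) => //.
- lia.
- move=> {cY nY}Y x [cY nY]; split.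
    by apply: leq_trans cY; apply: subset_leq_card; apply: subD1set.
  by apply: leq_trans nY; apply: adj_count_mono; apply: subD1set.
- by move=> Z [].
move=> {cY nY}Y x f A i0 [cY nY] blk; exfalso.
have := blocked_edges blk; rewrite (card_far_side blk).
exact: arith_few m4 (card_colors blk) nY.
Qed.

(** The case left after the first exchange. With two or three accessible
    classes there would be too many edges; with only one, an exchange leads to
    few_edges_capped_colorable. *)
Lemma middle_capped_colorable m t Y : 6 <= m -> m + 2 <= t -> #|Y| <= m * t ->
  adj_count e Y Y + 10 <= 2 * ((m + 2) * t + m) ->
    (forall u, u \in Y -> deg_in Y u <= m.+1) ->
  capped_colorable e Y m t.
Proof.
move=> m6 tm cY nY dY.
apply: (@capped_colorable_ind T e e_sym e_irr m t (fun Y => [/\ #|Y| <= m * t,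
  adj_count e Y Y + 10 <= 2 * ((m + 2) * t + m) &
    (forall u, u \in Y -> deg_in Y u <= m.+1)])) => //.
- lia.
- move=> {cY nY dY}Y x [cY nY dY]; split.
  + by apply: leq_trans cY; apply: subset_leq_card; apply: subD1set.
  + by apply: leq_trans nY; rewrite leq_add2r; apply: adj_count_mono;
      apply: subD1set.
  + move=> u; rewrite in_setD1 => /andP[_ uY]; apply: leq_trans (dY u uY).
    by apply: subset_leq_card; apply/subsetP => z;
      rewrite !inE => /andP[/andP[_ ->]].
- by move=> Z [].
move=> {cY nY dY}Y x f A i0 [cY nY dY] blk.
have be := blocked_edges blk; have bc := blocked_edges_class blk;
  have cB := card_far_side blk.
have pl := peel blk dY; have /andP[a0 a3] := card_colors blk.
have t0 : 0 < t by apply: leq_trans tm; rewrite addn_gt0 orbT.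
have {a0 a3} [a1|a23] : #|A| = 1 \/ (#|A| = 2 \/ #|A| = 3).
- by move: a0 a3; case: #|A| => [|[|[|[|a]]]] // _ _;
    [left|right; left|right; right].
- rewrite a1 in bc cB pl; apply: pl; first exact: arith_mid1 m6 tm cB bc nY.
  move=> B' _ cB' eB'; apply: few_edges_capped_colorable;
    last exact: arith_mid1' m6 tm cB eB' nY.
    by rewrite leq_subRL ?(leq_trans _ m6).
  by rewrite cB'.
- by rewrite cB in be; case: (arith_mid23 m6 a23 be nY t0).
Qed.

(** One, two or three classes are accessible. In the first case an exchange
    leads to middle_capped_colorable, where the degree bound gives k < t; in
    the other two it leads directly to few_edges_capped_colorable. *)
Theorem sparse_capped_colorable k t Y : 7 <= k -> #|Y| <= k * t ->
  (forall u, u \in Y -> deg_in Y u <= k) -> capped_colorable e Y k t.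
Proof.
move=> k7 cY dY.
apply: (@capped_colorable_ind T e e_sym e_irr k t (fun Y => #|Y| <= k * t /\
  (forall u, u \in Y -> deg_in Y u <= k))) => //.
- lia.
- move=> {cY dY}Y x [cY dY]; split.
  + by apply: leq_trans cY; apply: subset_leq_card; apply: subD1set.
  + move=> u; rewrite in_setD1 => /andP[_ uY]; apply: leq_trans (dY u uY).
    by apply: subset_leq_card; apply/subsetP => z;
      rewrite !inE => /andP[/andP[_ ->]].
- by move=> Z [].
move=> {cY dY}Y x f A i0 [cY dY] blk.
have := e_sparse (blocked_gt1 blk) => sp.
have {sp} nY : adj_count e Y Y + 6 <= 4 * (k * t) by lia.
have be := blocked_edges blk; have bc := blocked_edges_class blk;
  have cB := card_far_side blk.
have ce := class_edges blk dY; have cg := class_edges_ge blk.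
have pl := peel blk dY; have /andP[a0 a3] := card_colors blk.
have t0 : 0 < t by case: blk => _ _ _ [_ h _ _ _]; apply: leq_ltn_trans h.
have km a : a <= 3 -> 4 <= k - a by move=> a_3; rewrite leq_subRL;
  move: k7 a_3; clear; lia.
have {a0 a3} [a1|[a2|a3]] : #|A| = 1 \/ #|A| = 2 \/ #|A| = 3.
- by move: a0 a3; case: #|A| => [|[|[|[|a]]]] // _ _;
    [left|right; left|right; right].
- rewrite a1 in cB pl; have tk := arith_top1_t k7 t0 cB cg ce.
  apply: pl; first exact: arith_top12 k7 t0 (or_introl erefl) cB ce.
  move=> B' B'Y cB' eB'; have nB' := arith_top1' k7 cB eB' nY.
  apply: middle_capped_colorable nB' _ => //; try by (move: k7 tk; clear; lia).
    by rewrite cB'.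
  move=> u uB; apply: (@leq_trans k); last by move: k7; clear; lia.
  apply: leq_trans (dY u (subsetP B'Y u uB)); apply: subset_leq_card;
    apply/subsetP => z.
  by rewrite !inE => /andP[zB ->]; rewrite (subsetP B'Y).
- rewrite a2 in cB pl; apply: pl;
    first exact: arith_top12 k7 t0 (or_intror erefl) cB ce.
  move=> B' _ cB' eB'; apply: few_edges_capped_colorable; first exact: km;
    first by rewrite cB'.
  exact: arith_top23' k7 t0 (or_introl erefl) cB eB' nY.
- rewrite a3 in bc cB pl; apply: pl; first exact: arith_top3 k7 t0 cB bc nY.
  move=> B' _ cB' eB'; apply: few_edges_capped_colorable; first exact: km;
    first by rewrite cB'.
  exact: arith_top23' k7 t0 (or_intror erefl) cB eB' nY.
Qed.
End Peel.

(** * Equitable colorings of sparse graphs *)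

Section Padding.
Variables (T : finType) (e : rel T) (p : nat).

(** A clique on p extra vertices uses p distinct colors, so that removing it
    from an equitable coloring leaves an equitable coloring. *)
Definition add_clique : rel (T + 'I_p) := fun a b =>
  match a, b with
  | inl x, inl y => e x y
  | inr i, inr j => i != j
  | _, _ => false
  end.

Lemma card_sum_set (X : {set T + 'I_p}) :
  #|X| = #|[set x | inl x \in X]| + #|[set j | inr j \in X]|.
Proof.
rewrite -!sum1_card big_mkcond big_sumType /=.
by congr (_ + _); rewrite [RHS]big_mkcond; apply: eq_bigr => x _; rewrite inE.
Qed.

Lemma add_clique_sym : symmetric e -> symmetric add_clique.
Proof. by move=> e_sym [x|i] [y|j] //=; rewrite eq_sym. Qed.

Lemma add_clique_irr : irreflexive e -> irreflexive add_clique.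
Proof. by move=> e_irr [x|i] /=; rewrite ?eqxx. Qed.

Lemma adj_count_add_clique (X : {set T + 'I_p}) :
  adj_count add_clique X X = adj_count e [set x | inl x \in X]
    [set x | inl x \in X] +
    #|[set j | inr j \in X]| * #|[set j | inr j \in X]|.-1.
Proof.
rewrite /adj_count big_mkcond big_sumType /=; congr (_ + _).
  rewrite [RHS]big_mkcond; apply: eq_bigr => x _; rewrite inE;
    case: ifP => // _.
  rewrite big_mkcond big_sumType /= [X in _ + X]big1 ?addn0;
    last by move=> i _; case: ifP.
  by rewrite [RHS]big_mkcond; apply: eq_bigr => y _; rewrite inE.
rewrite -sum_nat_const big_mkcond [RHS]big_mkcond; apply: eq_bigr => i _.
rewrite [i \in [set _ | _]]inE; case: ifP => // iX.
rewrite big_mkcond big_sumType /= big1 ?add0n; last by move=> x _; case: ifP.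
rewrite (cardsD1 i [set j | _]) inE iX /= -sum1_card [RHS]big_mkcond;
  apply: eq_bigr => j _.
by rewrite !inE eq_sym; case: (inr j \in X); case: (j == i).
Qed.

(** A triangle still satisfies the bound 2 * 3 - 3. *)
Lemma add_clique_sparse : irreflexive e -> p <= 3 -> sparse e ->
  sparse add_clique.
Proof.
move=> e_irr p3 sp X; rewrite adj_count_add_clique card_sum_set.
set X1 := [set x | _]; set X2 := [set j | _].
have q3 : #|X2| <= 3 by apply: leq_trans p3; rewrite -[leqRHS]card_ord max_card.
move: q3; move: #|X2| => q q3.
have [gt1|le1] := ltnP 1 #|X1|.
  have := sp X1 gt1; move: (adj_count e X1 X1) #|X1|; move: q3.
  by case: q => [|[|[|[|q]]]] //=; clear; lia.
have -> : adj_count e X1 X1 = 0.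
  have [->|X0] := eqVneq X1 set0; first by rewrite /adj_count big_set0.
  have /cards1P[x ->] : #|X1| == 1 by rewrite eqn_leq le1 card_gt0.
  exact: adj_count11.
move: le1 q3; move: #|X1| => n1; clear.
by case: n1 => [|[|n1]] //; case: q => [|[|[|[|q]]]].
Qed.
End Padding.

Section Equitable.
Variables (T : finType) (e : rel T) (k : nat).
Hypotheses (e_sym : symmetric e) (e_irr : irreflexive e) (e_sparse : sparse e).
Hypotheses (k7 : 7 <= k) (e_deg : forall u, #|[set v | e u v]| <= k).
Implicit Types (Y : {set T}).

Definition equitable_on Y := exists f : T -> 'I_k, proper_on e Y f /\
  forall i j, #|color_class Y f i| <= #|color_class Y f j|.+1.

Lemma sum_color_class (V : finType) (Z : {set V}) (f : V -> 'I_k) :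
  \sum_i #|color_class Z f i| = #|Z|.
Proof.
have := card_color_class Z f setT; rewrite (_ : [set z in Z | _] = Z);
  last first.
  by apply/setP => z; rewrite !inE andbT.
by move=> ->; apply: eq_bigl => i; rewrite inE.
Qed.

(** All classes of the padded graph have exactly t vertices, and each loses at
    most one when the clique is removed. *)
Lemma equitable_pad Y t p : p <= 3 -> #|Y| + p = k * t -> equitable_on Y.
Proof.
move=> p3 cY; pose e' := @add_clique T e p.
pose Y' : {set T + 'I_p} := [set a | if a is inl y then y \in Y else true].
have cY' : #|Y'| = k * t.
  rewrite card_sum_set -cY; congr (_ + _); first by apply: eq_card => y;
    rewrite !inE.
  by rewrite -[RHS]card_ord; apply: eq_card => j; rewrite !inE.
have [||||u _|g [pg cg]] := @sparse_capped_colorable _ e' _ _ _ k t Y' k7.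
- exact: add_clique_sym.
- exact: add_clique_irr.
- exact: add_clique_sparse.
- by rewrite cY'.
- rewrite /deg_in card_sum_set; case: u => [x|i].
    rewrite [X in _ + X](_ : _ = 0) ?addn0; last first.
      by apply/eqP; rewrite cards_eq0; apply/eqP/setP => j;
        rewrite !inE /= ?andbF.
    apply: leq_trans (e_deg x); apply: subset_leq_card; apply/subsetP => y.
    by rewrite !inE => /andP[].
  rewrite (_ : #|[set x | _]| = 0) ?add0n; last first.
    by apply/eqP; rewrite cards_eq0; apply/eqP/setP => j;
      rewrite !inE /= ?andbF.
  apply: leq_trans (max_card _) _; rewrite card_ord; apply: leq_trans p3 _.
  exact: leq_trans k7.
have full i : #|color_class Y' g i| = t.
  apply/eqP; rewrite eqn_leq cg leqNgt; apply/negP => lt.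
  have : \sum_(j : 'I_k) #|color_class Y' g j| < k * t.
    rewrite -[X in _ < X * _](card_ord k) -sum_nat_const (bigD1 i) //=
      [X in _ < X](bigD1 i) //=.
    by rewrite -addSn; apply: leq_add => //; apply: leq_sum => j _.
  by rewrite sum_color_class cY' ltnn.
exists (fun y => g (inl y)); split.
  by move=> y z yY zY yz; apply: pg; rewrite ?inE.
have split_cls i : #|color_class Y (fun y => g (inl y)) i| <= t <=
  #|color_class Y (fun y => g (inl y)) i|.+1.
  have := full i; rewrite card_sum_set.
  have -> : [set x | inl x \in color_class Y' g i] =
    color_class Y (fun y => g (inl y)) i.
    by apply/setP => y; rewrite !inE.
  have : #|[set j | inr j \in color_class Y' g i]| <= 1.
    rewrite leqNgt; apply/negP => /card_gt1P[a [b [ha hb ab]]].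
    move: ha hb; rewrite !inE /= => /eqP ga /eqP gb.
    have := pg (inr a) (inr b); rewrite ga gb eqxx !inE /= => H.
    by have := H isT isT ab.
  lia.
move=> i j; have := split_cls i; have := split_cls j; lia.
Qed.

(** Delete a vertex x of degree at most 3 and color the rest equitably. Either
    some smallest class contains no neighbour of x and can receive it, or
    there are at most three smallest classes; then at most two vertices are
    missing for |Y| to be a multiple of k, and equitable_pad applies. *)
Lemma equitable_exists Y : equitable_on Y.
Proof.
have [n] := ubnP #|Y|; elim: n Y => // n IH Y leY.
have k0 : 0 < k by apply: leq_trans k7.
have [Y0|Y0] := eqVneq Y set0.
  exists (fun _ => Ordinal k0); split=> [y z|i j]; first by rewrite Y0 inE.
  by rewrite (_ : color_class _ _ _ = set0) ?cards0 //; apply/setP => z;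
    rewrite !inE Y0 inE.
have [x xY dx] := sparse_low_degree e_sparse Y0.
have [|f [pf eqf]] := IH (Y :\ x); first by move: leY; rewrite (cardsD1 x) xY.
pose s i := #|color_class (Y :\ x) f i|.
have [i0 _ imin] := @arg_minnP _ (Ordinal k0) xpredT s isT.
pose M := [set i | s i == s i0].
have s2 i : s i = s i0 + (i \notin M).
  have le1 := imin i isT; have le2 : s i <= (s i0).+1 := eqf i i0.
  by rewrite inE; case: (s i =P s i0) => [->|]; rewrite ?addn0 //= addn1; lia.
have [/exists_inP[i iM nox]|] :=
  boolP [exists i in M, [forall w in color_class (Y :\ x) f i, ~~ e x w]].
  exists (fun z => if z == x then i else f z); split.
    have aux z : z \in Y -> e x z -> z != x -> f z != i.
      move=> zY xz zx; apply/negP => /eqP gz.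
      have : z \in color_class (Y :\ x) f i by rewrite !inE zx zY gz eqxx.
      by move/(forall_inP nox); rewrite xz.
    move=> y z yY zY yz; case: (y =P x) => [yx|/eqP yx];
      case: (z =P x) => [zx|/eqP zx].
    - by rewrite yx zx e_irr in yz.
    - by rewrite eq_sym; apply: aux => //; rewrite -yx.
    - by apply: aux => //; rewrite -zx e_sym.
    - by apply: pf => //; rewrite in_setD1 ?yx ?zx.
  have si : s i = s i0 by move: iM; rewrite inE => /eqP.
  have sz j : #|color_class Y (fun z => if z == x then i else f z) j| = s j +
    (j == i).
    rewrite /s; have [->|ji] := eqVneq j i.
      have -> : color_class Y (fun z => if z == x then i else f z) i =
        x |: color_class (Y :\ x) f i.
        by apply/setP => z; rewrite !inE; case: (z =P x) => [->|//];
          rewrite xY eqxx.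
      by rewrite cardsU1 !inE eqxx /= addnC.
    rewrite addn0; apply: eq_card => z; rewrite !inE.
    by case: (z =P x) => //= _; rewrite eq_sym (negPf ji) andbF.
  have bound j : s i0 <= s j + (j == i) <= (s i0).+1.
    have := s2 j; have := imin j isT; case: (j =P i) => [->|_] /=; rewrite ?si;
      lia.
  by move=> a b; rewrite !sz; have := bound a; have := bound b; lia.
rewrite negb_exists_in => /forall_inP nb.
have M3 : #|M| <= 3.
  apply: leq_trans dx; apply: leq_trans (leq_imset_card f _).
  apply: subset_leq_card; apply/subsetP => j /nb.
  rewrite negb_forall_in => /exists_inP[w wj]; rewrite negbK => xw.
  apply/imsetP; exists w; last by move: wj; rewrite inE => /andP[_ /eqP].
  by move: wj; rewrite !inE xw andbT => /andP[/andP[]].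
have M0 : 0 < #|M| by apply/card_gt0P; exists i0; rewrite inE.
have tot : #|Y :\ x| + #|M| = k * (s i0).+1.
  rewrite -(sum_color_class (Y :\ x) f) -sum1_card [X in _ + X]big_mkcond
    -big_split /=.
  rewrite -[X in X * _](card_ord k) -sum_nat_const; apply: eq_bigr => i _.
  by rewrite -/(s i) s2; case: (i \in M); rewrite ?addn0 ?addn1.
apply: (@equitable_pad Y (s i0).+1 #|M|.-1).
  by move: M3; clear; lia.
by rewrite -tot (cardsD1 x Y) xY; move: M0; clear; lia.
Qed.
End Equitable.

(** * Planar graphs without chordal 4- and 6-cycles *)

(** The faces are needed for all induced subgraphs, which inherit the
    drawing. *)
Lemma drawing_restrict (R : realType) (T : finType) (e : rel T) (X :
  {set T}) p a :
  @plane_drawing R T e p a -> plane_drawing (rel_in e X) p a.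
Proof.
by case=> *; split=> // x y =>
  [/and3P[_ _ ?]|/and3P[_ _ ?]|/and3P[_ _ ?]|/and3P[_ _ ?]|
  /and3P[_ _ ?]|z /and3P[_ _ ?]|x' y' /and3P[_ _ ?] /and3P[_ _ ?]]; eauto.
Qed.

Lemma planar_sparse (R : realType) (T : finType) (e : rel T) :
  simple_graph e -> planar R e ->
  ~ (exists c : seq T, chordal_cycle e 4 c) ->
    ~ (exists c : seq T, chordal_cycle e 6 c) ->
  sparse e.
Proof.
move=> [e_sym e_irr] [p [a D]] no4 no6.
apply: planar_faces_sparse => // X.
have r_sym := rel_in_sym e_sym X.
have r_irr : irreflexive (rel_in e X) by move=> x;
  rewrite /rel_in /= e_irr !andbF.
have [N [B gm]] := Plane.drawing_grid_model (@drawing_restrict R T e X p a D)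
  r_irr r_sym.
exact: grid_model_faces r_sym r_irr gm.
Qed.

Theorem theorem2p11 (R : realType) (T : finType) (e : rel T) (k : nat)
    (e_simple : simple_graph e)
    (e_planar : planar R e)
    (no_chordal4 : ~ exists c : seq T, chordal_cycle e 4 c)
    (no_chordal6 : ~ exists c : seq T, chordal_cycle e 6 c)
    (le_k : (maxn 7 (max_degree e) <= k)%N) :
  equitably_colorable e k.
Proof.
have sp := @planar_sparse R T e e_simple e_planar no_chordal4 no_chordal6.
have [e_sym e_irr] := e_simple.
move: le_k; rewrite geq_max => /andP[k7 dk].
have deg u : (#|[set v | e u v]| <= k)%N.
  exact: leq_trans (leq_bigmax (F := degree e) u) dk.
have [f [pf ef]] := @equitable_exists T e k e_sym e_irr sp k7 deg [set: T].
exists f; split=> [x y|i j]; first exact: pf.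
have E i' : color_class [set: T] f i' = [set x | f x == i'] by apply/setP => x;
  rewrite !inE.
by rewrite -!E.
Qed.
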